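(* Let $f:\mathbb{R}^n\to\mathbb{R}$, $g:\mathbb{R}^n\to\mathbb{R}^m$, $h:\mathbb{R}^n\to\mathbb{R}^p$ be twice continuously differentiable, let $s<n$, and consider the problem (CCOP) $$\min_x f(x)\quad\text{s.t.}\quad g(x)\le0,\ h(x)=0,\ \|x\|_0\le s.$$ Let $x^*$ be a local optimal solution of CCOP and $d\in\mathcal{C}(x^* )$. Suppose that either CCOP-SOSCMS holds at $x^*$ in direction $d$, or one of the constraint qualifications CCOP-LICQ, CCOP-NNAMCQ, CCOP-CRCQ, CCOP-RCRCQ, CCOP-CPLD, CCOP-ERCPLD, CCOP-RCPLD holds at $x^*$. Then $x^*$ is M-stationary and there exists an M-stationary multiplier $(\lambda^g,\lambda^h,\eta)$ such that $$d^T\nabla_x^2\mathcal{L}(x^*,\lambda^g,\lambda^h)d\ge0.$$ Conversely, let $x^*$ be a feasible solution of CCOP. Suppose that for every $0\ne d\in\mathcal{C}(x^* )$ there exists an S-stationary $(d)$ multiplier $(\lambda^g,\lambda^h,\eta)$ such that $d^T\nabla_x^2\mathcal{L}(x^*,\lambda^g,\lambda^h)d>0$. Then $x^*$ is a strict local minimizer of CCOP.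
   Context: Notation. $\|x\|_0$ is the number of nonzero components of $x$; $I_\pm(x)=\{i : x_i\ne0\}$, $I_0(x)=\{i : x_i=0\}$; $e_i$ are the standard basis vectors; $\mathcal{I}_s$ is the family of subsets of $\{1,\dots,n\}$ of cardinality $s$, $\mathbb{R}_{\mathcal{I}}=\operatorname{span}\{e_i : i\in\mathcal{I}\}$; $\mathcal{I}_g(x^* )=\{i : g_i(x^* )=0\}$; $\mathbb{B}_\varepsilon(x^* )$ is the open ball. A pair of families $(\{v_i\}_{i\in I},\{u_i\}_{i\in J})$ is positive linearly dependent if there are scalars $\alpha_i\ge0$ ($i\in I$), $\beta_i$ ($i\in J$), not all zero, with $\sum_{i\in I}\alpha_iv_i+\sum_{i\in J}\beta_iu_i=0$. Critical cone: $\mathcal{C}(x^* )$ is the set of $d\in\mathbb{R}^n$ with $\nabla g_i(x^* )d\le0$ for $i\in\mathcal{I}_g(x^* )$, $\nabla h_i(x^* )d=0$ for $i=1,\dots,p$, $d\in\bigcup_{I_\pm(x^* )\subseteq\mathcal{I}\in\mathcal{I}_s}\mathbb{R}_{\mathcal{I}}$, and $\nabla f(x^* )d\le0$. $\mathcal{I}_g^*(d)=\{i\in\mathcal{I}_g(x^* ) : \nabla g_i(x^* )d=0\}$. Lagrangians: $\mathcal{L}(x,\lambda^g,\lambda^h)=f(x)+\langle\lambda^g,g(x)\rangle+\langle\lambda^h,h(x)\rangle$ and $\mathcal{L}^0(x,\lambda^g,\lambda^h)=\langle\lambda^g,g(x)\rangle+\langle\lambda^h,h(x)\rangle$. Stationarity: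 $(\lambda^g,\lambda^h,\eta)\in\mathbb{R}^m\times\mathbb{R}^p\times\mathbb{R}^n$ is an M-stationary multiplier (and $x^*$ is M-stationary if one exists) if $\lambda_i^g\ge0$ for $i\in\mathcal{I}_g(x^* )$, $\lambda_i^g=0$ otherwise, $\nabla f(x^* )+\sum_{i\in\mathcal{I}_g(x^* )}\lambda^g_i\nabla g_i(x^* )+\sum_{i=1}^p\lambda_i^h\nabla h_i(x^* )+\eta=0$, $\eta_i=0$ for all $i\in I_\pm(x^* )$ and $\|\eta\|_0\le n-s$. For $d\in\mathcal{C}(x^* )$, it is an S-stationary $(d)$ multiplier if $\lambda_i^g\ge0$ for $i\in\mathcal{I}_g^*(d)$, $\lambda_i^g=0$ otherwise, $\nabla f(x^* )+\sum_{i\in\mathcal{I}_g^*(d)}\lambda^g_i\nabla g_i(x^* )+\sum_{i=1}^p\lambda_i^h\nabla h_i(x^* )+\eta=0$, and: when $|I_\pm(x^* )\cup I_\pm(d)|=s$, $\eta_i=0$ for all $i\in I_\pm(x^* )\cup I_\pm(d)$; when $|I_\pm(x^* )\cup I_\pm(d)|<s$, $\eta=0$. CCOP-SOSCMS at $x^*$ in direction $d\in\mathcal{C}(x^* )$: there is no nonzero $(\lambda^g,\lambda^h,\eta)\in\mathbb{R}^m\times\mathbb{R}^p\times\mathbb{R}^n$ with $\lambda^g_i\ge0$ for $i\in\mathcal{I}_g^*(d)$, $\lambda_i^g=0$ otherwise, $\eta_i=0$ for all $i\in I_\pm(x^* )\cup I_\pm(d)$, $\|\eta\|_0\le n-s$,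 satisfying $\sum_{i\in\mathcal{I}_g^*(d)}\lambda_i^g\nabla g_i(x^* )+\sum_{i=1}^p\lambda_i^h\nabla h_i(x^* )+\eta=0$ and $d^T\nabla_x^2\mathcal{L}^0(x^*,\lambda^g,\lambda^h)d\ge0$. Two conditions used below, for $\eta\in\mathbb{R}^n$ and an index set $K$: (E) $\eta_i=0$ for all $i\in I_\pm(x^* )$ and $\|\eta\|_0\le n-s$. (K) if $\eta\ne0$, then $I_\pm(\eta)\subseteq K\subseteq I_0(x^* )$ and $|K|\le n-s$; if $\eta=0$, then $K=\emptyset$. Constraint qualifications at a feasible $x^*$: CCOP-LICQ: the family $\{\nabla g_i(x^* )\}_{i\in\mathcal{I}_g(x^* )}\cup\{\nabla h_i(x^* )\}_{i=1}^p\cup\{e_i\}_{i\in I_0(x^* )}$ is linearly independent. CCOP-NNAMCQ: there is no nonzero $(\lambda^g,\lambda^h,\eta)\in\mathbb{R}^m\times\mathbb{R}^p\times\mathbb{R}^n$ with $\lambda^g_i\ge0$ for $i\in\mathcal{I}_g(x^* )$, $\lambda_i^g=0$ for $i\notin\mathcal{I}_g(x^* )$, $\eta$ satisfying (E), and $\sum_{i\in\mathcal{I}_g(x^* )}\lambda_i^g\nabla g_i(x^* )+\sum_{i=1}^p\lambda_i^h\nabla h_i(x^* )+\eta=0$. CCOP-RCPLD: (i) there is $\varepsilon>0$ such that $\{\nabla h_i(x)\}_{i=1}^p$ has the same rank for all $x\in\mathbb{B}_\varepsilon(x^* )$; (ii) let $J\subseteq\{1,\dots,p\}$ be such that $\{\nabla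 h_i(x^* )\}_{i\in J}$ is a basis of $\operatorname{span}\{\nabla h_i(x^* )\}_{i=1}^p$. Whenever there are $I\subseteq\mathcal{I}_g(x^* )$ and $(\lambda^g_i)_{i\in I}$, $(\lambda_i^h)_{i\in J}$, $\eta$, not all zero, with $\lambda_i^g\ge0$ for $i\in I$, $\eta$ satisfying (E), and $\sum_{i\in I}\lambda_i^g\nabla g_i(x^* )+\sum_{i\in J}\lambda_i^h\nabla h_i(x^* )+\eta=0$, then for every sequence $x^k\to x^*$, $x^k\ne x^*$, and every $K$ satisfying (K), the family $\{\nabla g_i(x^k)\}_{i\in I}\cup\{\nabla h_i(x^k)\}_{i\in J}\cup\{e_i\}_{i\in K}$ is linearly dependent for all sufficiently large $k$. CCOP-CPLD: condition (ii) of CCOP-RCPLD holds with $J$ taken to be an arbitrary subset of $\{1,\dots,p\}$. CCOP-CRCQ: for all index sets $I\subseteq\mathcal{I}_g(x^* )$, $J\subseteq\{1,\dots,p\}$, every $\eta$ satisfying (E), every $K$ satisfying (K) and every sequence $x^k\to x^*$, $x^k\ne x^*$, the families $\{\nabla g_i(x^* )\}_{i\in I}\cup\{\nabla h_i(x^* )\}_{i\in J}\cup\{e_i\}_{i\in K}$ and $\{\nabla g_i(x^k)\}_{i\in I}\cup\{\nabla h_i(x^k)\}_{i\in J}\cup\{e_i\}_{i\in K}$ have the same rank for all sufficiently large $k$. CCOP-RCRCQ: as CCOP-CRCQ, but only with $J=\{1,\dots,p\}$. CCOP-ERCPLD: (i) as in CCOP-RCPLD; (ii) let $J$ be as in CCOP-RCPLD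 (ii). Whenever $I\subseteq\mathcal{I}_g(x^* )$, $\eta$ satisfies (E), $K$ satisfies (K), and the pair $(\{\nabla g_i(x^* )\}_{i\in I},\{\nabla h_i(x^* )\}_{i\in J}\cup\{e_i\}_{i\in K})$ is positive linearly dependent, then for every sequence $x^k\to x^*$, $x^k\ne x^*$, the family $\{\nabla g_i(x^k)\}_{i\in I}\cup\{\nabla h_i(x^k)\}_{i\in J}\cup\{e_i\}_{i\in K}$ is linearly dependent for all sufficiently large $k$. *)

(* Defs.v *)
From mathcomp Require Import all_boot all_order all_algebra.
From mathcomp Require Import boolp classical_sets reals topology normedtype.
From mathcomp Require Import landau sequences derive.

Set Implicit Arguments.
Unset Strict Implicit.
Unset Printing Implicit Defensive.

Import Order.TTheory GRing.Theory Num.Theory.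
Import numFieldNormedType.Exports.

Local Open Scope ring_scope.

(* R^n is 'rV[R]_n with the library's topology.  Its balls are those of the
   max norm; below they occur only through "there is an epsilon > 0", for which
   the max norm and the Euclidean norm are interchangeable. *)

Section Calculus.
Context {R : realType} {n : nat}.
Implicit Types (f : 'rV[R]_n -> R) (x d : 'rV[R]_n).

Definition evec (i : 'I_n) : 'rV[R]_n := delta_mx ord0 i.

Definition dot k (u v : 'rV[R]_k) : R := \sum_(i < k) u ord0 i * v ord0 i.

Definition grad f x : 'rV[R]_n := \row_(i < n) 'D_(evec i) f x.

Definition hessian f x : 'M[R]_n := 'J (grad f) x.

Definition quadform (A : 'M[R]_n) d : R := (d *m A *m d^T) ord0 ord0.

Definition C2 f : Prop :=
  [/\ forall x, differentiable f x,
      forall x, differentiable (grad f) x &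
      continuous (hessian f)].

Definition coordf k (g : 'rV[R]_n -> 'rV[R]_k) (i : 'I_k) : 'rV[R]_n -> R :=
  fun x => g x ord0 i.

Definition C2_vec k (g : 'rV[R]_n -> 'rV[R]_k) : Prop :=
  forall i : 'I_k, C2 (coordf g i).

(* I_{+-}(x), I_0(x) and the number of nonzero components of x *)
Definition supp x : {set 'I_n} := [set i | x ord0 i != 0]%SET.
Definition zeros x : {set 'I_n} := [set i | x ord0 i == 0]%SET.
Definition norm0 x : nat := #|supp x|.

Definition coord_space (I : {set 'I_n}) : {vspace 'rV[R]_n} :=
  <<[seq evec i | i in I]>>%VS.

(* Families of vectors are sequences, so that repetitions count: their linear
   independence is [free] and their rank is the dimension of their span. *)
Definition rank (vs : seq 'rV[R]_n) : nat := \dim <<vs>>%VS.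

Definition pos_lin_dep (vs us : seq 'rV[R]_n) : Prop :=
  exists (a : 'I_(size vs) -> R) (b : 'I_(size us) -> R),
    [/\ forall i, 0 <= a i,
        (exists i, a i != 0) \/ (exists j, b j != 0) &
        \sum_i a i *: vs`_i + \sum_j b j *: us`_j = 0].

End Calculus.

Section CCOP.
Context {R : realType} {n m p : nat}.
Context (s : nat) (f : 'rV[R]_n -> R).
Context (g : 'rV[R]_n -> 'rV[R]_m) (h : 'rV[R]_n -> 'rV[R]_p).
Implicit Types (x xs d eta : 'rV[R]_n) (lg : 'rV[R]_m) (lh : 'rV[R]_p).
Implicit Types (I : {set 'I_m}) (J : {set 'I_p}) (K : {set 'I_n}).

Definition feasible x : Prop :=
  [/\ forall i, g x ord0 i <= 0, h x = 0 & (norm0 x <= s)%N].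

Definition local_minimizer xs : Prop :=
  feasible xs /\ exists2 e : R, 0 < e &
    forall x, ball xs e x -> feasible x -> f xs <= f x.

Definition strict_local_minimizer xs : Prop :=
  feasible xs /\ exists2 e : R, 0 < e &
    forall x, ball xs e x -> feasible x -> x != xs -> f xs < f x.

Definition active xs : {set 'I_m} := [set i | g xs ord0 i == 0]%SET.

Definition active_dir xs d : {set 'I_m} :=
  [set i in active xs | dot (grad (coordf g i) xs) d == 0]%SET.

Definition critical_cone xs d : Prop :=
  [/\ forall i, i \in active xs -> dot (grad (coordf g i) xs) d <= 0,
      forall i, dot (grad (coordf h i) xs) d = 0,
      exists I : {set 'I_n},
        [/\ supp xs \subset I, #|I| = s & d \in coord_space I] &
      dot (grad f xs) d <= 0].

Definition lagrangian x lg lh : R := f x + dot lg (g x) + dot lh (h x).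
Definition lagrangian0 x lg lh : R := dot lg (g x) + dot lh (h x).

Definition hess_lagrangian xs lg lh : 'M[R]_n :=
  hessian (fun x => lagrangian x lg lh) xs.
Definition hess_lagrangian0 xs lg lh : 'M[R]_n :=
  hessian (fun x => lagrangian0 x lg lh) xs.

Definition grad_comb xs I J lg lh eta : 'rV[R]_n :=
  \sum_(i in I) lg ord0 i *: grad (coordf g i) xs
  + \sum_(j in J) lh ord0 j *: grad (coordf h j) xs + eta.

Definition nonneg_on I lg : Prop :=
  (forall i, i \in I -> 0 <= lg ord0 i) /\
  (forall i, i \notin I -> lg ord0 i = 0).

Definition vanishes_on K eta : Prop := forall i, i \in K -> eta ord0 i = 0.

Definition condE xs eta : Prop :=
  vanishes_on (supp xs) eta /\ (norm0 eta <= n - s)%N.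

Definition condK xs eta K : Prop :=
  (eta != 0 ->
     [/\ supp eta \subset K, K \subset zeros xs & (#|K| <= n - s)%N]) /\
  (eta = 0 -> K = finset.set0).

Definition M_multiplier xs lg lh eta : Prop :=
  [/\ nonneg_on (active xs) lg,
      grad f xs + grad_comb xs (active xs) finset.setT lg lh eta = 0 &
      condE xs eta].

Definition M_stationary xs : Prop :=
  exists lg lh eta, M_multiplier xs lg lh eta.

Definition S_multiplier xs d lg lh eta : Prop :=
  let D := supp xs :|: supp d in
  [/\ nonneg_on (active_dir xs d) lg,
      grad f xs + grad_comb xs (active_dir xs d) finset.setT lg lh eta = 0,
      #|D| = s -> vanishes_on D eta &
      (#|D| < s)%N -> eta = 0].

Definition SOSCMS xs d : Prop :=
  ~ exists lg lh eta,
    [/\ [\/ lg != 0, lh != 0 | eta != 0],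
        nonneg_on (active_dir xs d) lg,
        vanishes_on (supp xs :|: supp d) eta /\ (norm0 eta <= n - s)%N,
        grad_comb xs (active_dir xs d) finset.setT lg lh eta = 0 &
        0 <= quadform (hess_lagrangian0 xs lg lh) d].

Definition fam_g x I : seq 'rV[R]_n := [seq grad (coordf g i) x | i in I].
Definition fam_h x J : seq 'rV[R]_n := [seq grad (coordf h j) x | j in J].
Definition fam_e K : seq 'rV[R]_n := [seq evec i | i in K].
Definition fam x I J K : seq 'rV[R]_n := fam_g x I ++ fam_h x J ++ fam_e K.

Definition for_large_k_along_sequences xs (P : 'rV[R]_n -> Prop) : Prop :=
  forall xk : nat -> 'rV[R]_n,
    (xk @ \oo --> xs)%classic -> (forall k, xk k != xs) ->
    exists N, forall k, (N <= k)%N -> P (xk k).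

Definition LICQ xs : Prop := free (fam xs (active xs) finset.setT (zeros xs)).

Definition NNAMCQ xs : Prop :=
  ~ exists lg lh eta,
    [/\ [\/ lg != 0, lh != 0 | eta != 0],
        nonneg_on (active xs) lg,
        condE xs eta &
        grad_comb xs (active xs) finset.setT lg lh eta = 0].

Definition h_constant_rank xs : Prop :=
  exists2 e : R, 0 < e &
    forall x y, ball xs e x -> ball xs e y ->
      rank (fam_h x finset.setT) = rank (fam_h y finset.setT).

Definition h_basis xs J : Prop :=
  basis_of <<fam_h xs finset.setT>>%VS (fam_h xs J).

(* only the entries of lg in I and of lh in J matter here *)
Definition CPLD_for xs J : Prop :=
  forall I lg lh eta,
    I \subset active xs ->
    [\/ exists2 i, i \in I & lg ord0 i != 0,
        exists2 j, j \in J & lh ord0 j != 0 | eta != 0] ->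
    (forall i, i \in I -> 0 <= lg ord0 i) ->
    condE xs eta ->
    grad_comb xs I J lg lh eta = 0 ->
    forall K, condK xs eta K ->
      for_large_k_along_sequences xs (fun x => ~~ free (fam x I J K)).

Definition RCPLD xs : Prop :=
  h_constant_rank xs /\ forall J, h_basis xs J -> CPLD_for xs J.

Definition CPLD xs : Prop := forall J, CPLD_for xs J.

Definition CRCQ_for xs J : Prop :=
  forall I eta K,
    I \subset active xs -> condE xs eta -> condK xs eta K ->
    for_large_k_along_sequences xs
      (fun x => rank (fam x I J K) = rank (fam xs I J K)).

Definition CRCQ xs : Prop := forall J, CRCQ_for xs J.

Definition RCRCQ xs : Prop := CRCQ_for xs finset.setT.

Definition ERCPLD xs : Prop :=
  h_constant_rank xs /\
  forall J, h_basis xs J ->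
  forall I eta K,
    I \subset active xs -> condE xs eta -> condK xs eta K ->
    pos_lin_dep (fam_g xs I) (fam_h xs J ++ fam_e K) ->
    for_large_k_along_sequences xs (fun x => ~~ free (fam x I J K)).

End CCOP.

(* Main.v *)
Require Import Defs.
From mathcomp Require Import all_boot all_order all_algebra.
From mathcomp Require Import boolp classical_sets functions reals topology normedtype.
From mathcomp Require Import landau sequences derive realfun.
From mathcomp Require Import ring lra.
Import Order.TTheory GRing.Theory Num.Theory.
Import numFieldNormedType.Exports.
Set Implicit Arguments.
Unset Strict Implicit.
Unset Printing Implicit Defensive.
Local Open Scope ring_scope.
Local Open Scope classical_set_scope.

(** The necessary condition.  Choose an index set [I] with [s] elements that
    contains the supports of [xs] and of [d].  Every point supported in [I]
    meets the cardinality constraint, so [xs] is a local minimizer of the smooth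
    problem with constraints [g <= 0], [h = 0] and [x_i = 0] for [i] outside [I],
    and [d] is a critical direction of that problem.  The multipliers [eta] of
    the constraints [x_i = 0] vanish on [I]: they have at most [n - s] nonzero
    entries and are zero on both supports.  Multipliers of the smooth problem are
    therefore M-stationary, and the question is whether one of them has
    nonnegative curvature along [d].

    The tool for this is a second-order Fritz John theorem that holds without
    constraint qualification ([second_order_FJ]).  Write the problem as a system
    of (in)equalities that has no solution near [xs], the objective being the
    slightly shifted inequality [f - f xs + t^3 <= 0].  For small [t], minimise
    over [u] the euclidean norm of the residuals of the system plus
    [|u - xs - t d|^2 / t].  Since [d] is critical, the residuals at [xs + t d]
    are [O(t^2)]; hence the minimiser [u_t] lies at distance [O(t^(3/2))] from
    [xs + t d].  The normalised residuals at [u_t] are multipliers of norm one for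
    which the combination of gradients is [O(sqrt t)].  Let [Lam] be a limit of
    them.  Its combination of gradients is zero, so along [u_t] the combination
    of the functions is [t^2 / 2] times the curvature along [d], up to [o(t^2)].
    It is also at least [- O(t^3)], because a nonzero [Lam] has eventually the
    sign of its residual.  So the curvature is nonnegative.

    If CCOP-SOSCMS holds, the multiplier of the objective cannot be zero, and the
    result follows by dividing by it.  If one of the constraint qualifications
    holds, then [f] plus a multiple of the sum of the residuals has a local
    minimum at [xs] ([exact_penalty]).  This function is a maximum of finitely many
    smooth functions [f + kap * sum_t w_t c_t], one for each choice of weights
    [w].  Applied to these functions, the Fritz John theorem has no
    abnormal case, since each of them contains [f]
    ([multipliers_of_exact_penalty]).

    The exact penalty property needs one fact about the constraints: near [xs],
    any combination of their gradients with admissible signs can be rewritten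
    with coefficients of the order of its norm ([bounded_multipliers]).  All
    seven qualifications give it through one property, [qualification].  First
    express the gradients of [h] through those of a subfamily that is a basis of
    their span at all nearby points; then make the family linearly independent by
    Caratheodory's theorem.  A family of gradients that is linearly independent
    at points arbitrarily close to [xs] admits no abnormal combination at [xs],
    by [qualification], and then compactness bounds its coefficients
    ([bounded_reduction]).

    The sufficient condition.  If it fails, there are feasible points tending to
    [xs], all supported in one set [I] with [s] elements, at which [f] is at most
    [f xs].  Their normalised displacements have a limit [d], which is critical.
    For an S-stationary multiplier in direction [d], [eta] is orthogonal to these
    displacements, so the Lagrangian does not exceed its value at [xs] along the
    sequence, against its positive curvature. *)

(** * Inner product and norm *)

Lemma cvg_sumr (R : realType) (V : normedModType R) (T : Type)
    (F : set_system T) (FF : Filter F) (I : finType) (f : I -> T -> V) a :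
  (forall i, f i x @[x --> F] --> a i) ->
  \sum_i f i x @[x --> F] --> \sum_i a i.
Proof. by move=> fa; apply: cvg_big => //; exact: add_continuous. Qed.

Lemma sum_unit (V : nmodType) (F : unit -> V) : \sum_t F t = F tt.
Proof. by rewrite (bigD1 tt) //= big1 ?addr0 // => -[]. Qed.

Section Dot.
Context {R : realType} {n : nat}.
Implicit Types u v w : 'rV[R]_n.

Lemma dotC u v : dot u v = dot v u.
Proof. by apply: eq_bigr => i _; rewrite mulrC. Qed.

Lemma dotDl u v w : dot (u + v) w = dot u w + dot v w.
Proof. by rewrite -big_split; apply: eq_bigr => i _; rewrite mxE mulrDl. Qed.

Lemma dotZl a u w : dot (a *: u) w = a * dot u w.
Proof. by rewrite mulr_sumr; apply: eq_bigr => i _; rewrite mxE mulrA. Qed.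

Lemma dotDr u v w : dot w (u + v) = dot w u + dot w v.
Proof. by rewrite dotC dotDl !(dotC w). Qed.

Lemma dotZr a u w : dot w (a *: u) = a * dot w u.
Proof. by rewrite dotC dotZl dotC. Qed.

Lemma dotNl u w : dot (- u) w = - dot u w.
Proof. by rewrite -scaleN1r dotZl mulN1r. Qed.

Lemma dotNr u w : dot w (- u) = - dot w u.
Proof. by rewrite -scaleN1r dotZr mulN1r. Qed.

Lemma dotBl u v w : dot (u - v) w = dot u w - dot v w.
Proof. by rewrite dotDl dotNl. Qed.

Lemma dotBr u v w : dot w (u - v) = dot w u - dot w v.
Proof. by rewrite dotDr dotNr. Qed.

Lemma dot0l w : dot 0 w = 0.
Proof. by rewrite -(scale0r 0) dotZl mul0r. Qed.

Lemma dot_suml (I : finType) (F : I -> 'rV[R]_n) w :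
  dot (\sum_i F i) w = \sum_i dot (F i) w.
Proof.
by elim/big_ind2: _ => // [|x a y b <- <-]; rewrite ?dot0l ?dotDl.
Qed.

Lemma norm_coord u i : `|u ord0 i| <= `|u|.
Proof.
rewrite [leRHS]/Num.norm /= mx_normrE.
by apply/bigmax_geP; right => /=; exists (ord0, i).
Qed.

Lemma norm_le_coord u (e : R) :
  0 <= e -> (forall i, `|u ord0 i| <= e) -> `|u| <= e.
Proof.
move=> e0 ue; rewrite [leLHS]/Num.norm /= mx_normrE.
by apply/bigmax_leP; split => //= -[i j] _; rewrite (ord1 i).
Qed.

Lemma norm_dot u v : `|dot u v| <= n%:R * `|u| * `|v|.
Proof.
apply: le_trans (ler_norm_sum _ _ _) _.
apply: (@le_trans _ _ (\sum_(i < n) `|u| * `|v|)).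
  by apply: ler_sum => i _; rewrite normrM ler_pM // norm_coord.
by rewrite sumr_const card_ord -mulrA mulr_natl.
Qed.

Lemma dot_ge0 u : 0 <= dot u u.
Proof. by apply: sumr_ge0 => i _; rewrite -expr2 sqr_ge0. Qed.

Lemma sqr_norm_le_dot u : `|u| ^+ 2 <= dot u u.
Proof.
suff H : `|u| <= Num.sqrt (dot u u).
  by rewrite -(sqr_sqrtr (dot_ge0 u)) ler_sqr ?nnegrE // sqrtr_ge0.
apply: norm_le_coord; first exact: sqrtr_ge0.
move=> i; rewrite -sqrtr_sqr; apply: ler_wsqrtr; rewrite /dot (bigD1 i) //=.
by rewrite -expr2 lerDl; apply: sumr_ge0 => j _; rewrite -expr2 sqr_ge0.
Qed.

Lemma dot_le_sqr_norm u : dot u u <= n%:R * `|u| ^+ 2.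
Proof. by apply: le_trans (ler_norm _) _; rewrite expr2 mulrA norm_dot. Qed.

Lemma dot_evec i u : dot (evec i) u = u ord0 i.
Proof.
rewrite /dot (bigD1 i) //= big1 => [|j ji]; rewrite /evec mxE eqxx /=.
  by rewrite eqxx mul1r addr0.
by rewrite (negPf ji) mul0r.
Qed.

Lemma cvg_dot (T : Type) (F : set_system T) (FF : Filter F)
    (u v : T -> 'rV[R]_n) a b :
  u x @[x --> F] --> a -> v x @[x --> F] --> b ->
  dot (u x) (v x) @[x --> F] --> dot a b.
Proof.
move=> ua vb; apply: cvg_sumr => i.
apply: cvgM.
  exact: (cvg_comp _ _ ua (@coord_continuous R 1 n ord0 i a)).
exact: (cvg_comp _ _ vb (@coord_continuous R 1 n ord0 i b)).
Qed.

End Dot.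

(** * Taylor expansions of twice continuously differentiable functions *)

Section Smooth.
Context {R : realType} {n : nat}.
Implicit Types (F : 'rV[R]_n -> R) (x v d xs : 'rV[R]_n).

Lemma derive_grad F x v : differentiable F x -> 'D_v F x = dot (grad F x) v.
Proof.
move=> dF; rewrite deriveE //.
have -> : v = \sum_(i < n) v ord0 i *: evec i by exact: row_sum_delta.
rewrite linear_sum dotC dot_suml; apply: eq_bigr => i _.
by rewrite linearZ /= dotZl dot_evec mxE deriveE.
Qed.

Lemma is_derive_line F x v (r : R) : differentiable F (x + r *: v) ->
  is_derive r (1 : R) (fun r => F (x + r *: v)) (dot (grad F (x + r *: v)) v).
Proof.
move=> dF.
have dl : is_diff r (fun r : R => x + r *: v) ( *:%R^~ v).
  apply: is_diff_eq (is_diffD (is_diff_cst x r) (is_diff_scalel r v)) _.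
  by apply/funext => y; transitivity (0 + y *: v) => //; rewrite add0r.
have dc : differentiable (F \o (fun r : R => x + r *: v)) r.
  exact: differentiable_comp.
apply: DeriveDef; first exact: diff_derivable.
rewrite deriveE // diff_comp //= diff_val /= scale1r -deriveE //.
exact: derive_grad.
Qed.

Lemma seg_MVT F x v : (forall y, differentiable F y) ->
  exists c : R, [/\ 0 <= c, c <= 1 &
    F (x + v) - F x = dot (grad F (x + c *: v)) v].
Proof.
move=> dF.
have cF : {within `[0, 1], continuous (fun r : R => F (x + r *: v))}.
  apply: continuous_subspaceT => r; apply/differentiable_continuous.
  by apply/derivable1_diffP; have [] := is_derive_line (dF (x + r *: v)).
have [c] := MVT_segment ler01 (fun r _ => is_derive_line (dF (x + r *: v))) cF.
rewrite in_itv /= => /andP[c0 c1]; rewrite scale1r scale0r addr0 subr0 mulr1.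
by exists c.
Qed.

End Smooth.

Section C2facts.
Context {R : realType} {n : nat}.
Implicit Types (F : 'rV[R]_n -> R) (x v d xs : 'rV[R]_n).

Lemma derive_coord (G : 'rV[R]_n -> 'rV[R]_n) z v i : differentiable G z ->
  'D_v (fun y => G y ord0 i) z = ('D_v G z) ord0 i.
Proof.
move=> dG; have /cvg_ex[/= l Gl] : derivable G z v by exact: diff_derivable.
rewrite /derive (cvg_lim _ Gl) //; apply: cvg_lim => //.
have := cvg_comp _ _ Gl (@coord_continuous R 1 n ord0 i l).
apply: cvg_trans; apply: near_eq_cvg; near=> r.
by rewrite /= !mxE.
Unshelve. all: by end_near. Qed.

Lemma differentiable_coordf (G : 'rV[R]_n -> 'rV[R]_n) z i :
  differentiable G z -> differentiable (fun y => G y ord0 i) z.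
Proof.
move=> dG; apply: (@differentiable_comp _ _ _ _ G (fun y => y ord0 i)) => //.
exact: differentiable_coord.
Qed.

Lemma norm_mulmx_le v (A : 'M[R]_n) : `|v *m A| <= n%:R * `|v| * `|A|.
Proof.
apply: norm_le_coord => [|j]; first by rewrite !mulr_ge0.
rewrite mxE; apply: le_trans (ler_norm_sum _ _ _) _.
apply: (@le_trans _ _ (\sum_(i < n) `|v| * `|A|)).
  apply: ler_sum => i _; rewrite normrM ler_pM ?norm_coord //.
  rewrite [leRHS]/Num.norm /= mx_normrE.
  by apply/bigmax_geP; right => /=; exists (i, j).
by rewrite sumr_const card_ord -mulrA mulr_natl.
Qed.

Lemma near_norm_lt xs (P : 'rV[R]_n -> Prop) :
  (\forall x \near xs, P x) <->
  exists2 e : R, 0 < e & forall x, `|x - xs| < e -> P x.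
Proof.
split=> [/nbhs_ballP[e /= e0 H]|[e e0 H]].
  by exists e => // x xe; apply: H; rewrite -ball_normE /= distrC.
apply/nbhs_ballP; exists e => //= x; rewrite -ball_normE /= distrC => ?.
exact: H.
Qed.

Lemma norm_segment xs x v (c e : R) : 0 <= c <= 1 ->
  `|x - xs| < e -> `|x + v - xs| < e -> `|x + c *: v - xs| < e.
Proof.
move=> /andP[c0 c1] xe ve.
have -> : x + c *: v - xs = (1 - c) *: (x - xs) + c *: (x + v - xs).
  by apply/rowP => i; rewrite !mxE; ring.
apply: le_lt_trans (ler_normD _ _) _; rewrite !normrZ !ger0_norm ?subr_ge0 //.
have [->|cN0] := eqVneq c 0; first by rewrite subr0 mul1r mul0r addr0.
have c_gt0 : 0 < c by rewrite lt_neqAle eq_sym cN0.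
have -> : e = (1 - c) * e + c * e by rewrite -mulrDl subrK mul1r.
by rewrite ler_ltD ?ltr_pM2l // ler_wpM2l ?subr_ge0 // ltW.
Qed.

(** The mean value theorem for each partial derivative, whose own gradient is
    bounded near [xs] because the Hessian is continuous. *)
Lemma C2_grad_lipschitz F xs : C2 F -> exists C e : R, [/\ 0 <= C, 0 < e &
  forall x v, `|x - xs| < e -> `|x + v - xs| < e ->
    `|grad F (x + v) - grad F x| <= C * `|v|].
Proof.
move=> [dF dG cH].
have : \forall z \near xs, `|hessian F z| <= `|hessian F xs| + 1.
  by apply: cvgr_norm_le (cH xs) _ _; rewrite ltrDl.
move=> /near_norm_lt[e e0 He].
exists (n%:R * (`|hessian F xs| + 1)), e; split=> // [|x v xe ve].
  by rewrite mulr_ge0 // addr_ge0.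
apply: norm_le_coord => [|i]; first by rewrite !mulr_ge0 // addr_ge0.
rewrite !mxE.
have [c [c0 c1]] := @seg_MVT _ _ (fun y => grad F y ord0 i) x v
  (fun y => differentiable_coordf i (dG y)).
rewrite -derive_grad; last exact: differentiable_coordf.
rewrite derive_coord // deriveEjacobian // => cE.
have := congr1 Num.norm cE; rewrite !mxE => ->.
have -> : (\sum_j v ord0 j * jacobian (grad F) (x + c *: v) j i) =
   (v *m hessian F (x + c *: v)) ord0 i by rewrite !mxE.
apply: le_trans (norm_coord _ _) _; apply: le_trans (norm_mulmx_le _ _) _.
rewrite -!mulrA ler_wpM2l // mulrC ler_wpM2r // He //.
by apply: norm_segment => //; rewrite c0.
Qed.

(** Both points vary, so the expansion can be used at minimisers that are only
    known to be close to [xs]. *)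
Lemma C2_quadratic_remainder F xs : C2 F -> exists C e : R, [/\ 0 <= C, 0 < e &
  forall x y, `|x - xs| < e -> `|y - xs| < e ->
    `|F y - F x - dot (grad F x) (y - x)| <= C * `|y - x| ^+ 2].
Proof.
move=> hF; have [C [e [C0 e0 HC]]] := C2_grad_lipschitz xs hF.
exists (n%:R * C), e; split=> // [|x y xe ye]; first exact: mulr_ge0.
have [v yE] : exists v, y = x + v by exists (y - x); rewrite addrC subrK.
rewrite {y}yE in ye *; have [dF _ _] := hF.
have [c [c0 c1 ->]] := seg_MVT x v dF.
rewrite [x + v - x]addrAC subrr add0r -dotBl.
apply: le_trans (norm_dot _ _) _.
rewrite expr2 -!mulrA ler_wpM2l // mulrA ler_wpM2r //.
apply: le_trans (HC _ _ _ _) _ => //; first by apply: norm_segment; rewrite ?c0.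
by rewrite ler_wpM2l // normrZ ger0_norm // ler_piMl.
Qed.

Lemma quadformE F x v : differentiable (grad F) x ->
  quadform (hessian F x) v = dot ('D_v (grad F) x) v.
Proof.
move=> dG; rewrite /quadform deriveEjacobian // mxE.
by apply: eq_bigr => i _; rewrite [v^T _ _]mxE.
Qed.

Lemma quadformZ (A : 'M[R]_n) a v : quadform A (a *: v) = a ^+ 2 * quadform A v.
Proof.
by rewrite /quadform linearZ /= -scalemxAr -!scalemxAl scalerA mxE -expr2.
Qed.

Lemma quadform_continuous (A : 'M[R]_n) : continuous (quadform A).
Proof.
have E : quadform A = fun v => \sum_j (\sum_i v ord0 i * A i j) * v ord0 j.
  apply/funext => v; rewrite /quadform mxE.
  by apply: eq_bigr => j _; rewrite [v^T _ _]mxE mxE.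
rewrite E => d; apply: (@cvg_sumr _ _ _ (nbhs d)) => j.
apply: cvgM; last exact: coord_continuous.
apply: (@cvg_sumr _ _ _ (nbhs d)) => i.
by apply: cvgMr_tmp; exact: coord_continuous.
Qed.

(** The derivative of the remainder along a ray is controlled by the
    differentiability of the gradient at the single point [xs]; the mean value
    theorem integrates that bound. *)
Lemma C2_taylor2 F xs (eps : R) : C2 F -> 0 < eps ->
  \forall v \near (0 : 'rV[R]_n),
    `|F (xs + v) - F xs - dot (grad F xs) v
      - 2^-1 * quadform (hessian F xs) v| <= eps * `|v| ^+ 2.
Proof.
move=> [dF dG _] eps0.
have e'0 : 0 < eps / (n%:R + 1) by rewrite divr_gt0 // ltr_wpDl.
set H := 'd (grad F) xs.
have : \forall v \near (0 : 'rV[R]_n),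
    `|grad F (v + xs) - grad F xs - H v| <= eps / (n%:R + 1) * `|v|.
  have /eqaddoP /(_ _ e'0) := diff_locally (dG xs).
  apply: filterS => v /=.
  by rewrite !fctE /= opprD addrA.
move=> /nbhs_norm0P[e /= e0 He]; apply/nbhs_norm0P; exists e => //= v ve.
pose q := quadform (hessian F xs) v.
pose r (t : R) := F (xs + t *: v) - t * dot (grad F xs) v - 2^-1 * (t ^+ 2 * q).
pose r' (t : R) := dot (grad F (xs + t *: v)) v - dot (grad F xs) v - t * q.
have dr t : is_derive t (1 : R) r (r' t).
  have H1 := is_derive_line (dF (xs + t *: v)).
  have H2 c : is_derive t (1 : R) (fun t : R => t * c) c.
    apply: (@is_derive_eq _ _ _ _ _ _ _ _ (is_deriveM _ (is_derive_cst c t 1))).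
    by rewrite scaler0 add0r; apply: mulr1.
  have H3 : is_derive t (1 : R) (fun t : R => 2^-1 * (t ^+ 2 * q)) (t * q).
    have -> : (fun t : R => 2^-1 * (t ^+ 2 * q)) = (fun t => t * (2^-1 * q)) * id.
      by apply/funext => y; rewrite fctE /=; ring.
    apply: (is_derive_eq (is_deriveM (H2 (2^-1 * q)) (is_derive_id t 1))).
    by transitivity (t * (2^-1 * q) * 1 + t * (2^-1 * q)) => //; field.
  exact: (is_deriveB (is_deriveB H1 (H2 _)) H3).
have cr : {within `[0, 1], continuous r}.
  apply: continuous_subspaceT => t; apply/differentiable_continuous.
  by apply/derivable1_diffP; have [] := dr t.
have [c] := MVT_segment ler01 (fun t _ => dr t) cr.
rewrite in_itv /= subr0 mulr1 => /andP[c0 c1].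
rewrite /r !scale1r scale0r addr0 expr1n expr0n !mul1r !mul0r mulr0 !subr0.
move=> E.
have -> : F (xs + v) - F xs - dot (grad F xs) v - 2^-1 * quadform (hessian F xs) v
    = dot (grad F (c *: v + xs) - grad F xs - H (c *: v)) v.
  transitivity (r' c); first by rewrite -E /q; ring.
  rewrite /r' [xs + _]addrC /q quadformE // deriveE // !dotBl.
  have Hc : H (c *: v) = c *: H v by rewrite linearZ.
  by rewrite Hc dotZl.
have cv : `|c *: v| <= `|v| by rewrite normrZ ger0_norm // ler_piMl.
apply: le_trans (norm_dot _ _) _; rewrite expr2 [leRHS]mulrA ler_wpM2r //.
apply: (@le_trans _ _ (n%:R * (eps / (n%:R + 1) * `|v|))).
  rewrite ler_wpM2l //; apply: le_trans (He _ _) _; first exact: le_lt_trans ve.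
  by rewrite ler_wpM2l // ltW.
rewrite mulrA ler_wpM2r // mulrCA ler_piMr ?ltW //.
by rewrite ltr_pdivrMr ?mul1r ?ltrDl // ltr_wpDl.
Qed.




End C2facts.

(** * Functions with first- and second-order expansions *)

Section Smooth2.
Context {R : realType} {n : nat}.
Implicit Types (F : 'rV[R]_n -> R) (G : 'rV[R]_n -> 'rV[R]_n) (x v d xs : 'rV[R]_n).

(** The first-order information used below: [G] plays the role of the gradient,
    and the quadratic remainder is uniform for both endpoints near [xs]. *)
Definition C11_at F G xs : Prop :=
  [/\ continuous F, {for xs, continuous G} &
  exists C e : R, [/\ 0 <= C, 0 < e &
  forall x y, `|x - xs| < e -> `|y - xs| < e ->
    `|F y - F x - dot (G x) (y - x)| <= C * `|y - x| ^+ 2]].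

(** The second-order expansion along points [xs + t k *: a k] with [a k] tending
    to [d].  It is stated for arbitrary filters on [nat] because limits are taken
    along an ultrafilter, which spares the extraction of subsequences. *)
Definition order2_at F g xs d (q : R) : Prop :=
  forall (U : set_system nat) (t : nat -> R) (a : nat -> 'rV[R]_n),
    Filter U -> (\forall k \near U, 0 < t k) -> t k @[k --> U] --> 0 ->
    a k @[k --> U] --> d ->
    (F (xs + t k *: a k) - F xs - t k * dot g (a k)) / t k ^+ 2 @[k --> U]
      --> q / 2.

Definition smooth2_at F G xs d q :=
  C11_at F G xs /\ order2_at F (G xs) xs d q.

Lemma smooth2_C2 F xs d : C2 F ->
  smooth2_at F (grad F) xs d (quadform (hessian F xs) d).
Proof.
move=> hF; have [dF dG cH] := hF; split.
  split; [|exact: differentiable_continuous (dG xs)|exact: C2_quadratic_remainder].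
  by move=> x; exact: differentiable_continuous.
move=> U t a FU t0 tU aU.
pose Q := quadform (hessian F xs).
have QU : Q (a k) / 2 @[k --> U] --> Q d / 2.
  by apply: cvgMr_tmp; apply: (cvg_comp _ _ aU (@quadform_continuous _ _ _ d)).
apply/cvgrPdist_le => eps eps0.
have M0 : 0 < (`|d| + 1) ^+ 2 by rewrite exprn_gt0 // ltr_wpDl.
have e'0 : 0 < eps / 2 / (`|d| + 1) ^+ 2 by rewrite !divr_gt0.
have taU : t k *: a k @[k --> U] --> (0 : 'rV[R]_n).
  by rewrite -(scale0r d); apply: cvgZ.
have /taU := C2_taylor2 xs hF e'0; rewrite nbhs_simpl /= => H1.
near=> k.
have tk : 0 < t k by near: k.
have ak : `|a k| <= `|d| + 1.
  by near: k; apply: cvgr_norm_le aU _ _; rewrite ltrDl.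
have H2 : `|Q d / 2 - Q (a k) / 2| <= eps / 2.
  by near: k; apply: cvgr_dist_le; rewrite // divr_gt0.
have H3 : `|F (xs + t k *: a k) - F xs - dot (grad F xs) (t k *: a k)
    - 2^-1 * Q (t k *: a k)| <= eps / 2 / (`|d| + 1) ^+ 2 * `|t k *: a k| ^+ 2.
  by near: k.
set q := _ / t k ^+ 2.
have H4 : `|q - Q (a k) / 2| <= eps / 2.
  have -> : q - Q (a k) / 2 = (F (xs + t k *: a k) - F xs -
     dot (grad F xs) (t k *: a k) - 2^-1 * Q (t k *: a k)) / t k ^+ 2.
    rewrite /q dotZr /Q quadformZ; field; exact: lt0r_neq0.
  rewrite normrM normfV (ger0_norm (sqr_ge0 (t k))).
  rewrite ler_pdivrMr ?exprn_gt0 //; apply: le_trans H3 _.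
  rewrite normrZ (ger0_norm (ltW tk)) exprMn.
  rewrite -mulrA ler_pM2l; last by rewrite divr_gt0.
  rewrite mulrCA ler_piMr ?sqr_ge0 // mulrC ler_pdivrMr // mul1r.
  by rewrite ler_sqr ?nnegrE // addr_ge0.
have -> : Q d / 2 - q = (Q d / 2 - Q (a k) / 2) - (q - Q (a k) / 2).
  by rewrite -[RHS]/(_ - _); ring.
apply: le_trans (ler_normB _ _) _; rewrite (splitr eps); exact: lerD.
Unshelve. all: by end_near. Qed.

Lemma smooth2_dot w xs d : smooth2_at (dot w) (cst w) xs d 0.
Proof.
split.
  split; [|exact: cst_continuous|exists 0, 1; split=> // x y _ _].
    by move=> x; apply: (@cvg_dot _ _ _ (nbhs x) _ (fun=> w) id); [exact: cvg_cst|exact: cvg_id].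
  by rewrite dotBr subrr normr0 mul0r.
move=> U t a FU t0 tU aU; rewrite mul0r; under eq_cvg do
  rewrite dotDr dotZr [dot w xs + _]addrC addrK subrr mul0r.
exact: cvg_cst.
Qed.

Lemma smooth2_cst (c : R) xs d : smooth2_at (cst c) (cst 0) xs d 0.
Proof.
split.
  split; [|exact: cst_continuous|exists 0, 1; split=> // x y _ _].
    exact: cst_continuous.
  by rewrite subrr dot0l subrr normr0 mul0r.
move=> U t a FU t0 tU aU; rewrite mul0r; under eq_cvg do
  rewrite subrr dot0l mulr0 subrr mul0r.
exact: cvg_cst.
Qed.

(** Both the penalty argument and the Lagrangian need the class to be stable under
    linear combinations. *)
Lemma smooth2_sum (T : finType) (F : T -> _ -> R) (G : T -> _ -> _) (a q : T -> R) xs d :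
  (forall t, smooth2_at (F t) (G t) xs d (q t)) ->
  smooth2_at (fun x => \sum_t a t * F t x) (fun x => \sum_t a t *: G t x) xs d
    (\sum_t a t * q t).
Proof.
move=> FG; split.
  split.
  - move=> x; apply: (@cvg_sumr _ _ _ (nbhs x)) => t.
    by apply: cvgMl_tmp; have [[cF _ _] _] := FG t; exact: cF.
  - apply: (@cvg_sumr _ _ _ (nbhs xs)) => t.
    by apply: cvgZl_tmp; have [[_ cG _] _] := FG t; exact: cG.
  - have : forall t, exists C, 0 <= C /\ \forall e \near 0^'+, forall x y,
      `|x - xs| < e -> `|y - xs| < e ->
      `|F t y - F t x - dot (G t x) (y - x)| <= C * `|y - x| ^+ 2.
      move=> t; have [[_ _ [C [e [C0 e0 H]]]] _] := FG t.
      exists C; split=> //; near=> e' => x y xe ye.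
      have ee : e' <= e by near: e'; exact: nbhs_right_le.
      by apply: H; exact: lt_le_trans ee.
    move=> /choice[C HC].
    have : \forall e \near 0^'+, forall t x y,
      `|x - xs| < e -> `|y - xs| < e ->
      `|F t y - F t x - dot (G t x) (y - x)| <= C t * `|y - x| ^+ 2.
      by apply: filter_forall => t; have [] := HC t.
    move=> /(filterI (nbhs_right_gt (0 : R)))/filter_ex[e [/= e0 He]].
    exists (\sum_t `|a t| * C t), e; split=> //.
    + by apply: sumr_ge0 => t _; rewrite mulr_ge0 //; have [] := HC t.
    + move=> x y xe ye; rewrite dot_suml -!sumrB mulr_suml.
      apply: le_trans (ler_norm_sum _ _ _) _; apply: ler_sum => t _.
      rewrite dotZl -!mulrBr normrM -mulrA ler_wpM2l //.
      exact: He.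
move=> U t u FU t0 tU uU.
rewrite mulr_suml.
under eq_cvg do rewrite dot_suml mulr_sumr -!sumrB mulr_suml.
apply: cvg_sumr => i; have [_ /(_ U t u FU t0 tU uU)] := FG i.
rewrite -mulrA => H; apply: cvg_trans (cvgM (@cvg_cst _ (a i) _ U _) H).
apply: near_eq_cvg; near=> k => /=.
by rewrite dotZl -[LHS]/(a i * (_ / _)) [LHS]mulrA; congr (_ * _); ring.
Unshelve. all: by end_near. Qed.

End Smooth2.

(** * Hessian of the Lagrangian *)

Section HessianLinear.
Context {R : realType} {n : nat}.

Lemma derive_fsum (V W : normedModType R) (T : finType) (F : T -> V -> W) x v :
  (forall t, differentiable (F t) x) ->
  differentiable (fun y => \sum_t F t y) x /\
  'D_v (fun y => \sum_t F t y) x = \sum_t 'D_v (F t) x.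
Proof.
move=> dF.
suff H (r : seq T) : differentiable (fun y => \sum_(t <- r) F t y) x /\
  'D_v (fun y => \sum_(t <- r) F t y) x = \sum_(t <- r) 'D_v (F t) x by exact: H.
elim: r => [|t r [IH1 IH2]].
  have -> : (fun y => \sum_(t <- [::]) F t y) = cst 0.
    by apply/funext => y; rewrite big_nil.
  by split; [exact: differentiable_cst|rewrite big_nil derive_cst].
have -> : (fun y => \sum_(t <- t :: r) F t y) =
          F t + (fun y => \sum_(t <- r) F t y).
  by apply/funext => y; rewrite big_cons.
split; first exact: differentiableD.
by rewrite deriveD ?big_cons ?IH2 //; exact: diff_derivable.
Qed.

Lemma C2_sum_grad (T : finType) (F : T -> 'rV[R]_n -> R) (a : T -> R) :
  (forall t, C2 (F t)) ->
  grad (fun x => \sum_t a t * F t x) = fun x => \sum_t a t *: grad (F t) x.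
Proof.
move=> hF; apply/funext => x; apply/rowP => i; rewrite mxE summxE.
have dF t : differentiable (fun x => a t * F t x) x.
  by apply: differentiableM => //; have [] := hF t.
rewrite (derive_fsum _ dF).2; apply: eq_bigr => t _; rewrite !mxE.
have [dFt _ _] := hF t.
have := deriveZ (a t) (diff_derivable (v := evec i) (dFt x)).
by rewrite -[_ *: 'D_ _ _ _]/(_ * _) => <-.
Qed.

Lemma quadform_hessian_sum (T : finType) (F : T -> 'rV[R]_n -> R) (a : T -> R)
    xs d : (forall t, C2 (F t)) ->
  quadform (hessian (fun x => \sum_t a t * F t x) xs) d =
  \sum_t a t * quadform (hessian (F t) xs) d.
Proof.
move=> hF; have gE := C2_sum_grad a hF.
have dF t : differentiable (fun x => a t *: grad (F t) x) xs.
  by apply: differentiableZ; have [] := hF t.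
have [d1 d2] := derive_fsum d dF.
have d1' : differentiable (grad (fun x => \sum_t a t * F t x)) xs.
  by rewrite gE; exact: d1.
have E1 := quadformE d d1'.
apply: (etrans E1).
rewrite gE.
rewrite d2.
rewrite dot_suml; apply: eq_bigr => t _.
have [_ dG _] := hF t.
rewrite quadformE; last exact: dG.
rewrite -dotZl; congr (dot _ d).
exact: deriveZ (diff_derivable (dG xs)).
Qed.

End HessianLinear.

Section Lagrangian.
Context {R : realType} {n m p : nat} (f : 'rV[R]_n -> R)
  (g : 'rV[R]_n -> 'rV[R]_m) (h : 'rV[R]_n -> 'rV[R]_p).

Lemma quadform_lagrangian0 xs lg lh d : C2_vec g -> C2_vec h ->
  quadform (hess_lagrangian0 g h xs lg lh) d =
  \sum_i lg ord0 i * quadform (hessian (coordf g i) xs) d +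
  \sum_j lh ord0 j * quadform (hessian (coordf h j) xs) d.
Proof.
move=> hg hh.
pose F (t : 'I_m + 'I_p) := match t with inl i => coordf g i | inr j => coordf h j end.
pose a (t : 'I_m + 'I_p) := match t with inl i => lg ord0 i | inr j => lh ord0 j end.
have hF t : C2 (F t) by case: t.
have LE : (fun x => lagrangian0 g h x lg lh) = fun x => \sum_t a t * F t x.
  by apply/funext => x; rewrite big_sumType.
rewrite /hess_lagrangian0 LE.
by apply: (etrans (quadform_hessian_sum a xs d hF)); rewrite big_sumType.
Qed.

Lemma quadform_lagrangian xs lg lh d : C2 f -> C2_vec g -> C2_vec h ->
  quadform (hess_lagrangian f g h xs lg lh) d =
  quadform (hessian f xs) d +
  \sum_i lg ord0 i * quadform (hessian (coordf g i) xs) d +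
  \sum_j lh ord0 j * quadform (hessian (coordf h j) xs) d.
Proof.
move=> hf hg hh.
pose F (t : 'I_m + 'I_p + unit) :=
  match t with inl (inl i) => coordf g i | inl (inr j) => coordf h j | _ => f end.
pose a (t : 'I_m + 'I_p + unit) := match t with inl (inl i) => lg ord0 i
  | inl (inr j) => lh ord0 j | _ => 1 end.
have hF t : C2 (F t) by case: t => [[]|].
have LE : (fun x => lagrangian f g h x lg lh) = fun x => \sum_t a t * F t x.
  apply/funext => x; rewrite !big_sumType /= sum_unit mul1r addrC /lagrangian.
  by rewrite -!addrA.
rewrite /hess_lagrangian LE.
apply: (etrans (quadform_hessian_sum a xs d hF)).
by rewrite !big_sumType /= sum_unit mul1r addrC addrA.
Qed.

End Lagrangian.

(** * Minimisers on balls and limits along ultrafilters *)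

Section Compactness.
Context {R : realType}.

Lemma ball_compact n (xs : 'rV[R]_n) (e : R) : compact [set x | `|x - xs| <= e].
Proof.
apply: bounded_closed_compact.
  exists (e + `|xs|); split; first exact: num_real.
  move=> M eM x /= xe; apply: ltW; apply: le_lt_trans eM.
  by rewrite -[x](subrK xs); apply: le_trans (ler_normD _ _) _; rewrite lerD2r.
rewrite [X in closed X](_ : _ = closed_ball_ Num.norm xs e).
  exact: closed_closed_ball_.
by apply/seteqP; split=> x /=; rewrite /closed_ball_ /= distrC.
Qed.

Lemma ball_min n (Q : 'rV[R]_n -> R) xs e : continuous Q -> 0 <= e ->
  exists u, `|u - xs| <= e /\ forall y, `|y - xs| <= e -> Q u <= Q y.
Proof.
move=> cQ e0.
have [||u ue uQ] := EVT_min_rV _ (@ball_compact n xs e) (f := Q).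
- by exists xs; rewrite /= subrr normr0.
- exact: continuous_subspaceT.
exists u; split; first by move: ue; rewrite inE.
by move=> y ye; apply: uQ; rewrite inE.
Qed.

(** An ultrafilter converges to any of its cluster points. *)
Lemma ultra_cvg_compact (T : Type) (V : topologicalType) (U : set_system T)
    (A : set V) (v : T -> V) :
  UltraFilter U -> compact A -> (\forall x \near U, A (v x)) ->
  exists2 l, A l & v x @[x --> U] --> l.
Proof.
move=> UU cA vA; have [l [Al cl]] := cA _ (fmap_proper_filter v _) vA.
exists l => // B Bl; have [//|UnB] := in_ultra_setVsetC (v @^-1` B) UU.
by have [y [+ By]] := cl (~` B) B UnB Bl.
Qed.

Lemma ultra_cvg_bounded (T : Type) (U : set_system T) (v : T -> R) (M : R) :
  UltraFilter U -> (\forall x \near U, `|v x| <= M) ->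
  exists l : R, v x @[x --> U] --> l.
Proof.
move=> UU vM; have [|l _] := ultra_cvg_compact UU (@segment_compact R (- M) M) (v := v).
  by apply: filterS vM => x; rewrite ler_norml /= in_itv.
by exists l.
Qed.

End Compactness.

(** * Residuals and stationarity of a penalised minimiser *)

Section Residual.
Context {R : realType}.

(** Signed violation of [y <= 0] if [b] holds, and of [y = 0] otherwise. *)
Definition res (b : bool) (y : R) : R := if b then Num.max y 0 else y.

(** The squared residual has the derivative [2 * res b y], which is 2-Lipschitz, so
    that its first-order remainder is at most [dy ^+ 2]. *)
Lemma res_sqrD b y dy :
  res b (y + dy) ^+ 2 <= res b y ^+ 2 + 2 * res b y * dy + dy ^+ 2.
Proof.
case: b => /=; last by rewrite le_eqVlt; apply/orP; left; apply/eqP; ring.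
rewrite !maxEle; case: (leP y 0) => y0; case: (leP (y + dy) 0) => yd0; nra.
Qed.

Lemma res_continuous b : continuous (res b).
Proof.
case: b => y; last exact: cvg_id.
by apply: (@continuous_max R R id (cst 0)); [exact: cvg_id|exact: cvg_cst].
Qed.

Lemma res_ge0 y : 0 <= res true y.
Proof. by rewrite /= le_max lexx orbT. Qed.

Lemma res_gt0 y : res true y != 0 -> 0 < y /\ res true y = y.
Proof. by rewrite /= maxEle; case: (leP y 0) => // _; rewrite eqxx. Qed.

Lemma res_le0 y : y <= 0 -> res true y = 0.
Proof. by move=> y0; rewrite /= maxEle y0. Qed.

Lemma res_eq0 y : (res true y == 0) = (y <= 0).
Proof.
by rewrite /= maxEle; case: (leP y 0) => [_|/gt_eqF]; rewrite ?eqxx.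
Qed.

End Residual.

Section Penalty.
Context {R : realType} {n : nat}.
Implicit Types (x v d xs : 'rV[R]_n).

Lemma cvg_scale0 (v : 'rV[R]_n) : (s : R) *: v @[s --> 0^'+] --> (0 : 'rV[R]_n).
Proof.
rewrite -[X in _ --> X](scale0r v); apply: cvgZr_tmp.
exact: cvg_at_right_filter.
Qed.

Lemma le0_of_small (a K : R) :
  (\forall s \near 0^'+, a <= s * K) -> a <= 0.
Proof.
move=> H; apply: (@cvgr_to_ge _ _ _ _ (fun s => s * K) 0 a _ H).
rewrite -[X in _ --> X](mul0r K); apply: cvgMr_tmp.
by apply: cvg_at_right_filter; exact: cvg_id.
Qed.

(** Stationarity at a local minimiser of a function [Phi] of the squared residuals
    plus a multiple of the squared distance to [x0].  Only an affine upper bound of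
    [Phi] at the minimiser matters, so one statement covers the square root and
    the linear case.  Test the minimality in the direction [- L], where [L] is
    the candidate gradient: the first-order decrease [s * dot L L] cannot exceed
    the second-order terms. *)
Lemma penalty_stationary (T : finType) (b : T -> bool) (c : T -> 'rV[R]_n -> R)
    (G : T -> 'rV[R]_n) (sh : T -> R) (u x0 : 'rV[R]_n) (Phi : R -> R) (kap al : R) :
  let A y := \sum_t res (b t) (c t y + sh t) ^+ 2 in
  (forall t, exists C, \forall v \near (0 : 'rV[R]_n),
     `|c t (u + v) - c t u - dot (G t) v| <= C * `|v| ^+ 2) ->
  0 <= kap -> 
  (forall A', 0 <= A' -> Phi A' <= Phi (A u) + kap * (A' - A u)) ->
  (\forall v \near (0 : 'rV[R]_n), Phi (A u) + al * dot (u - x0) (u - x0) <=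
     Phi (A (u + v)) + al * dot (u + v - x0) (u + v - x0)) ->
  \sum_t (kap * res (b t) (c t u + sh t)) *: G t = - al *: (u - x0).
Proof.
move=> A hc kap0 hPhi hmin.
set W := \sum_t _; pose L := W + al *: (u - x0).
suff L0 : dot L L <= 0.
  have : `|L| ^+ 2 <= 0 by apply: le_trans L0; exact: sqr_norm_le_dot.
  rewrite le_eqVlt ltNge sqr_ge0 orbF sqrf_eq0 normr_eq0 => /eqP L00.
  by rewrite scaleNr; apply/eqP; rewrite -subr_eq0 opprK -/L L00.
pose v := - L.
have vs := @cvg_scale0 v.
have : forall t, exists K, \forall s \near 0^'+,
    res (b t) (c t (u + s *: v) + sh t) ^+ 2 <= res (b t) (c t u + sh t) ^+ 2 +
      2 * s * (res (b t) (c t u + sh t) * dot (G t) v) + s ^+ 2 * K.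
  move=> t; have [C HC] := hc t; set r := res _ (c t u + sh t).
  set l := dot (G t) v.
  exists (2 * `|r| * (`|C| * `|v| ^+ 2) + (`|l| + `|C| * `|v| ^+ 2) ^+ 2).
  have := vs _ HC; rewrite nbhs_simpl /= => HC'.
  near=> s.
  have s0 : 0 < s by near: s; exact: nbhs_right_gt.
  have s1 : s <= 1 by near: s; exact: nbhs_right_le.
  have H : `|c t (u + s *: v) - c t u - dot (G t) (s *: v)| <= C * `|s *: v| ^+ 2.
    by near: s.
  set rho := c t (u + s *: v) - c t u - dot (G t) (s *: v) in H.
  have rhoB : `|rho| <= s ^+ 2 * (`|C| * `|v| ^+ 2).
    apply: le_trans H _; rewrite normrZ (ger0_norm (ltW s0)) exprMn.
    by rewrite mulrCA ler_wpM2l ?sqr_ge0 // ler_wpM2r ?sqr_ge0 // ler_norm.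
  have -> : c t (u + s *: v) + sh t = (c t u + sh t) + (s * l + rho).
    by rewrite /rho dotZr -/l; ring.
  apply: le_trans (res_sqrD _ _ _) _; rewrite -/r -!addrA lerD2l.
  have B0 : 0 <= `|C| * `|v| ^+ 2 by rewrite mulr_ge0 // sqr_ge0.
  set B := `|C| * `|v| ^+ 2 in rhoB B0 *.
  have H1 : r * rho <= `|r| * (s ^+ 2 * B).
    by apply: le_trans (ler_norm _) _; rewrite normrM ler_wpM2l.
  have H2 : (s * l + rho) ^+ 2 <= s ^+ 2 * (`|l| + B) ^+ 2.
    rewrite -exprMn -real_normK ?num_real // ler_sqr ?nnegrE //.
      apply: le_trans (ler_normD _ _) _; rewrite normrM (ger0_norm (ltW s0)).
      rewrite mulrDr lerD2l; apply: le_trans rhoB _; rewrite ler_wpM2r //.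
      by rewrite expr2 ler_piMr // ltW.
    by rewrite mulr_ge0 ?addr_ge0 // ltW.
  nra.
move=> /choice[K HK].
have {}HK : \forall s \near 0^'+, forall t,
    res (b t) (c t (u + s *: v) + sh t) ^+ 2 <= res (b t) (c t u + sh t) ^+ 2 +
      2 * s * (res (b t) (c t u + sh t) * dot (G t) v) + s ^+ 2 * K t.
  exact: filter_forall.
have := vs _ hmin; rewrite nbhs_simpl /= => hmin'.
apply: (@le0_of_small _ (2^-1 * (kap * \sum_t K t + al * dot v v))).
near=> s.
have s0 : 0 < s by near: s; exact: nbhs_right_gt.
have H1 : A (u + s *: v) <= A u +
    2 * s * (\sum_t res (b t) (c t u + sh t) * dot (G t) v) + s ^+ 2 * \sum_t K t.
  rewrite /A !mulr_sumr -!big_split /=; apply: ler_sum => t _.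
  by move: t; near: s.
have H2 : Phi (A u) + al * dot (u - x0) (u - x0) <=
     Phi (A (u + s *: v)) + al * dot (u + s *: v - x0) (u + s *: v - x0).
  by near: s.
have H3 : Phi (A (u + s *: v)) <= Phi (A u) + kap * (A (u + s *: v) - A u).
  by apply: hPhi; apply: sumr_ge0 => t _; exact: sqr_ge0.
have H4 : kap * (\sum_t res (b t) (c t u + sh t) * dot (G t) v) = dot W v.
  rewrite mulr_sumr dot_suml; apply: eq_bigr => t _.
  by rewrite dotZl mulrA.
have H5 : dot (u + s *: v - x0) (u + s *: v - x0) = dot (u - x0) (u - x0) +
    2 * s * dot (u - x0) v + s ^+ 2 * dot v v.
  have E w z : dot (w + s *: z) (w + s *: z) =
      dot w w + 2 * s * dot w z + s ^+ 2 * dot z z.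
    rewrite !dotDl !dotDr !dotZl !dotZr (dotC z w); ring.
  by rewrite -E addrAC.
have H6 : dot W v + al * dot (u - x0) v = - dot L L.
  by rewrite -dotZl -dotDl -/L dotNr.
have H7 := ler_wpM2l kap0 H1.
rewrite H5 in H2.
set SS := \sum_t res _ _ * _ in H1 H4 H7 *.
set KK := \sum_t K t in H1 H7 *.
suff : 2 * s * dot L L <= 2 * s * (s * (2^-1 * (kap * KK + al * dot v v))).
  by rewrite ler_pM2l // mulr_gt0.
have -> : 2 * s * (s * (2^-1 * (kap * KK + al * dot v v))) =
  s ^+ 2 * (kap * KK + al * dot v v) by field.
have H8 : 2 * s * (kap * SS) + 2 * s * (al * dot (u - x0) v) = - (2 * s * dot L L).
  by rewrite -mulrDr H4 H6 mulrN.
have H9 : kap * (A u + 2 * s * SS + s ^+ 2 * KK) =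
  kap * A u + 2 * s * (kap * SS) + s ^+ 2 * (kap * KK) by ring.
rewrite H9 in H7.
have H10 : al * (dot (u - x0) (u - x0) + 2 * s * dot (u - x0) v + s ^+ 2 * dot v v) =
  al * dot (u - x0) (u - x0) + 2 * s * (al * dot (u - x0) v) + s ^+ 2 * (al * dot v v).
  by ring.
rewrite H10 in H2; rewrite mulrBr in H3; rewrite mulrDr.
lra.
Unshelve. all: by end_near. Qed.

End Penalty.

(** * Second-order Fritz John conditions without constraint qualification *)

Section SecondOrderFJ.
Context {R : realType} {n : nat} {T : finType}.
Implicit Types (x v d xs : 'rV[R]_n).

Lemma C11_local (c : 'rV[R]_n -> R) G xs : C11_at c G xs ->
  \forall u \near xs, exists C, \forall v \near (0 : 'rV[R]_n),
     `|c (u + v) - c u - dot (G u) v| <= C * `|v| ^+ 2.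
Proof.
move=> [_ _ [C [e [C0 e0 H]]]]; apply/near_norm_lt; exists e => // u ue.
exists C; apply/near_norm_lt; exists (e - `|u - xs|); first by rewrite subr_gt0.
move=> v; rewrite subr0 => ve.
have vE : u + v - u = v by rewrite addrC addKr.
rewrite -[in dot _ v]vE -[X in `|X| ^+ 2]vE.
apply: H => //; rewrite addrAC; apply: le_lt_trans (ler_normD _ _) _.
by rewrite -ltrBrDl.
Qed.

(** The square root lies below its tangents. *)
Lemma sqrt_upper (A A' : R) : 0 < A -> 0 <= A' ->
  Num.sqrt A' <= Num.sqrt A + (2 * Num.sqrt A)^-1 * (A' - A).
Proof.
move=> A0 A'0; have s0 : 0 < Num.sqrt A by rewrite sqrtr_gt0.
have s'0 := sqrtr_ge0 A'.
rewrite -[in _ * (A' - A)](sqr_sqrtr A'0) -[X in _ - X](sqr_sqrtr (ltW A0)).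
move: (Num.sqrt A) (Num.sqrt A') s0 s'0 => a b a0 b0.
rewrite -subr_ge0.
have -> : a + (2 * a)^-1 * (b ^+ 2 - a ^+ 2) - b = (2 * a)^-1 * (b - a) ^+ 2.
  by field; exact: lt0r_neq0.
by rewrite mulr_ge0 ?sqr_ge0 // invr_ge0 mulr_ge0 // ltW.
Qed.

Lemma sqrt_sum_sqr (r : T -> R) : Num.sqrt (\sum_t r t ^+ 2) <= \sum_t `|r t|.
Proof.
have S0 : 0 <= \sum_t `|r t| by exact: sumr_ge0.
rewrite -[leRHS](ger0_norm S0) -sqrtr_sqr; apply: ler_wsqrtr.
have H (s : seq T) : \sum_(t <- s) r t ^+ 2 <= (\sum_(t <- s) `|r t|) ^+ 2.
  elim: s => [|t s IH]; first by rewrite !big_nil expr0n.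
  rewrite !big_cons sqrrD real_normK ?num_real // -addrA lerD2l.
  apply: le_trans IH _; rewrite lerDr mulrn_wge0 // mulr_ge0 //.
  exact: sumr_ge0.
exact: H.
Qed.

Variables (b : T -> bool) (c : T -> 'rV[R]_n -> R) (G : T -> 'rV[R]_n -> 'rV[R]_n).
Variables (q sh : T -> R) (xs d : 'rV[R]_n).
Hypothesis smooth : forall t, smooth2_at (c t) (G t) xs d (q t).
Hypothesis sh0 : forall t, 0 <= sh t.
Hypothesis ineqs : forall t, b t -> c t xs <= 0.
Hypothesis ineqd : forall t, b t -> c t xs = 0 -> dot (G t xs) d <= 0.
Hypothesis eqs : forall t, ~~ b t -> c t xs = 0.
Hypothesis eqd : forall t, ~~ b t -> dot (G t xs) d = 0.

(** The shift [sg] makes every residual vector near [xs] nonzero.  The choice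
    [t ^+ 3] keeps it negligible in expansions of order [t ^+ 2]. *)
Let theta (sg : R) x := Num.sqrt (\sum_t res (b t) (c t x + sg * sh t) ^+ 2).

Let tk (k : nat) : R := k.+1%:R^-1.
Let xk k := xs + tk k *: d.
Let sgk k := tk k ^+ 3.

Let tk_gt0 k : 0 < tk k. Proof. by rewrite invr_gt0. Qed.

Let cvg_tk : tk k @[k --> \oo] --> 0.
Proof. exact: (@cvg_harmonic R). Qed.

Lemma theta_continuous sg : continuous (theta sg).
Proof.
move=> x.
have H t : res (b t) (c t y + sg * sh t) @[y --> x] --> res (b t) (c t x + sg * sh t).
  have H1 : c t y + sg * sh t @[y --> x] --> c t x + sg * sh t.
    have [[cc _ _] _] := smooth t.
    exact: (cvgD (cc x) (@cvg_cst _ (sg * sh t) _ (nbhs x) _)).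
  exact: (cvg_comp _ _ H1 (@res_continuous R _ _)).
have H2 : \sum_t res (b t) (c t y + sg * sh t) ^+ 2 @[y --> x] -->
    \sum_t res (b t) (c t x + sg * sh t) ^+ 2.
  apply: (@cvg_sumr _ _ _ (nbhs x)) => t.
  exact: (cvg_comp _ _ (H t) (@exprn_continuous R 2 _)).
exact: (cvg_comp _ _ H2 (@sqrt_continuous R _)).
Qed.

(** Criticality of [d] makes the first-order terms of the active inequalities
    nonpositive and those of the equalities zero; inactive inequalities have no
    residual near [xs]. *)
Lemma theta_on_ray : exists K : R, 0 <= K /\
  \forall k \near \oo, theta (sgk k) (xk k) <= K * tk k ^+ 2.
Proof.
have : forall t, exists K : R, 0 <= K /\ \forall k \near \oo,
    `|res (b t) (c t (xk k) + sgk k * sh t)| <= K * tk k ^+ 2.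
  move=> t; have [[cc _ [C [e [C0 e0 H]]]] _] := smooth t.
  have xk_cvg : xk k @[k --> \oo] --> xs.
    rewrite -[X in _ --> X]addr0 -(scale0r d).
    by apply: cvgD; [exact: cvg_cst|apply: cvgZr_tmp].
  exists (C * `|d| ^+ 2 + sh t); split; first by rewrite addr_ge0 // mulr_ge0 // sqr_ge0.
  have expand : \forall k \near \oo, c t xs = 0 ->
      `|c t (xk k) + sgk k * sh t - tk k * dot (G t xs) d| <= (C * `|d| ^+ 2 + sh t) * tk k ^+ 2.
    near=> k => cxs0.
    have ke : `|xk k - xs| < e.
      by rewrite distrC; near: k; exact: cvgr_dist_lt.
    have := H xs (xk k); rewrite subrr normr0 => /(_ e0 ke).
    rewrite cxs0 subr0 /xk addrAC subrr add0r dotZr normrZ exprMn.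
    rewrite (ger0_norm (ltW (tk_gt0 k))) => H1.
    rewrite -/(xk k) addrAC; apply: le_trans (ler_normD _ _) _.
    rewrite mulrDl; apply: lerD; first by rewrite -mulrA [_ * tk k ^+ 2]mulrC.
    rewrite normrM (ger0_norm (sh0 t)) mulrC ler_wpM2l //.
    rewrite ger0_norm; last by rewrite exprn_ge0 // ltW.
    rewrite /sgk exprS ler_piMl ?sqr_ge0 //.
    by rewrite invf_le1 // ler1n.
  case bt : (b t).
    have := ineqs bt; rewrite le_eqVlt => /orP[/eqP cxs0|cxs_lt0].
      apply: filterS expand => k /(_ cxs0) H1.
      have d0 := ineqd bt cxs0.
      rewrite ger0_norm ?res_ge0 // /res ge_max.
      rewrite mulr_ge0 ?sqr_ge0 ?addr_ge0 // ?mulr_ge0 ?sqr_ge0 // andbT.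
      have H2 : tk k * dot (G t xs) d <= 0 by rewrite mulr_ge0_le0 // ltW.
      have := le_trans (ler_norm _) H1; lra.
    near=> k; rewrite res_le0 ?normr0; last first.
      near: k.
      have : c t (xk k) + sgk k * sh t @[k --> \oo] --> c t xs + 0 ^+ 3 * sh t.
        apply: cvgD; first exact: (cvg_comp _ _ xk_cvg (cc xs)).
        by apply: cvgMr_tmp; exact: (cvg_comp _ _ cvg_tk (@exprn_continuous R 3 0)).
      by move=> H1; apply: cvgr_le H1 _ _; rewrite expr0n mul0r addr0.
    by rewrite mulr_ge0 ?sqr_ge0 ?addr_ge0 // ?mulr_ge0 ?sqr_ge0.
  have cxs0 := eqs (negbT bt); have d0 := eqd (negbT bt).
  by apply: filterS expand => k /(_ cxs0); rewrite /= d0 mulr0 subr0.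
move=> /choice[K HK].
have HK' : \forall k \near \oo, forall t,
    `|res (b t) (c t (xk k) + sgk k * sh t)| <= K t * tk k ^+ 2.
  by apply: filter_forall => t; have [] := HK t.
exists (\sum_t K t); split; first by apply: sumr_ge0 => t _; have [] := HK t.
apply: filterS HK' => k Hk; apply: le_trans (sqrt_sum_sqr _) _.
by rewrite mulr_suml; apply: ler_sum.
Unshelve. all: by end_near. Qed.


(** No point near [xs] solves the shifted system; an objective is included as the
    inequality [f x - f xs <= 0] with a positive shift. *)
Hypothesis infeasible : exists2 e : R, 0 < e & forall x, `|x - xs| < e ->
  forall sg, 0 < sg -> exists t, res (b t) (c t x + sg * sh t) != 0.

(** [u k] minimises [theta] plus [|u - xk k|^2 / tk k].  Comparison with the value
    at [xk k] bounds [|u k - xk k|^2] by a multiple of [tk k ^+ 3], so that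
    [w k = (u k - xk k) / tk k] tends to zero; stationarity then says that the
    normalised residuals combine the gradients to [- 2 *: w k]. *)
Lemma approx_multipliers : exists (w : nat -> 'rV[R]_n) (u : nat -> 'rV[R]_n),
  [/\ w k @[k --> \oo] --> (0 : 'rV[R]_n),
      forall k, u k = xs + tk k *: (d + w k) &
      \forall k \near \oo, 0 < theta (sgk k) (u k) /\
        \sum_t (res (b t) (c t (u k) + sgk k * sh t) / theta (sgk k) (u k))
          *: G t (u k) = - 2 *: w k].
Proof.
have [e1 e1_gt0 He1] := infeasible.
have : \forall u \near xs, forall t, exists C, \forall v \near (0 : 'rV[R]_n),
     `|c t (u + v) - c t u - dot (G t u) v| <= C * `|v| ^+ 2.
  apply: (@filter_forall _ _ (fun t u => exists C,
    \forall v \near (0 : 'rV[R]_n),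
     `|c t (u + v) - c t u - dot (G t u) v| <= C * `|v| ^+ 2) (nbhs xs)) => t.
  by apply: C11_local; have [] := smooth t.
move=> /near_norm_lt[e2 e2_gt0 He2].
pose e := Num.min e1 e2.
have e_gt0 : 0 < e by rewrite lt_min e1_gt0.
pose Q k y := theta (sgk k) y + (tk k)^-1 * dot (y - xk k) (y - xk k).
have cQ k : continuous (Q k).
  move=> x.
  have cB : y - xk k @[y --> x] --> x - xk k.
    exact: (cvgB (@cvg_id _ (nbhs x)) (@cvg_cst _ (xk k) _ (nbhs x) _)).
  exact: (cvgD (@theta_continuous (sgk k) x)
    (@cvgMl_tmp _ _ _ _ _ (tk k)^-1 _ (cvg_dot _ cB cB))).
have he : 0 <= e / 2 by rewrite divr_ge0 // ltW.
have [u Hu] := choice (fun k => ball_min xs (cQ k) he).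
have [K [K0 HK]] := theta_on_ray.
pose w k := (tk k)^-1 *: (u k - xk k).
have uE k : u k - xk k = tk k *: w k.
  by rewrite /w scalerA divff ?scale1r // lt0r_neq0.
have xk_cvg : xk k @[k --> \oo] --> xs.
  rewrite -[X in _ --> X]addr0 -(scale0r d).
  by apply: cvgD; [exact: cvg_cst|apply: cvgZr_tmp].
have w0 : w k @[k --> \oo] --> (0 : 'rV[R]_n).
  apply/cvgr0Pnorm_le => eps eps0.
  near=> k.
  have H1 : `|xk k - xs| <= e / 2.
    by rewrite distrC; near: k; apply: cvgr_dist_le; rewrite // divr_gt0.
  have H2 : theta (sgk k) (xk k) <= K * tk k ^+ 2 by near: k.
  have H3 : K * tk k <= eps ^+ 2.
    near: k; apply: (@cvgr_le _ _ _ _ _ (K * 0)); first exact: cvgMl_tmp.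
    by rewrite mulr0 exprn_gt0.
  have := (Hu k).2 _ H1; rewrite /Q subrr dot0l mulr0 addr0 => H4.
  have H5 : (tk k)^-1 * dot (u k - xk k) (u k - xk k) <= K * tk k ^+ 2.
    by apply: le_trans (le_trans H4 H2); rewrite lerDr sqrtr_ge0.
  rewrite -ler_sqr ?nnegrE ?(ltW eps0) //; apply: le_trans H3.
  apply: le_trans (sqr_norm_le_dot _) _.
  move: H5; rewrite uE dotZl dotZr mulKf ?lt0r_neq0 //.
  by rewrite expr2 mulrA mulrC ler_pM2r.
exists w, u; split=> // [k|].
  by rewrite scalerDr -uE /xk addrA addrC subrK.
near=> k.
have H1 : `|u k - xs| < e / 2.
  have -> : u k - xs = (u k - xk k) + (xk k - xs) by rewrite addrA subrK.
  apply: le_lt_trans (ler_normD _ _) _; rewrite (splitr (e / 2)); apply: ltrD.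
    rewrite uE normrZ (ger0_norm (ltW (tk_gt0 k))).
    near: k; apply: (@cvgr_lt _ _ _ _ _ (0 * `|0 : 'rV[R]_n|)).
      by apply: cvgM => //; exact: cvg_norm.
    by rewrite mul0r !divr_gt0.
  by rewrite distrC; near: k; apply: cvgr_dist_lt; rewrite // !divr_gt0.
have [ue1 ue2] : `|u k - xs| < e1 /\ `|u k - xs| < e2.
  have : `|u k - xs| < e by apply: lt_trans H1 _; rewrite ltr_pdivrMr // mulr_natr mulr2n ltrDl.
  by rewrite lt_min => /andP.
set A := \sum_t res (b t) (c t (u k) + sgk k * sh t) ^+ 2.
have A0 : 0 < A.
  have [t rt] := He1 _ ue1 (sgk k) (exprn_gt0 _ (tk_gt0 k)).
  rewrite /A (bigD1 t) //= ltr_pwDl ?exprn_even_gt0 //.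
  by apply: sumr_ge0 => ? _; exact: sqr_ge0.
have th0 : 0 < theta (sgk k) (u k) by rewrite sqrtr_gt0.
split=> //.
have thE : theta (sgk k) (u k) = Num.sqrt A by [].
have kap0 : 0 <= (2 * Num.sqrt A)^-1.
  by rewrite invr_ge0 mulr_ge0 // sqrtr_ge0.
have := @penalty_stationary R n T b c (fun t => G t (u k))
  (fun t => sgk k * sh t) (u k) (xk k) Num.sqrt _ (tk k)^-1 (He2 _ ue2) kap0
  (fun A' => @sqrt_upper A A' A0).
have uin : \forall v \near (0 : 'rV[R]_n), Num.sqrt A + (tk k)^-1 * dot (u k - xk k) (u k - xk k) <=
   theta (sgk k) (u k + v) + (tk k)^-1 * dot (u k + v - xk k) (u k + v - xk k).
  apply/near_norm_lt; exists (e / 2 - `|u k - xs|); first by rewrite subr_gt0.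
  move=> v; rewrite subr0 => ve; apply: (Hu k).2.
  rewrite addrAC; apply: le_trans (ler_normD _ _) _.
  by rewrite -lerBrDl ltW.
move=> /(_ uin) E.
transitivity (2 *: (\sum_t ((2 * Num.sqrt A)^-1 *
    res (b t) (c t (u k) + sgk k * sh t)) *: G t (u k))).
  rewrite scaler_sumr thE; apply: eq_bigr => t _; rewrite scalerA.
  by congr (_ *: _); field; rewrite sqrtr_eq0 -ltNge.
by rewrite E uE !scalerA; congr (_ *: _); field; exact: lt0r_neq0.
Unshelve. all: by end_near. Qed.


(** The multipliers are limits of normalised residuals.  A nonzero limit has the
    sign of its residual, hence the active constraints that carry a multiplier are
    violated along [u k]; this forces [dot (G t xs) d = 0] for them, and bounds
    the combination of the constraint functions from below. *)
Lemma second_order_FJ : exists Lam : T -> R,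
  [/\ (exists t, Lam t != 0) /\ (forall t, b t -> 0 <= Lam t),
      forall t, Lam t != 0 -> c t xs = 0 /\ dot (G t xs) d = 0,
      \sum_t Lam t *: G t xs = 0 &
      0 <= \sum_t Lam t * q t].
Proof.
have [w [u [w0 uE stat]]] := approx_multipliers.
have [U [UU ooU]] := ultraFilterLemma (eventually_filter).
pose th k := theta (sgk k) (u k).
pose r k t := res (b t) (c t (u k) + sgk k * sh t).
pose L k t := r k t / th k.
have statU : \forall k \near U, 0 < th k /\ \sum_t L k t *: G t (u k) = - 2 *: w k.
  exact: ooU.
have thU : \forall k \near U, 0 < th k by apply: filterS statU => k [].
have thE k : th k ^+ 2 = \sum_t r k t ^+ 2.
  by rewrite sqr_sqrtr //; apply: sumr_ge0 => t _; exact: sqr_ge0.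
have L1 : \forall k \near U, \sum_t L k t ^+ 2 = 1.
  apply: filterS thU => k th0.
  under eq_bigr do rewrite expr_div_n.
  by rewrite -mulr_suml -thE divff // lt0r_neq0 // exprn_gt0.
have Lex : forall t, exists l : R, L k t @[k --> U] --> l.
  move=> t; apply: (@ultra_cvg_bounded _ _ _ _ 1).
  apply: filterS L1 => k L1.
  rewrite -sqrtr_sqr -[leRHS]sqrtr1; apply: ler_wsqrtr.
  rewrite -L1 (bigD1 t) //= lerDl.
  by apply: sumr_ge0 => ? _; exact: sqr_ge0.
have [Lam HLam] := choice Lex.
have tU : tk k @[k --> U] --> 0 by apply: cvg_trans cvg_tk; exact: cvg_app ooU.
have wU : w k @[k --> U] --> (0 : 'rV[R]_n) by apply: cvg_trans w0; exact: cvg_app ooU.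
have aU : d + w k @[k --> U] --> d.
  have H : d + w k @[k --> U] --> d + 0 by apply: cvgD wU; exact: cvg_cst.
  by rewrite addr0 in H.
have uU : u k @[k --> U] --> xs.
  under eq_cvg do rewrite uE.
  have H : xs + tk k *: (d + w k) @[k --> U] --> xs + 0 *: d.
    by apply: cvgD; [exact: cvg_cst|exact: cvgZ].
  by rewrite scale0r addr0 in H.
have cU t : c t (u k) @[k --> U] --> c t xs.
  by have [[cc _ _] _] := smooth t; exact: (cvg_comp _ _ uU (cc xs)).
pose rho t k := (c t (u k) - c t xs - tk k * dot (G t xs) (d + w k)) / tk k ^+ 2.
have rhoU t : rho t k @[k --> U] --> q t / 2.
  have [_ o2] := smooth t.
  have -> : rho t = fun k => (c t (xs + tk k *: (d + w k)) - c t xs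
      - tk k * dot (G t xs) (d + w k)) / tk k ^+ 2.
    by apply/funext => k; rewrite /rho uE.
  by apply: o2 => //; apply: nearW => k; exact: tk_gt0.
(* a nonzero limit and its residual have eventually the same sign *)
have signL t : Lam t != 0 -> \forall k \near U, 0 < Lam t * (c t (u k) + sgk k * sh t).
  move=> Lt0.
  have : \forall k \near U, 0 < Lam t * L k t.
    have : Lam t * L k t @[k --> U] --> Lam t * Lam t by exact: cvgMl_tmp.
    by move=> H; apply: cvgr_gt H _ _; rewrite -expr2 exprn_even_gt0.
  apply: filterS2 thU => k th0; rewrite /L mulrA pmulr_lgt0 ?invr_gt0 // /r.
  case: (b t) => //= H.
  have rN0 : res true (c t (u k) + sgk k * sh t) != 0.
    by apply/negP => /eqP E; move: H; rewrite /= in E; rewrite E mulr0 ltxx.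
  by have [_ <-] := res_gt0 rN0.
have Lge0 t : b t -> 0 <= Lam t.
  move=> bt; apply: (cvgr_to_ge (HLam t)).
  by apply: filterS thU => k th0; rewrite divr_ge0 ?(ltW th0) // /r bt res_ge0.
have stat0 : \sum_t Lam t *: G t xs = 0.
  have H1 : \sum_t L k t *: G t (u k) @[k --> U] --> \sum_t Lam t *: G t xs.
    apply: cvg_sumr => t; apply: cvgZ; first exact: HLam.
    by have [[_ cG _] _] := smooth t; exact: (cvg_comp _ _ uU cG).
  have H2 : \sum_t L k t *: G t (u k) @[k --> U] --> (- 2 *: 0 : 'rV[R]_n).
    have H3 : - 2 *: w k @[k --> U] --> (- 2 *: 0 : 'rV[R]_n) by exact: cvgZl_tmp.
    apply: cvg_trans H3.
    by apply: near_eq_cvg; apply: filterS statU => k [_ ->].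
  by rewrite scaler0 in H2; exact: (cvg_unique _ H1 H2).
have Lact t : Lam t != 0 -> c t xs = 0 /\ dot (G t xs) d = 0.
  move=> Lt; case bt : (b t); last by rewrite eqs ?eqd ?bt.
  have Lt_gt0 : 0 < Lam t by rewrite lt_neqAle eq_sym Lt Lge0.
  have pos : \forall k \near U, 0 <= c t (u k) + sgk k * sh t.
    by apply: filterS (signL t Lt) => k; rewrite pmulr_rgt0 // => /ltW.
  have sgU : sgk k @[k --> U] --> 0.
    have H := cvg_comp _ _ tU (@exprn_continuous R 3 0).
    by rewrite expr0n in H.
  have c0 : c t xs = 0.
    apply/eqP; rewrite eq_le ineqs //=.
    apply: (@cvgr_to_ge _ U _ _ (fun k => c t (u k) + sgk k * sh t) _ _ _ pos).
    have H : c t (u k) + sgk k * sh t @[k --> U] --> c t xs + 0 * sh t.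
      by apply: cvgD => //; exact: cvgMr_tmp.
    by rewrite mul0r addr0 in H.
  split=> //; apply/eqP; rewrite eq_le ineqd //=.
  have H1 : dot (G t xs) (d + w k) + tk k * (rho t k + tk k * sh t) @[k --> U]
     --> dot (G t xs) d + 0 * (q t / 2 + 0 * sh t).
    apply: cvgD; first by apply: cvg_dot => //; exact: cvg_cst.
    by apply: cvgM => //; apply: cvgD => //; exact: cvgMr_tmp.
  rewrite mul0r addr0 in H1; apply: (cvgr_to_ge H1).
  apply: filterS pos => k.
  have tk0 := tk_gt0 k.
  have -> : c t (u k) + sgk k * sh t =
    tk k * (dot (G t xs) (d + w k) + tk k * (rho t k + tk k * sh t)).
    by rewrite /rho c0 /sgk; field; exact: lt0r_neq0.
  by rewrite pmulr_rge0.
exists Lam; split=> //.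
- split=> //.
  apply: contrapT => /forallNP H.
  have H1 : \sum_t L k t ^+ 2 @[k --> U] --> \sum_t Lam t ^+ 2.
    apply: cvg_sumr => t.
    exact: (cvg_comp _ _ (HLam t) (@exprn_continuous R 2 _)).
  have H2 : \sum_t L k t ^+ 2 @[k --> U] --> (1 : R).
    by apply: cvg_trans (@cvg_cst _ (1 : R) _ U _); apply: near_eq_cvg; apply: filterS L1 => k ->.
  have H3 : \sum_t Lam t ^+ 2 = 1 by exact: (cvg_unique _ H1 H2).
  suff H4 : \sum_t Lam t ^+ 2 = 0 by move/eqP: H3; rewrite H4 eq_sym oner_eq0.
  apply: big1 => t _.
  by have /negP := H t; rewrite negbK => /eqP->; rewrite expr0n.
- have H1 : \sum_t Lam t * rho t k + tk k * (\sum_t Lam t * sh t) @[k --> U] -->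
     \sum_t Lam t * (q t / 2) + 0 * (\sum_t Lam t * sh t).
    apply: cvgD; last exact: cvgMr_tmp.
    by apply: cvg_sumr => t; exact: cvgMl_tmp.
  have : 0 <= \sum_t Lam t * (q t / 2) + 0 * (\sum_t Lam t * sh t).
    apply: (cvgr_to_ge H1).
    have : \forall k \near U, forall t, 0 <= Lam t * (c t (u k) + sgk k * sh t).
      apply: filter_forall => t; have [->|/signL H] := eqVneq (Lam t) 0.
        by apply: nearW => k; rewrite mul0r.
      by apply: filterS H => k /ltW.
    apply: filterS => k Hk.
    have tk0 := tk_gt0 k.
    suff -> : \sum_t Lam t * rho t k + tk k * (\sum_t Lam t * sh t) =
       (\sum_t Lam t * (c t (u k) + sgk k * sh t)) / tk k ^+ 2.
      by rewrite divr_ge0 ?sqr_ge0 // sumr_ge0.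
    have E : \sum_t Lam t * (tk k * dot (G t xs) (d + w k)) = 0.
      under eq_bigr do rewrite mulrCA -dotZl.
      by rewrite -mulr_sumr -dot_suml stat0 dot0l mulr0.
    have -> : \sum_t Lam t * (c t (u k) + sgk k * sh t) = \sum_t
       (Lam t * (c t (u k) + sgk k * sh t) - Lam t * (tk k * dot (G t xs) (d + w k))).
      by rewrite sumrB E subr0.
    rewrite mulr_suml mulr_sumr -big_split /=; apply: eq_bigr => t _.
    have [->|/Lact[c0 _]] := eqVneq (Lam t) 0; first by rewrite !mul0r mulr0 addr0 subr0 mul0r.
    by rewrite /rho c0 /sgk; field; exact: lt0r_neq0.
  rewrite mul0r addr0; under eq_bigr do rewrite mulrA.
  by rewrite -mulr_suml pmulr_lge0 // invr_gt0 ltr0n.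
Qed.

End SecondOrderFJ.

(** * Exact penalisation from bounded multipliers *)

Section ExactPenalty.
Context {R : realType} {n : nat}.
Implicit Types (x y z v : 'rV[R]_n).

Lemma C11_lipschitz (f : 'rV[R]_n -> R) gf xs : C11_at f gf xs ->
  exists L e : R, [/\ 0 < L, 0 < e & forall x y, `|x - xs| < e -> `|y - xs| < e ->
    `|f y - f x| <= L * `|y - x|].
Proof.
move=> [_ cg [C [e [C0 e0 H]]]].
have : \forall z \near xs, `|gf z| <= `|gf xs| + 1.
  by apply: cvgr_norm_le cg _ _; rewrite ltrDl.
move=> /near_norm_lt[e' e'0 He'].
exists (n%:R * (`|gf xs| + 1) + C * 2 + 1), (Num.min 1 (Num.min e e')); split.
- by rewrite ltr_wpDl // addr_ge0 ?mulr_ge0 // addr_ge0.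
- by rewrite !lt_min e0 e'0 ltr01.
move=> x y; rewrite !lt_min => /andP[x1 /andP[xe xe']] /andP[y1 /andP[ye _]].
have yx2 : `|y - x| <= 2.
  have -> : y - x = (y - xs) - (x - xs) by rewrite opprB addrA subrK.
  by apply: le_trans (ler_normB _ _) _; rewrite [2](_ : _ = 1 + 1) // lerD ?ltW.
have -> : f y - f x = (f y - f x - dot (gf x) (y - x)) + dot (gf x) (y - x).
  by rewrite subrK.
apply: le_trans (ler_normD _ _) _.
have H1 := H x y xe ye.
have H2 : `|dot (gf x) (y - x)| <= n%:R * (`|gf xs| + 1) * `|y - x|.
  apply: le_trans (norm_dot _ _) _; rewrite ler_wpM2r // ler_wpM2l //.
  exact: He'.
have H3 : C * `|y - x| ^+ 2 <= C * 2 * `|y - x|.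
  by rewrite expr2 mulrA ler_wpM2r // ler_wpM2l.
rewrite !mulrDl mul1r; have := normr_ge0 (y - x); lra.
Qed.

Lemma le_sqrD1 (y : R) : 0 <= y -> y <= (y + 1) ^+ 2.
Proof. by nra. Qed.

(** A step from a point with value [cz] to one with value [cx], whose linear part
    is [l]: an inequality that carries a multiplier is violated at the first point,
    so moving cannot gain more than the residual at the second one. *)
Lemma residual_decrease (b : bool) (cx cz l lam eta rem : R) :
  `|cx - cz - l| <= rem -> `|res b cz| <= eta ->
  (b -> 0 <= lam) -> (b -> lam != 0 -> 0 < cz) ->
  lam * l <= `|lam| * (`|res b cx| + (eta + rem)).
Proof.
rewrite ler_norml => /andP[lo hi]; case: b => [etaz lam0 cz0|+ _ _].
  have [->|lamN0] := eqVneq lam 0; first by rewrite normr0 !mul0r.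
  rewrite ger0_norm ?lam0 // ler_wpM2l ?lam0 //.
  have cx0 : cx <= `|res true cx|.
    by rewrite ger0_norm ?res_ge0 //= le_max lexx.
  have := cz0 isT lamN0; have := le_trans (normr_ge0 _) etaz; lra.
rewrite /= ler_norml => /andP[E1 E2].
apply: le_trans (ler_norm _) _; rewrite normrM ler_wpM2l //.
have := ler_norm cx; have := ler_norm (- cx); rewrite normrN => A1 A2.
by rewrite ler_norml; apply/andP; split; lra.
Qed.

(** The quadratic term is absorbed in the left-hand side; what remains contradicts
    the lower bound on the step [w]. *)
Lemma no_small_step (M N C phi eta w r : R) :
  w <= M * (phi + N * (eta + C * w ^+ 2)) -> M * N * C * w <= 2^-1 ->
  M * phi <= r / 8 -> M * (N * eta) <= r / 8 -> r / 2 < w -> 0 <= w -> False.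
Proof.
move=> dw small Mphi Meta rw w0.
have sq : M * (N * (C * w ^+ 2)) <= 2^-1 * w.
  by rewrite expr2 !mulrA ler_wpM2r.
rewrite !mulrDr in dw; lra.
Qed.

Context {T : finType}.
Variables (b : T -> bool) (c : T -> 'rV[R]_n -> R) (G : T -> 'rV[R]_n -> 'rV[R]_n).
Variables (f : 'rV[R]_n -> R) (gf : 'rV[R]_n -> 'rV[R]_n) (xs : 'rV[R]_n).
Hypothesis hc : forall t, C11_at (c t) (G t) xs.
Hypothesis hf : C11_at f gf xs.

Lemma C11_uniform : exists C e : R, [/\ 0 <= C, 0 < e & forall t x y,
    `|x - xs| < e -> `|y - xs| < e ->
    `|c t y - c t x - dot (G t x) (y - x)| <= C * `|y - x| ^+ 2].
Proof.
have : forall t, exists C, 0 <= C /\ \forall e \near 0^'+, forall x y,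
    `|x - xs| < e -> `|y - xs| < e ->
    `|c t y - c t x - dot (G t x) (y - x)| <= C * `|y - x| ^+ 2.
  move=> t; have [_ _ [C [e [C0 e0 H]]]] := hc t.
  exists C; split=> //; near=> e' => x y xe ye.
  have ee : e' <= e by near: e'; exact: nbhs_right_le.
  by apply: H; exact: lt_le_trans ee.
move=> /choice[C HC].
have : \forall e \near 0^'+, forall t x y, `|x - xs| < e -> `|y - xs| < e ->
    `|c t y - c t x - dot (G t x) (y - x)| <= C t * `|y - x| ^+ 2.
  by apply: filter_forall => t; have [] := HC t.
move=> /(filterI (nbhs_right_gt (0 : R)))/filter_ex[e [/= e0 He]].
have C0 t : 0 <= C t by have [] := HC t.
exists (\sum_t C t), e; split=> //; first by rewrite sumr_ge0.
move=> t x y xe ye; apply: le_trans (He t x y xe ye) _.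
by rewrite ler_wpM2r ?sqr_ge0 // (bigD1 t) //= lerDl sumr_ge0.
Unshelve. all: by end_near. Qed.

(** Replacing the multipliers must not create new inequality multipliers: those
    present before belong to violated constraints. *)
Definition bounded_multipliers :=
  exists M e : R, [/\ 0 <= M, 0 < e & forall z, `|z - xs| < e ->
  forall Lam : T -> R, (forall t, b t -> 0 <= Lam t) ->
  (forall t, b t -> Lam t != 0 -> c t xs = 0) ->
  exists Lam' : T -> R, [/\ forall t, b t -> 0 <= Lam' t,
    forall t, b t -> Lam t = 0 -> Lam' t = 0,
    \sum_t Lam' t *: G t z = \sum_t Lam t *: G t z &
    forall t, `|Lam' t| <= M * `|\sum_t Lam t *: G t z|]].

Let phi x := \sum_t `|res (b t) (c t x)|.
Let phi2 x := \sum_t res (b t) (c t x) ^+ 2.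

Lemma phi2_continuous : continuous phi2.
Proof.
move=> x; apply: (@cvg_sumr _ _ _ (nbhs x)) => t.
have [cc _ _] := hc t.
have H := cvg_comp _ _ (cc x) (@res_continuous R (b t) _).
exact: (cvg_comp _ _ H (@exprn_continuous R 2 _)).
Qed.

(** Suppose that [f x + kap * phi x < f xs] for some [x] near [xs].  As [f] is
    Lipschitz, no feasible point lies within [r = (f xs - f x) / L] of [x].
    Minimise [N * phi2 + |. - x|^2] for large [N]: the minimiser [z] has small
    residuals, is farther than [r / 2] from [x], and [x - z] is a combination of
    the gradients at [z].  With bounded multipliers, the inner product of this
    combination with [x - z] is at most [|x - z|] times the residuals at [x] and
    [z], up to a quadratic remainder.  Hence [|x - z|] is bounded by a multiple of
    [phi x < r * L / kap], which is impossible when [kap] is large. *)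
Lemma exact_penalty :
  (forall t, res (b t) (c t xs) = 0) ->
  (exists2 e : R, 0 < e & forall x, `|x - xs| < e ->
     (forall t, res (b t) (c t x) = 0) -> f xs <= f x) ->
  bounded_multipliers ->
  exists kap e : R, [/\ 0 < kap, 0 < e &
    forall x, `|x - xs| < e -> f xs <= f x + kap * phi x].
Proof.
move=> feas [el el0 Hl] [M [eb [M0 eb0 HM]]].
have [C [ec [C0 ec0 HC]]] := C11_uniform.
have [L [eL [L0 eL0 HL]]] := C11_lipschitz hf.
have : \forall z \near xs, forall t, b t -> 0 < c t z -> c t xs = 0.
  apply: (@filter_forall _ _ (fun t z => b t -> 0 < c t z -> c t xs = 0) (nbhs xs)) => t.
  have [-> | cN0] := eqVneq (c t xs) 0; first exact: nearW.
  case bt : (b t); last exact: nearW.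
  have clt : c t xs < 0.
    rewrite lt_neqAle cN0 -res_eq0; apply/eqP; have := feas t.
    by rewrite bt.
  have [cc _ _] := hc t.
  have : \forall z \near xs, c t z < 0 by apply: cvgr_lt (cc xs) _ _.
  by apply: filterS => z cz _ /(lt_trans cz); rewrite ltxx.
move=> /near_norm_lt[ea ea0 Ha].
pose cT : R := #|T|%:R.
have cT0 : 0 <= cT by [].
(* a radius at which the quadratic remainders take at most half of the step *)
pose ek : R := (2 * (M * cT * C + 1))^-1.
have k0 : 0 <= M * cT * C by rewrite !mulr_ge0.
have ek0 : 0 < ek by rewrite invr_gt0 mulr_gt0 // ltr_wpDl.
pose e0 := Num.min el (Num.min eb (Num.min ec (Num.min eL (Num.min ea ek)))).
have e0_gt0 : 0 < e0 by rewrite !lt_min el0 eb0 ec0 eL0 ea0.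
have e0P x : `|x - xs| < e0 -> [/\ `|x - xs| < el, `|x - xs| < eb,
    `|x - xs| < ec, `|x - xs| < eL & `|x - xs| < ea].
  by rewrite !lt_min => /and5P[-> -> -> -> /andP[-> _]].
have e0k : e0 <= ek by rewrite !ge_min lexx !orbT.
pose n2 : R := n%:R + 2.
have n2_gt0 : 0 < n2 by rewrite ltr_wpDl.
(* then [M * phi x <= r / 8] as soon as [kap * phi x < r * L] *)
pose kap := 8 * (M + 1) * L.
have kap0 : 0 < kap by rewrite !mulr_gt0 // ltr_wpDl.
exists kap, (e0 / 2 / n2); split=> [||x xe]; [by []|by rewrite !divr_gt0|].
rewrite leNgt; apply/negP => Hx.
pose dx := `|x - xs|.
have dx_e : n2 * dx < e0 / 2 by rewrite mulrC -ltr_pdivlMr.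
have dx0 : 0 <= dx by exact: normr_ge0.
have dx2 : 2 * dx <= n2 * dx by rewrite ler_wpM2r // lerDr.
have xe0 : `|x - xs| < e0 by rewrite -/dx; lra.
have [xel xeb xec xeL xea] := e0P _ xe0.
have xs_in e : 0 < e -> `|xs - xs| < e by rewrite subrr normr0.
pose r := (f xs - f x) / L.
have phix0 : 0 <= phi x by exact: sumr_ge0.
have r0 : 0 < r.
  rewrite divr_gt0 // subr_gt0; apply: le_lt_trans Hx.
  by rewrite lerDl mulr_ge0 // ltW.
have rdx : r <= dx.
  rewrite ler_pdivrMr // mulrC; apply: le_trans (ler_norm _) _.
  rewrite /dx distrC; apply: HL => //; exact: xs_in.
have phir : kap * phi x < r * L.
  by rewrite /r divfK ?lt0r_neq0 //; lra.
(* no point within distance [r / 2] of [x] is feasible, so the squared residuals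
   have a positive minimum [m] there *)
have [y0 [y0x y0min]] := ball_min x phi2_continuous (ltW (divr_gt0 r0 (ltr0n R 2))).
have m0 : 0 < phi2 y0.
  rewrite lt_neqAle sumr_ge0 ?andbT => [|t _]; last exact: sqr_ge0.
  apply/negP => /eqP/esym H0.
  have y0e : `|y0 - xs| < e0.
    have -> : y0 - xs = (y0 - x) + (x - xs) by rewrite addrA subrK.
    by apply: le_lt_trans (ler_normD _ _) _; rewrite -/dx; lra.
  have [y0el _ _ y0eL _] := e0P _ y0e.
  have /(Hl _ y0el) : forall t, res (b t) (c t y0) = 0.
    move=> t; apply/eqP; rewrite -sqrf_eq0; apply/eqP.
    apply: (psumr_eq0P _ H0) => // ? _; exact: sqr_ge0.
  have H4 := le_trans (ler_norm _) (HL x y0 xeL y0eL).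
  have H1 : L * `|y0 - x| <= L * (r / 2) by rewrite ler_wpM2l // ltW.
  have H2 : L * (r / 2) = (f xs - f x) / 2 by rewrite /r; field; exact: lt0r_neq0.
  have H3 : 0 < f xs - f x by rewrite -(divfK (lt0r_neq0 L0) (f xs - f x)) mulr_gt0.
  by move=> H5; clear - H1 H2 H3 H4 H5; lra.
set m := phi2 y0 in m0.
(* bound on the residuals at the minimiser: their total, times [M], is at most
   [r / 8] *)
pose eta := r / (8 * ((M + 1) * (cT + 1))).
have eta0 : 0 < eta by rewrite divr_gt0 // !mulr_gt0 // ltr_wpDl.
pose D := n%:R * dx ^+ 2.
have D0 : 0 <= D by rewrite mulr_ge0 // sqr_ge0.
(* the first term keeps the minimiser away from the ball of radius [r / 2] about
   [x], the second one makes its residuals at most [eta] *)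
pose N := (D + 1) / m + D / eta ^+ 2.
have N1 : 0 < (D + 1) / m by rewrite divr_gt0 // ltr_wpDl.
have N2 : 0 <= D / eta ^+ 2 by rewrite divr_ge0 // sqr_ge0.
have N0 : 0 < N by rewrite ltr_wpDr.
pose Q y := N * phi2 y + 1 * dot (y - x) (y - x).
have cQ : continuous Q.
  move=> y.
  have cB : z - x @[z --> y] --> y - x.
    exact: (cvgB (@cvg_id _ (nbhs y)) (@cvg_cst _ x _ (nbhs y) _)).
  exact: (cvgD (@cvgMl_tmp _ _ _ _ _ N _ (@phi2_continuous y))
    (@cvgMl_tmp _ _ _ _ _ 1 _ (cvg_dot _ cB cB))).
have [z [ze zmin]] := ball_min xs cQ (ltW (divr_gt0 e0_gt0 (ltr0n R 2))).
have phi20 y : 0 <= phi2 y by apply: sumr_ge0 => t _; exact: sqr_ge0.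
have Qz : N * phi2 z + dot (z - x) (z - x) <= D.
  have := zmin xs; rewrite subrr normr0 => /(_ (ltW (divr_gt0 e0_gt0 (ltr0n R 2)))).
  rewrite /Q !mul1r => H; apply: le_trans H _.
  rewrite [phi2 xs]big1 ?mulr0 ?add0r => [|t _]; last by rewrite feas expr0n.
  by apply: le_trans (dot_le_sqr_norm _) _; rewrite distrC.
have Nphi2 : N * phi2 z <= D by apply: le_trans Qz; rewrite lerDl dot_ge0.
have zxD : dot (z - x) (z - x) <= D.
  by apply: le_trans Qz; rewrite lerDr mulr_ge0 // ltW.
have zx : `|z - x| <= (n%:R + 1) * dx.
  rewrite -ler_sqr ?nnegrE ?mulr_ge0 ?addr_ge0 //.
  apply: le_trans (sqr_norm_le_dot _) _; apply: le_trans zxD _.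
  by rewrite exprMn ler_wpM2r ?sqr_ge0 // le_sqrD1.
have ze2 : `|z - xs| < e0 / 2.
  have -> : z - xs = (z - x) + (x - xs) by rewrite addrA subrK.
  apply: le_lt_trans (ler_normD _ _) _; rewrite -/dx.
  apply: le_lt_trans dx_e.
  by rewrite /n2 [2](_ : _ = 1 + 1) // addrA mulrDl mul1r lerD2r.
have ze0 : `|z - xs| < e0.
  by apply: lt_trans ze2 _; rewrite ltr_pdivrMr // ltr_pMr // ltr1n.
have [zel zeb zec zeL zea] := e0P _ ze0.
have rw : r / 2 < `|z - x|.
  rewrite ltNge; apply/negP => /y0min; rewrite -/m => mz.
  have Nm : N * m <= N * phi2 z by rewrite ler_wpM2l // ltW.
  have Dm : D + 1 <= N * m.
    by rewrite /N mulrDl divfK ?lt0r_neq0 // lerDl mulr_ge0 // ltW.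
  by have := le_trans Dm (le_trans Nm Nphi2); rewrite gerDl ler10.
have reseta t : `|res (b t) (c t z)| <= eta.
  rewrite -ler_sqr ?nnegrE ?(ltW eta0) // real_normK ?num_real //.
  apply: (@le_trans _ _ (phi2 z)).
    by rewrite /phi2 (bigD1 t) //= lerDl sumr_ge0 // => ? _; exact: sqr_ge0.
  rewrite -(ler_pM2l N0); apply: le_trans Nphi2 _.
  rewrite /N mulrDl divfK; last by rewrite lt0r_neq0 // exprn_gt0.
  by rewrite lerDr mulr_ge0 ?sqr_ge0 // ltW.
have stat : \sum_t (N * res (b t) (c t z + 0)) *: G t z = - 1 *: (z - x).
  apply: (@penalty_stationary R n T b c (fun t => G t z) (fun=> 0) z x (fun A => N * A)).
  - move=> t; exists C; apply/near_norm_lt; exists (e0 - `|z - xs|); first by rewrite subr_gt0.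
    move=> v; rewrite subr0 => ve.
    have zve : `|z + v - xs| < e0.
      rewrite addrAC; apply: le_lt_trans (ler_normD _ _) _.
      by rewrite -ltrBrDl.
    have [_ _ zvec _ _] := e0P _ zve.
    have := HC t z (z + v) zec zvec.
    by rewrite [z + v - z]addrC addKr.
  - exact: ltW.
  - by move=> A' _; rewrite mulrBr addrC subrK.
  - have sE y : \sum_t res (b t) (c t y + 0) ^+ 2 = phi2 y.
      by apply: eq_bigr => t _; rewrite addr0.
    apply/near_norm_lt; exists (e0 / 2 - `|z - xs|); first by rewrite subr_gt0.
    move=> v; rewrite subr0 => ve; rewrite !sE; apply: zmin.
    rewrite addrAC; apply: le_trans (ler_normD _ _) _.
    by rewrite -lerBrDl ltW.
pose w := x - z.
have wN : `|w| = `|z - x| by rewrite distrC.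
have {}stat : \sum_t (N * res (b t) (c t z)) *: G t z = w.
  rewrite /w -[RHS]opprB -scaleN1r -stat; apply: eq_bigr => t _.
  by rewrite addr0.
have Nres t : b t -> N * res (b t) (c t z) != 0 -> 0 < c t z.
  move=> bt; rewrite mulf_eq0 negb_or => /andP[_].
  by rewrite bt => /res_gt0[].
have [||Lam' [Lp Lz LE LB]] := HM z zeb (fun t => N * res (b t) (c t z)).
- by move=> t bt; rewrite bt mulr_ge0 ?res_ge0 // ltW.
- by move=> t bt /(Nres t bt); exact: Ha.
rewrite stat in LE LB.
have w_gt0 : 0 < `|w| by rewrite wN; apply: lt_trans rw; rewrite divr_gt0.
have Mw0 : 0 <= M * `|w| by rewrite mulr_ge0.
have term t : Lam' t * dot (G t z) w <=
    M * `|w| * (`|res (b t) (c t x)| + (eta + C * `|w| ^+ 2)).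
  have H := HC t z x zec xec; rewrite -/w in H.
  have S0 : 0 <= `|res (b t) (c t x)| + (eta + C * `|w| ^+ 2).
    have C2 : 0 <= C * `|w| ^+ 2 by rewrite mulr_ge0 // sqr_ge0.
    by apply: addr_ge0 => //; apply: addr_ge0 => //; exact: ltW.
  apply: le_trans (residual_decrease H (reseta t) (Lp t) _) _.
    move=> bt L'N0; apply: (Nres t bt); apply: contra_neq L'N0.
    by move=> /(Lz t bt).
  exact: ler_wpM2r.
have dww : `|w| ^+ 2 <= M * `|w| * (phi x + cT * (eta + C * `|w| ^+ 2)).
  apply: le_trans (sqr_norm_le_dot _) _.
  rewrite -{1}LE dot_suml.
  under eq_bigr do rewrite dotZl.
  apply: (@le_trans _ _ (\sum_t M * `|w| *
      (`|res (b t) (c t x)| + (eta + C * `|w| ^+ 2)))).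
    by apply: ler_sum => t _; exact: term.
  rewrite -mulr_sumr big_split /= -/(phi x) sumr_const.
  by rewrite -[X in _ + X]mulr_natl.
have dw : `|w| <= M * (phi x + cT * (eta + C * `|w| ^+ 2)).
  rewrite -(ler_pM2l w_gt0) -expr2; apply: le_trans dww _.
  by rewrite [leRHS]mulrA (mulrC `|w| M).
have small : M * cT * C * `|w| <= 2^-1.
  apply: (@le_trans _ _ (M * cT * C * ek)).
    rewrite ler_wpM2l // wN; apply: le_trans zx _; apply: le_trans e0k.
    apply: (@le_trans _ _ (n2 * dx)); first by rewrite ler_wpM2r // lerD2l ler1n.
    by apply: ltW (lt_trans dx_e _); rewrite ltr_pdivrMr // ltr_pMr // ltr1n.
  rewrite /ek ler_pdivrMr; last by rewrite mulr_gt0 // ltr_wpDl.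
  by rewrite mulKf ?pnatr_eq0 // lerDl.
have Meta : M * (cT * eta) <= r / 8.
  have X0 : 0 < (M + 1) * (cT + 1) by rewrite mulr_gt0 // ltr_wpDl.
  have -> : M * (cT * eta) = r / 8 * (M * cT / ((M + 1) * (cT + 1))).
    by rewrite /eta; field; rewrite !lt0r_neq0 // ltr_wpDl.
  apply: ler_piMr; first by rewrite divr_ge0 // ltW.
  rewrite ler_pdivrMr // mul1r.
  by apply: ler_pM => //; rewrite lerDl.
have Mphi : M * phi x <= r / 8.
  have H1 : 8 * (M + 1) * phi x <= r.
    rewrite -(ler_pM2r L0); apply: ltW; apply: le_lt_trans phir.
    by rewrite /kap mulrAC.
  have H2 : 0 <= 8 * phi x by rewrite mulr_ge0.
  rewrite ler_pdivlMr // mulrC; apply: le_trans H1.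
  by rewrite mulrDr mulr1 mulrDl mulrA lerDl.
rewrite -wN in rw.
exact: no_small_step dw small Mphi Meta rw (normr_ge0 _).
Unshelve. all: by end_near. Qed.

End ExactPenalty.

(** * Multipliers with nonnegative curvature *)

Section Multipliers.
Context {R : realType} {n : nat} {T : finType}.
Variables (b : T -> bool) (c : T -> 'rV[R]_n -> R) (G : T -> 'rV[R]_n -> 'rV[R]_n).
Variables (q : T -> R) (f : 'rV[R]_n -> R) (gf : 'rV[R]_n -> 'rV[R]_n) (qf : R).
Variables (xs d : 'rV[R]_n).
Hypothesis smc : forall t, smooth2_at (c t) (G t) xs d (q t).
Hypothesis smf : smooth2_at f gf xs d qf.
Hypothesis ineqs : forall t, b t -> c t xs <= 0.
Hypothesis ineqd : forall t, b t -> c t xs = 0 -> dot (G t xs) d <= 0.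
Hypothesis eqs : forall t, ~~ b t -> c t xs = 0.
Hypothesis eqd : forall t, ~~ b t -> dot (G t xs) d = 0.
Hypothesis dfd : dot (gf xs) d <= 0.

Lemma smooth2_sub (k : R) : smooth2_at (fun x => f x - k) gf xs d qf.
Proof.
pose F (o : bool) := if o then f else cst k.
pose GF (o : bool) := if o then gf else cst 0.
pose a (o : bool) : R := if o then 1 else - 1.
have := @smooth2_sum _ _ _ F GF a (fun o => if o then qf else 0) xs d.
rewrite big_bool /= mul1r mulr0 addr0.
rewrite (_ : (fun x => \sum_o a o * F o x) = fun x => f x - k); last first.
  by apply/funext => x; rewrite big_bool /= mul1r mulN1r.
rewrite (_ : (fun x => \sum_o a o *: GF o x) = gf); last first.
  by apply/funext => x; rewrite big_bool /= scale1r scaler0 addr0.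
by apply=> -[]; [exact: smf|exact: smooth2_cst].
Qed.

(** The Fritz John theorem for the constraints together with the objective; only
    the objective is shifted. *)
Lemma abnormal_or_normal_multipliers :
  (exists2 e : R, 0 < e & forall x, `|x - xs| < e ->
     (forall t, res (b t) (c t x) = 0) -> f xs <= f x) ->
  exists (l0 : R) (Lam : T -> R),
  [/\ 0 <= l0, l0 != 0 \/ (exists t, Lam t != 0),
     (forall t, b t -> 0 <= Lam t) /\
       (forall t, Lam t != 0 -> c t xs = 0 /\ dot (G t xs) d = 0),
     l0 *: gf xs + \sum_t Lam t *: G t xs = 0 &
     0 <= l0 * qf + \sum_t Lam t * q t].
Proof.
move=> [e e0 He].
pose b' (o : unit + T) := if o is inr t then b t else true.
pose c' (o : unit + T) := if o is inr t then c t else fun x => f x - f xs.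
pose G' (o : unit + T) := if o is inr t then G t else gf.
pose q' (o : unit + T) := if o is inr t then q t else qf.
pose sh (o : unit + T) : R := if o is inr t then 0 else 1.
have [|||||||L [[LN0 Lp] La stat so]] := @second_order_FJ R n _ b' c' G' q' sh xs d.
- by case=> [[]|t]; [exact: smooth2_sub|exact: smc].
- by case.
- by case=> [[]|t] /=; [rewrite subrr|exact: ineqs].
- by case=> [[]|t] //=; exact: ineqd.
- by case=> [[]|t] //=; exact: eqs.
- by case=> [[]|t] //=; exact: eqd.
- exists e => // x xe sg sg0; apply: contrapT => /forallNP H.
  have H0 o : res (b' o) (c' o x + sg * sh o) = 0.
    by apply/eqP; rewrite -[_ == 0]negbK; apply/negP; exact: H.
  have /(He _ xe) : forall t, res (b t) (c t x) = 0.
    by move=> t; have := H0 (inr t); rewrite /= mulr0 addr0.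
  have /eqP := H0 (inl tt); rewrite res_eq0 /= mulr1; lra.
exists (L (inl tt)), (fun t => L (inr t)); split.
- exact: Lp.
- by have [[[]|t] ?] := LN0; [left|right; exists t].
- by split=> [t bt|t]; [exact: Lp|exact: (La (inr t))].
- by move: stat; rewrite big_sumType /= sum_unit.
- by move: so; rewrite big_sumType /= sum_unit.
Qed.

(** The absolute residual of a constraint is the larger of its two weighted values:
    the weights are 0 and 1 for an inequality, 1 and -1 for an equality. *)
Let wt (t : T) (s : bool) : R := if b t then s%:R else (-1) ^+ s.
Let sel (t : T) (y : R) := if b t then 0 < y else y < 0.

Let wt_sel t y : wt t (sel t y) * y = `|res (b t) y|.
Proof.
rewrite /wt /sel; case: (b t) => /=.
  by rewrite maxEle; case: (leP y 0); rewrite ?mul0r ?normr0 ?mul1r // => /gtr0_norm.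
by case: (ltP y 0) => [/ltr0_norm->|/ger0_norm->]; rewrite ?mulN1r ?mul1r.
Qed.

(** [F B] runs over the smooth functions whose maximum is the exact penalty function
    minus [f xs], so no point near [xs] makes all of them negative.  Each [F B]
    contains [f] with coefficient one, and the multiplier of [f] is therefore the
    positive number [S]. *)
Lemma multipliers_of_exact_penalty (kap : R) : 0 < kap ->
  (exists2 e : R, 0 < e & forall x, `|x - xs| < e ->
     f xs <= f x + kap * \sum_t `|res (b t) (c t x)|) ->
  exists Lam : T -> R,
  [/\ forall t, b t -> 0 <= Lam t,
     forall t, b t -> Lam t != 0 -> c t xs = 0,
     gf xs + \sum_t Lam t *: G t xs = 0 &
     0 <= qf + \sum_t Lam t * q t].
Proof.
move=> kap0 [e e0 He].
pose I := {ffun T -> bool}.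
pose a (B : I) (o : unit + T) : R := if o is inr t then kap * wt t (B t) else 1.
pose c' (o : unit + T) := if o is inr t then c t else fun x => f x - f xs.
pose G' (o : unit + T) := if o is inr t then G t else gf.
pose q' (o : unit + T) := if o is inr t then q t else qf.
have sm' o : smooth2_at (c' o) (G' o) xs d (q' o).
  by case: o => [[]|t]; [exact: smooth2_sub|exact: smc].
pose F (B : I) x := \sum_o a B o * c' o x.
have FE B x : F B x = f x - f xs + kap * \sum_t wt t (B t) * c t x.
  rewrite /F big_sumType /= sum_unit mul1r mulr_sumr; congr (_ + _).
  by apply: eq_bigr => t _; rewrite mulrA.
have wc_le0 t s : wt t s * c t xs <= 0.
  rewrite /wt; case bt : (b t); last by rewrite eqs ?bt // mulr0.
  by rewrite mulr_ge0_le0 // ineqs.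
have Fact (B : I) t : F B xs = 0 -> b t -> B t -> c t xs = 0.
  rewrite FE subrr add0r => /eqP; rewrite mulf_eq0 (gt_eqF kap0) /= => /eqP H bt Bt.
  have : forall s, true -> 0 <= - (wt s (B s) * c s xs) by move=> s _; rewrite oppr_ge0.
  move=> /psumr_eq0P; rewrite sumrN H oppr0 => /(_ erefl t isT) /eqP.
  by rewrite oppr_eq0 /wt bt Bt mul1r => /eqP.
have [|||||||L [[LN0 Lp] La stat so]] := @second_order_FJ R n I (fun=> true) F
   (fun B x => \sum_o a B o *: G' o x) (fun B => \sum_o a B o * q' o) (fun=> 1) xs d.
- by move=> B; exact: smooth2_sum.
- by move=> B.
- move=> B _; rewrite FE subrr add0r pmulr_rle0 //; exact: sumr_le0.
- move=> B _ FB0; rewrite dot_suml big_sumType /= sum_unit scale1r.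
  rewrite -[leRHS]addr0; apply: lerD => //; apply: sumr_le0 => t _.
  rewrite dotZl -mulrA pmulr_rle0 // /wt.
  case bt : (b t); last by rewrite eqd ?bt // mulr0.
  case Bt : (B t); last by rewrite mul0r.
  by rewrite mul1r ineqd //; exact: (Fact B).
- by [].
- by [].
- exists e => // x xe sg sg0; exists [ffun t => sel t (c t x)].
  rewrite res_eq0 -ltNge mulr1 FE.
  under eq_bigr do rewrite ffunE wt_sel.
  by have := He x xe; lra.
pose S := \sum_B L B.
have S0 : 0 < S.
  have [B LB] := LN0; rewrite /S (bigD1 B) //= ltr_pwDl ?sumr_ge0 //.
    by rewrite lt_neqAle eq_sym LB Lp.
  by move=> *; exact: Lp.
(* collect the coefficient of each constraint and normalise that of [f] *)
pose Lam t := kap * (\sum_B L B * wt t (B t)) / S.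
have LamE (V : lmodType R) (v0 : V) (v : T -> V) :
    S *: (v0 + \sum_t Lam t *: v t) =
    \sum_B L B *: \sum_o a B o *: (if o is inr t then v t else v0).
  under [RHS]eq_bigr do rewrite big_sumType /= sum_unit scale1r scalerDr.
  rewrite big_split /= -scaler_suml scalerDr; congr (_ + _).
  rewrite scaler_sumr.
  under [RHS]eq_bigr do rewrite scaler_sumr.
  rewrite exchange_big /=; apply: eq_bigr => t _.
  rewrite scalerA; under eq_bigr do rewrite scalerA.
  rewrite -scaler_suml; congr (_ *: _).
  rewrite /Lam mulrC divfK ?lt0r_neq0 // mulr_sumr; apply: eq_bigr => B _.
  by rewrite mulrCA.
exists Lam; split.
- move=> t bt; rewrite divr_ge0 ?(ltW S0) // mulr_ge0 ?(ltW kap0) //.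
  by apply: sumr_ge0 => B _; rewrite mulr_ge0 ?Lp // /wt bt.
- move=> t bt; apply: contra_neqP => ct0.
  rewrite /Lam big1 ?mulr0 ?mul0r // => B _.
  have [->|/La[FB0 _]] := eqVneq (L B) 0; first by rewrite mul0r.
  rewrite /wt bt; case Bt : (B t); last by rewrite mulr0.
  by case: ct0; exact: (Fact B).
- have := LamE _ (gf xs) (fun t => G t xs).
  rewrite (_ : \sum_(B : I) _ = 0); last first.
    by rewrite -[RHS]stat; apply: eq_bigr => B _; congr (_ *: _); apply: eq_bigr => -[[]|].
  by move=> /eqP; rewrite scaler_eq0 (gt_eqF S0) /= => /eqP.
- have := LamE R^o qf q.
  rewrite (_ : \sum_(B : I) _ = \sum_B L B * \sum_o a B o * q' o :> R); last first.
    by apply: eq_bigr => B _; congr (_ * _); apply: eq_bigr => -[[]|].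
  move=> E; rewrite -(pmulr_rge0 _ S0) -[leRHS]/(S *: (qf + \sum_t Lam t *: (q t : R^o)) : R^o).
  by rewrite E.
Qed.

End Multipliers.

(** * Bounded multipliers from Caratheodory's theorem and compactness *)

Section Caratheodory.
Context {R : realType} {V : lmodType R} {T : finType}.

Definition free_on (S : {set T}) (v : T -> V) : Prop :=
  forall a : T -> R, (forall t, t \notin S -> a t = 0) ->
    \sum_t a t *: v t = 0 -> forall t, a t = 0.

(** The coefficients on [Q] are unrestricted and those on [P] must stay
    nonnegative.  Subtract a multiple of a linear relation so that one coefficient
    outside [Q] vanishes; taking the index with the smallest quotient in absolute
    value keeps all signs, whatever the sign of the relation. *)
Lemma caratheodory (P : pred T) (Q : {set T}) (v : T -> V) (c0 : T -> R) :
  (forall t, P t -> t \notin Q) -> free_on Q v ->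
  (forall t, P t -> 0 <= c0 t) ->
  exists c : T -> R, [/\ forall t, P t -> 0 <= c t,
    forall t, t \notin Q -> c0 t = 0 -> c t = 0,
    \sum_t c t *: v t = \sum_t c0 t *: v t &
    free_on (Q :|: [set t | c t != 0])%SET v].
Proof.
move=> PQ fQ; have [k] := ubnP #|[set t | (t \notin Q) && (c0 t != 0)]%SET|.
elim: k c0 => // k IH c0 ck c0P.
have [fc|] := pselect (free_on (Q :|: [set t | c0 t != 0])%SET v).
  by exists c0; split.
move=> /existsNP[a /not_implyP[aS /not_implyP[a0 /existsNP[t1 /eqP at1]]]].
have [t2 /andP[t2Q at2]] : exists t, (t \notin Q) && (a t != 0).
  apply: contrapT => /forallNP H; move/eqP: at1; apply.
  apply: fQ a0 _ => t tQ; apply/eqP; rewrite -[_ == 0]negbK; apply/negP => at0.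
  by apply: (H t); rewrite tQ.
case: (@arg_minP _ R T t2 (fun t => (t \notin Q) && (a t != 0))
  (fun t => `|c0 t / a t|)) => [|t0 /andP[t0Q at0] tmin]; first by rewrite t2Q.
have ct0 : c0 t0 != 0.
  apply/eqP => c00; have := aS t0; rewrite !inE negb_or t0Q c00 eqxx /= => H.
  by rewrite H // eqxx in at0.
(* [a] is a linear relation and [t0] the index that its multiple cancels first *)
pose tau := c0 t0 / a t0.
pose c1 t := c0 t - tau * a t.
have c1t0 : c1 t0 = 0 by rewrite /c1 /tau divfK // subrr.
have a_supp t : t \notin Q -> c0 t = 0 -> a t = 0.
  by move=> tQ ct; apply: aS; rewrite !inE negb_or tQ ct eqxx.
have c1supp t : t \notin Q -> c0 t = 0 -> c1 t = 0.
  by move=> tQ ct; rewrite /c1 ct a_supp // mulr0 subr0.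
have [||c [cP cQ cE cF]] := IH c1.
- rewrite ltnS in ck; apply: leq_trans ck; apply: proper_card; apply/properP; split.
    apply/fintype.subsetP => t; rewrite !inE => /andP[tQ]; rewrite tQ /=.
    by apply: contra_neq; exact: c1supp.
  by exists t0; rewrite !inE t0Q ?ct0 // c1t0 eqxx.
- move=> t Pt; rewrite /c1 subr_ge0.
  have [at_0|atN0] := eqVneq (a t) 0; first by rewrite at_0 mulr0 c0P.
  apply: le_trans (ler_norm _) _; rewrite normrM.
  have := tmin t; rewrite PQ // atN0 => /(_ isT); rewrite -/tau => H.
  apply: le_trans (ler_wpM2r (normr_ge0 _) H) _.
  by rewrite -normrM divfK // ger0_norm // c0P.
exists c; split=> // [t tQ ct|]; first by apply: cQ => //; exact: c1supp.
rewrite cE /c1; under eq_bigr do rewrite scalerBl -scalerA.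
by rewrite sumrB -scaler_sumr a0 scaler0 subr0.
Qed.

End Caratheodory.

Section UniformBound.
Context {R : realType} {n : nat} {T : finType}.
Variables (v : T -> 'rV[R]_n -> 'rV[R]_n) (xs : 'rV[R]_n) (P : pred T).
Hypothesis cv : forall t, {for xs, continuous (v t)}.

(** By compactness: coefficients that violate every such bound at points tending to
    [xs] have, after normalisation, a limit of norm one that gives a vanishing
    combination at [xs]. *)
Lemma uniform_bound (S : {set T}) :
  (forall a : T -> R, (forall t, t \notin S -> a t = 0) ->
     (forall t, P t -> 0 <= a t) ->
     \sum_t a t *: v t xs = 0 -> forall t, a t = 0) ->
  exists M : R, 0 <= M /\ \forall z \near xs, forall a : T -> R,
     (forall t, t \notin S -> a t = 0) -> (forall t, P t -> 0 <= a t) ->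
     forall t, `|a t| <= M * `|\sum_t a t *: v t z|.
Proof.
move=> Hpos; apply: contrapT => /forallNP H.
have {}H k : exists za : 'rV[R]_n * (T -> R), [/\ `|za.1 - xs| < k.+1%:R^-1,
    (forall t, t \notin S -> za.2 t = 0), (forall t, P t -> 0 <= za.2 t) &
    exists t, k.+1%:R * `|\sum_t za.2 t *: v t za.1| < `|za.2 t|].
  apply: contrapT => /forallNP H1; apply: (H k.+1%:R); split=> //.
  apply/near_norm_lt; exists k.+1%:R^-1; first by rewrite invr_gt0.
  move=> z zk a aS aP t; rewrite leNgt; apply/negP => at_.
  by apply: (H1 (z, a)); split=> //; exists t.
have [za Hza] := choice H.
pose z k := (za k).1; pose a k := (za k).2.
pose N k := \sum_t `|a k t|.
have N0 k : 0 < N k.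
  have [_ _ _ [t at_]] := Hza k.
  rewrite /N (bigD1 t) //= ltr_pwDl ?sumr_ge0 //.
  by apply: le_lt_trans at_; rewrite mulr_ge0.
pose b k t := a k t / N k.
have [U [UU ooU]] := ultraFilterLemma (eventually_filter).
have bex t : exists l : R, b k t @[k --> U] --> l.
  apply: (@ultra_cvg_bounded _ _ _ _ 1); apply: nearW => k.
  rewrite normrM normfV (ger0_norm (ltW (N0 k))) ler_pdivrMr // mul1r.
  by rewrite /N (bigD1 t) //= lerDl sumr_ge0.
have [l Hl] := choice bex.
have invU : k.+1%:R^-1 @[k --> U] --> (0 : R).
  by apply: cvg_trans (@cvg_harmonic R); exact: cvg_app ooU.
have zU : z k @[k --> U] --> xs.
  apply/cvgrPdist_lt => e e0.
  have : \forall k \near U, k.+1%:R^-1 < e by apply: cvgr_lt invU _ _.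
  apply: filterS => k; apply: lt_trans.
  by rewrite distrC; have [] := Hza k.
have sum1 : \sum_t `|l t| = 1.
  have H1 : \sum_t `|b k t| @[k --> U] --> \sum_t `|l t|.
    by apply: cvg_sumr => t; exact: cvg_norm.
  have H2 : \sum_t `|b k t| @[k --> U] --> (1 : R).
    apply: cvg_trans (@cvg_cst _ (1 : R) _ U _).
    apply: near_eq_cvg; apply: nearW => k; rewrite /cst /=.
    under eq_bigr do rewrite normrM normfV (ger0_norm (ltW (N0 k))).
    by rewrite -mulr_suml -[X in X / _]/(N k) divff // lt0r_neq0.
  exact: (cvg_unique _ H1 H2).
have sum0 : \sum_t l t *: v t xs = 0.
  have H1 : \sum_t b k t *: v t (z k) @[k --> U] --> \sum_t l t *: v t xs.
    apply: cvg_sumr => t; apply: cvgZ => //.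
    exact: (cvg_comp _ _ zU (@cv t)).
  have H2 : \sum_t b k t *: v t (z k) @[k --> U] --> (0 : 'rV[R]_n).
    apply/cvgr0Pnorm_lt => e e0.
    have : \forall k \near U, k.+1%:R^-1 < e by apply: cvgr_lt invU _ _.
    apply: filterS => k; apply: lt_trans.
    have [_ _ _ [t at_]] := Hza k.
    have -> : \sum_t b k t *: v t (z k) = (N k)^-1 *: \sum_t a k t *: v t (z k).
      by rewrite scaler_sumr; apply: eq_bigr => s _; rewrite scalerA mulrC.
    rewrite normrZ normfV (ger0_norm (ltW (N0 k))) mulrC ltr_pdivrMr //.
    rewrite mulrC ltr_pdivlMr // mulrC; apply: lt_le_trans at_ _.
    by rewrite /N (bigD1 t) //= lerDl sumr_ge0.
  exact: (cvg_unique _ H1 H2).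
have l0 : forall t, l t = 0.
  apply: Hpos => // t.
    move=> tS; suff H2 : b k t @[k --> U] --> (0 : R) by exact: (cvg_unique _ (Hl t) H2).
    apply: cvg_trans (@cvg_cst _ (0 : R) _ U _).
    apply: near_eq_cvg; apply: nearW => k; rewrite /cst /= /b /a.
    by have [_ -> // _ _] := Hza k; rewrite mul0r.
  move=> Pt; apply: (cvgr_to_ge (Hl t)); apply: nearW => k.
  by rewrite divr_ge0 ?(ltW (N0 k)) // /a; have [_ _ + _] := Hza k; apply.
by move/eqP: sum1; rewrite big1 => [|t _]; rewrite ?l0 ?normr0 // eq_sym oner_eq0.
Qed.

End UniformBound.

Section BoundedMultipliers.
Context {R : realType} {n : nat} {T : finType}.
Variables (v : T -> 'rV[R]_n -> 'rV[R]_n) (xs : 'rV[R]_n).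
Hypothesis cv : forall t, {for xs, continuous (v t)}.

(** The preceding bound without sign conditions. *)
Lemma free_on_open (S : {set T}) :
  free_on S (v^~ xs) -> \forall z \near xs, free_on S (v^~ z).
Proof.
move=> fS; have [|M [M0 HM]] := uniform_bound cv (P := pred0) (S := S).
  by move=> a aS _; exact: fS.
apply: filterS HM => z Hz a aS a0 t.
by apply/eqP; rewrite -normr_le0; apply: le_trans (Hz a aS _ t) _ => //; rewrite a0 normr0 mulr0.
Qed.

(** There are finitely many supports [S].  Either a nonzero admissible combination
    over [S] vanishes at [xs], and then the vectors of [S] are dependent near [xs],
    or the coefficients over [S] are uniformly bounded.  Caratheodory's theorem
    produces an independent support, hence one of the second kind. *)
Lemma bounded_reduction (P : pred T) (Q S0 : {set T}) :
  (forall t, P t -> t \notin Q) -> (Q \subset S0)%SET ->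
  free_on Q (v^~ xs) ->
  (forall S : {set T}, (Q \subset S)%SET -> (S \subset S0)%SET ->
    (exists a : T -> R, [/\ forall t, t \notin S -> a t = 0,
      forall t, P t -> 0 <= a t, \sum_t a t *: v t xs = 0 & exists t, a t != 0]) ->
    \forall z \near xs, ~ free_on S (v^~ z)) ->
  exists M e : R, [/\ 0 <= M, 0 < e & forall z, `|z - xs| < e ->
    forall a : T -> R, (forall t, t \notin S0 -> a t = 0) ->
    (forall t, P t -> 0 <= a t) ->
    exists a' : T -> R, [/\ forall t, P t -> 0 <= a' t,
      forall t, t \notin Q -> a t = 0 -> a' t = 0,
      \sum_t a' t *: v t z = \sum_t a t *: v t z &
      forall t, `|a' t| <= M * `|\sum_t a t *: v t z|]].
Proof.
move=> PQ QS0 fQ HS.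
have : forall S : {set T}, exists M : R, 0 <= M /\ \forall z \near xs,
    (Q \subset S)%SET -> (S \subset S0)%SET -> free_on S (v^~ z) ->
    forall a : T -> R, (forall t, t \notin S -> a t = 0) ->
    (forall t, P t -> 0 <= a t) -> forall t, `|a t| <= M * `|\sum_t a t *: v t z|.
  move=> S; have [ex|nex] := pselect (exists a : T -> R, [/\ forall t, t \notin S -> a t = 0,
      forall t, P t -> 0 <= a t, \sum_t a t *: v t xs = 0 & exists t, a t != 0]).
    exists 0; split=> //.
    have [QS|nQS] := boolP (Q \subset S)%SET; last first.
      by apply/near_norm_lt; exists 1 => // z _ QS; rewrite QS in nQS.
    have [SS0|nSS0] := boolP (S \subset S0)%SET; last first.
      by apply/near_norm_lt; exists 1 => // z _ _ SS0; rewrite SS0 in nSS0.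
    by apply: filterS (HS S QS SS0 ex) => z Hn _ _ /Hn.
  have [|M [M0 HM]] := uniform_bound cv (P := P) (S := S).
    move=> a aS aP a0 t; apply/eqP; rewrite -[_ == 0]negbK; apply/negP => at0.
    by apply: nex; exists a; split=> //; exists t.
  exists M; split=> //; apply: filterS HM => z Hz _ _ _; exact: Hz.
move=> /choice[M HM].
have M0 S : 0 <= M S by have [] := HM S.
have : \forall z \near xs, forall S : {set T},
    (Q \subset S)%SET -> (S \subset S0)%SET -> free_on S (v^~ z) ->
    forall a : T -> R, (forall t, t \notin S -> a t = 0) ->
    (forall t, P t -> 0 <= a t) -> forall t, `|a t| <= M S * `|\sum_t a t *: v t z|.
  apply: (@filter_forall _ {set T} (fun (S : {set T}) z => (Q \subset S)%SET -> (S \subset S0)%SET -> free_on S (v^~ z) ->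
    forall a : T -> R, (forall t, t \notin S -> a t = 0) ->
    (forall t, P t -> 0 <= a t) -> forall t, `|a t| <= M S * `|\sum_t a t *: v t z|) (nbhs xs)).
  by move=> S; have [] := HM S.
move=> /(filterI (free_on_open fQ))/near_norm_lt[e e0 He].
exists (\sum_S M S), e; split=> //; first by rewrite sumr_ge0.
move=> z ze a aS aP; have [fz Hz] := He z ze.
have [a' [a'P a'Q a'E a'F]] := caratheodory PQ fz aP.
exists a'; split=> // t; rewrite -a'E.
pose S := (Q :|: [set t | a' t != 0])%SET.
apply: le_trans (Hz S _ _ a'F a' _ a'P t) _.
- exact: finset.subsetUl.
- apply/fintype.subsetP => s; rewrite !inE => /orP[|]; first exact: (fintype.subsetP QS0).
  apply: contraR => sS0; apply/eqP; apply: a'Q (aS _ sS0).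
  by apply: contra sS0; exact: (fintype.subsetP QS0).
- by move=> s; rewrite !inE negb_or negbK => /andP[_ /eqP].
- by rewrite ler_wpM2r // (bigD1 S) //= lerDl sumr_ge0.
Qed.

End BoundedMultipliers.

(** * Linear independence and spans of indexed families *)

Section FreeFamilies.
Context {R : realType} {V : vectType R}.

Lemma big_with (T : eqType) (v : T -> V) (a : T -> R) t k (s : seq T) :
  t \notin s ->
  \sum_(x <- s) (if x == t then k else a x) *: v x = \sum_(x <- s) a x *: v x.
Proof.
move=> ts; apply: eq_big_seq => x xs; case: eqP => // xt.
by rewrite -xt xs in ts.
Qed.

Lemma span_mapP (T : eqType) (v : T -> V) (s : seq T) u : uniq s ->
  reflect (exists a : T -> R, u = \sum_(t <- s) a t *: v t)
    (u \in <<[seq v t | t <- s]>>%VS).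
Proof.
move=> us; apply: (iffP idP) => [|[a ->]]; last first.
  rewrite big_seq; apply: memv_suml => t ts; apply: memvZ.
  by apply: memv_span; exact: map_f.
elim: s us u => [_ u|t s IH /= /andP[ts us] u].
  by rewrite span_nil memv0 => /eqP->; exists (fun=> 0); rewrite big_nil.
rewrite span_cons => /memv_addP[_ /vlineP[k ->]] [u' /(IH us)[a ->] ->].
exists (fun x => if x == t then k else a x).
by rewrite big_cons eqxx big_with.
Qed.

Lemma free_mapP (T : eqType) (v : T -> V) (s : seq T) : uniq s ->
  free [seq v t | t <- s] <->
  forall a : T -> R, \sum_(t <- s) a t *: v t = 0 -> forall t, t \in s -> a t = 0.
Proof.
elim: s => [_|t s IH /= /andP[ts us]]; first by split=> // _; exact: nil_free.
rewrite free_cons; split=> [/andP[vt /(IH us) fs] a|H].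
  rewrite big_cons => E.
  have at0 : a t = 0.
    apply: contraNeq vt => at0; apply/span_mapP => //.
    exists (fun x => - (a t)^-1 * a x).
    under eq_bigr do rewrite -scalerA.
    rewrite -scaler_sumr -[LHS]scale1r -(mulVf at0) -scalerA scaleNr -scalerN.
    by congr (_ *: _); apply/eqP; rewrite -addr_eq0 E.
  rewrite at0 scale0r add0r in E.
  by move=> x; rewrite inE => /predU1P[->//|]; exact: fs.
apply/andP; split.
  apply/negP => /(span_mapP _ _ us)[a E].
  have := H (fun x => if x == t then - 1 else a x).
  rewrite big_cons eqxx big_with // -E scaleN1r addNr => /(_ erefl t).
  by rewrite inE eqxx => /(_ isT)/eqP; rewrite oppr_eq0 oner_eq0.
apply/(IH us) => a E x xs.
have := H (fun x => if x == t then 0 else a x).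
rewrite big_cons eqxx big_with // E scale0r add0r => /(_ erefl x).
rewrite inE xs orbT => /(_ isT); case: eqP => // xt.
by rewrite -xt xs in ts.
Qed.

Lemma big_supp (T : finType) (v : T -> V) (a : T -> R) (s : seq T) : uniq s ->
  (forall t, t \notin s -> a t = 0) -> \sum_t a t *: v t = \sum_(t <- s) a t *: v t.
Proof.
move=> us as0; rewrite [RHS]big_uniq //= [LHS](bigID (mem s)) /=.
rewrite [X in _ + X]big1 ?addr0 //.
by move=> t /as0->; rewrite scale0r.
Qed.

Lemma free_map_on (T : finType) (v : T -> V) (s : seq T) : uniq s ->
  free [seq v t | t <- s] <-> free_on [set t in s]%SET v.
Proof.
move=> us; rewrite free_mapP //; split=> H a.
  move=> as0 E t; have {}as0 x : x \notin s -> a x = 0.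
    by move=> xs; apply: as0; rewrite inE.
  have [ts|/as0//] := boolP (t \in s).
  by apply: H ts; rewrite -big_supp.
move=> E t ts; have := H (fun x => if x \in s then a x else 0).
have H1 : \sum_t0 (if t0 \in s then a t0 else 0) *: v t0 = 0.
  rewrite (big_supp v us); last by move=> x /negPf->.
  by rewrite -[RHS]E; apply: eq_big_seq => x ->.
move=> /(_ _ H1 t); rewrite ts; apply=> x; rewrite inE => /negPf-> //.
Qed.

Lemma sum_nth_map (T : eqType) (v : T -> V) (a : T -> R) (s : seq T) :
  \sum_(i < size [seq v t | t <- s]) [seq a t | t <- s]`_i *: [seq v t | t <- s]`_i
  = \sum_(t <- s) a t *: v t.
Proof.
elim: s => [|t s IH]; first by rewrite big_nil /= big_ord0.
by rewrite /= big_ord_recl big_cons /= IH.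
Qed.

End FreeFamilies.

Section Families.
Context {R : realType} {n m p : nat}.
Variables (g : 'rV[R]_n -> 'rV[R]_m) (h : 'rV[R]_n -> 'rV[R]_p).
Implicit Types (I : {set 'I_m}) (J : {set 'I_p}) (K : {set 'I_n}).

Let T := ('I_m + 'I_p + 'I_n)%type.

(** The vectors of [fam], indexed by a sum type so that a combination over [g], [h]
    and the unit vectors is a single sum. *)
Definition fam_vec (z : 'rV[R]_n) (t : T) : 'rV[R]_n :=
  match t with
  | inl (inl i) => grad (coordf g i) z
  | inl (inr j) => grad (coordf h j) z
  | inr i => evec i
  end.

Definition fam_set I J K : {set T} :=
  [set t | match t with inl (inl i) => i \in I | inl (inr j) => j \in J
    | inr i => i \in K end]%SET.

Definition fam_seq I J K : seq T :=
  [seq inl (inl i) | i <- enum I] ++ [seq inl (inr j) | j <- enum J] ++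
  [seq inr i | i <- enum K].

Lemma fam_map z I J K : fam g h z I J K = [seq fam_vec z t | t <- fam_seq I J K].
Proof. by rewrite /fam_seq !map_cat -!map_comp. Qed.

Lemma fam_seq_uniq I J K : uniq (fam_seq I J K).
Proof.
rewrite !cat_uniq !map_inj_uniq ?enum_uniq ?andbT /=; try by move=> ? ? [].
apply/andP; split; apply/hasPn => t; rewrite ?mem_cat.
  by case/orP => /mapP[x _ ->]; apply/negP => /mapP[y _].
by case/mapP => x _ ->; apply/negP => /mapP[y _].
Qed.

Lemma mem_fam_seq I J K t : (t \in fam_seq I J K) = (t \in fam_set I J K).
Proof.
have f1 : injective (fun i : 'I_m => inl (inl i) : T) by move=> ? ? [].
have f2 : injective (fun i : 'I_p => inl (inr i) : T) by move=> ? ? [].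
have f3 : injective (fun i : 'I_n => inr i : T) by move=> ? ? [].
rewrite inE !mem_cat; case: t => [[i|j]|i].
- rewrite mem_map // mem_enum; case: (i \in I) => //=.
  by apply/negbTE; rewrite negb_or; apply/andP; split; apply/mapP => -[].
- rewrite orbCA mem_map // mem_enum; case: (j \in J) => //=.
  by apply/negbTE; rewrite negb_or; apply/andP; split; apply/mapP => -[].
- rewrite orbA orbC mem_map // mem_enum; case: (i \in K) => //=.
  by apply/negbTE; rewrite negb_or; apply/andP; split; apply/mapP => -[].
Qed.

Lemma free_fam z I J K :
  free (fam g h z I J K) <-> free_on (fam_set I J K) (fam_vec z).
Proof.
rewrite fam_map free_map_on ?fam_seq_uniq //.
suff -> : [set t in fam_seq I J K]%SET = fam_set I J K by [].
by apply/setP => t; rewrite inE mem_fam_seq.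
Qed.

Lemma fam_vec_continuous (xs : 'rV[R]_n) : C2_vec g -> C2_vec h ->
  forall t, {for xs, continuous (fam_vec^~ t)}.
Proof.
move=> hg hh [[i|j]|i].
- by apply: differentiable_continuous; have [_ + _] := hg i; apply.
- by apply: differentiable_continuous; have [_ + _] := hh j; apply.
- exact: cst_continuous.
Qed.

Definition sum_coef (lg : 'rV[R]_m) (lh : 'rV[R]_p) (eta : 'rV[R]_n)
   I J (t : T) : R :=
  match t with
  | inl (inl i) => if i \in I then lg ord0 i else 0
  | inl (inr j) => if j \in J then lh ord0 j else 0
  | inr i => eta ord0 i
  end.

Lemma grad_combE xs I J lg lh eta :
  grad_comb g h xs I J lg lh eta = \sum_t sum_coef lg lh eta I J t *: fam_vec xs t.
Proof.
rewrite !big_sumType /= /grad_comb; congr (_ + _ + _).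
- rewrite big_mkcond; apply: eq_bigr => i _; case: ifP => // _.
  by rewrite scale0r.
- rewrite big_mkcond; apply: eq_bigr => i _; case: ifP => // _.
  by rewrite scale0r.
- exact: row_sum_delta.
Qed.

End Families.

(** * A common consequence of the constraint qualifications *)

Section Qualification.
Context {R : realType} {n m p : nat}.
Variables (s : nat) (g : 'rV[R]_n -> 'rV[R]_m) (h : 'rV[R]_n -> 'rV[R]_p).
Hypothesis (hg : C2_vec g) (hh : C2_vec h).
Implicit Types (I : {set 'I_m}) (J : {set 'I_p}) (K : {set 'I_n}).
Variable xs : 'rV[R]_n.

(** A failure at points arbitrarily close to [xs] yields a sequence that avoids [xs],
    since the property holds at [xs] itself. *)
Lemma near_of_sequences (P : 'rV[R]_n -> Prop) :
  P xs -> for_large_k_along_sequences xs P -> \forall z \near xs, P z.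
Proof.
move=> Pxs HP; apply: contrapT => Hn.
have H k : exists z, `|z - xs| < k.+1%:R^-1 /\ ~ P z.
  apply: contrapT => /forallNP H; apply: Hn; apply/near_norm_lt.
  exists k.+1%:R^-1; first by rewrite invr_gt0.
  by move=> z zk; apply: contrapT => nPz; apply: (H z).
have [z Hz] := choice H.
have [||N HN] := HP z.
- apply/cvgrPdist_lt => e e0.
  have : \forall k \near \oo, k.+1%:R^-1 < e.
    by apply: cvgr_lt (@cvg_harmonic R) _ _.
  apply: filterS => k; apply: lt_trans.
  by rewrite distrC; have [] := Hz k.
- by move=> k; apply/eqP => zE; have [_] := Hz k; rewrite zE.
by have [_] := Hz N; apply; exact: HN.
Qed.

(** A nontrivial vanishing combination of the gradients at [xs] with the signs of a
    multiplier. *)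
Definition abnormal I J K :=
  exists (lg : 'rV[R]_m) (lh : 'rV[R]_p) (eta : 'rV[R]_n),
  [/\ [\/ exists2 i, i \in I & lg ord0 i != 0,
        exists2 j, j \in J & lh ord0 j != 0 | eta != 0],
    (forall i, i \in I -> 0 <= lg ord0 i),
    supp eta \subset K &
    grad_comb g h xs I J lg lh eta = 0].

(** What exact penalisation uses.  [K0] is the complement of the index set [I] to
    which the problem is restricted; [J] indexes gradients of [h] that span all
    the others not only at [xs] but nearby. *)
Definition qualification K0 := exists J, [/\ free (fam_h h xs J),
  \forall z \near xs, forall j, grad (coordf h j) z \in <<fam_h h z J>>%VS &
  forall I K, I \subset active g xs -> K \subset K0 -> abnormal I J K ->
    \forall z \near xs, ~~ free (fam g h z I J K)].

Lemma abnormal_not_free I J K : abnormal I J K -> ~~ free (fam g h xs I J K).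
Proof.
move=> [lg [lh [eta [nz _ sK E]]]]; apply/negP => /free_fam F.
have a0 : forall t, sum_coef lg lh eta I J t = 0.
  apply: F; last by rewrite -grad_combE.
  move=> [[i|j]|i]; rewrite inE /=; try by move=> /negPf->.
  by apply: contraNeq => ei; apply: (fintype.subsetP sK); rewrite inE.
case: nz => [[i iI]|[j jJ]|].
- by have := a0 (inl (inl i)); rewrite /= iI => ->; rewrite eqxx.
- by have := a0 (inl (inr j)); rewrite /= jJ => ->; rewrite eqxx.
- by move/eqP; apply; apply/rowP => i; have := a0 (inr i); rewrite /= mxE.
Qed.

Lemma not_free_sub z I J K :
  ~~ free (fam g h z I J finset.set0) -> ~~ free (fam g h z I J K).
Proof.
apply: contra; rewrite /fam.
have -> : fam_e (R := R) (n := n) finset.set0 = [::].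
  by rewrite /fam_e /image_mem enum_set0.
by rewrite cats0 catA; exact: catl_free.
Qed.

Lemma supp_eq0 (eta : 'rV[R]_n) : (supp eta == finset.set0) = (eta == 0).
Proof.
apply/eqP/eqP => [/setP H|->].
  apply/rowP => i; rewrite mxE; have := H i; rewrite !inE.
  by move/negbFE/eqP.
by apply/setP => i; rewrite !inE mxE eqxx.
Qed.

Lemma condE_sub eta K : K \subset zeros xs -> (#|K| <= n - s)%N ->
  supp eta \subset K -> condE s xs eta.
Proof.
move=> Kz Kn eK; split.
  move=> i; rewrite inE => xi; apply/eqP; rewrite -[_ == 0]negbK; apply/negP => ei.
  have : i \in zeros xs by apply: (fintype.subsetP Kz); apply: (fintype.subsetP eK); rewrite inE.
  by rewrite inE (negPf xi).
by apply: leq_trans Kn; exact: subset_leq_card.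
Qed.

Lemma condK_sub eta K : K \subset zeros xs -> (#|K| <= n - s)%N ->
  supp eta \subset K -> eta != 0 -> condK s xs eta K.
Proof. by move=> Kz Kn eK e0; split=> // ez; rewrite ez eqxx in e0. Qed.

Lemma condK0 : condK s xs (0 : 'rV[R]_n) finset.set0.
Proof. by split=> //; rewrite eqxx. Qed.

Lemma condE0 : condE s xs (0 : 'rV[R]_n).
Proof.
split=> [i _|]; first by rewrite mxE.
by rewrite /norm0 (eqP (_ : supp 0 == finset.set0)) ?cards0 // supp_eq0.
Qed.

(** When [eta = 0], the constant positive linear dependence condition speaks of the
    family without unit vectors; a larger family is dependent as well. *)
Lemma dependence_of_CPLD_for J K0 :
  K0 \subset zeros xs -> (#|K0| <= n - s)%N -> CPLD_for s g h xs J ->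
  forall I K, I \subset active g xs -> K \subset K0 -> abnormal I J K ->
    \forall z \near xs, ~~ free (fam g h z I J K).
Proof.
move=> Kz Kn H I K IA KK0 ab; have [lg [lh [eta [nz lg0 eK E]]]] := ab.
have Kz' := fintype.subset_trans KK0 Kz.
have Kn' := leq_trans (subset_leq_card KK0) Kn.
apply: near_of_sequences; first exact: abnormal_not_free.
have [e0|eN0] := eqVneq eta 0; last first.
  by apply: (H I lg lh eta) => //; [exact: condE_sub eK|exact: condK_sub].
rewrite e0 in nz E; have := H I lg lh 0 IA nz lg0 condE0 E _ condK0.
move=> Hs x xx xn; have [N HN] := Hs x xx xn; exists N => k Nk.
by apply: not_free_sub; exact: HN.
Qed.

Lemma pos_lin_dep_abnormal I J K : abnormal I J K ->
  pos_lin_dep (fam_g g xs I) (fam_h h xs J ++ fam_e K).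
Proof.
move=> [lg [lh [eta [nz lg0 eK E]]]].
pose U := ('I_p + 'I_n)%type.
pose v (t : U) : 'rV[R]_n := match t with inl j => grad (coordf h j) xs | inr i => evec i end.
pose a (t : U) : R := match t with inl j => lh ord0 j | inr i => eta ord0 i end.
pose L : seq U := [seq inl j | j <- enum J] ++ [seq inr i | i <- enum K].
have LE : fam_h h xs J ++ fam_e K = [seq v t | t <- L].
  by rewrite map_cat -!map_comp.
rewrite LE.
exists (fun i => [seq lg ord0 i | i <- enum I]`_i).
exists (fun i => [seq a t | t <- L]`_i); split.
- move=> i; have iI : (i < size [seq lg ord0 i | i <- enum I])%N.
    by rewrite size_map -(size_map (fun i => grad (coordf g i) xs)).
  by have /mapP[j + ->] := mem_nth 0 iI; rewrite mem_enum; exact: lg0.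
- case: nz => [[i iI li]|[j jJ lj]|eN0].
  + left; have /(nthP 0)[k] : lg ord0 i \in [seq lg ord0 i | i <- enum I].
      by apply: map_f; rewrite mem_enum.
    rewrite size_map -(size_map (fun i => grad (coordf g i) xs)) => kI kE.
    by exists (Ordinal kI); rewrite /= kE.
  + right; have /(nthP 0)[k] : a (inl j) \in [seq a t | t <- L].
      by apply: map_f; rewrite mem_cat map_f // mem_enum.
    by rewrite (size_map a) -(size_map v) => kI kE; exists (Ordinal kI); rewrite /= kE.
  + right; have [i ei] : exists i, eta ord0 i != 0.
      move: eN0; rewrite -supp_eq0 => /set0Pn[i]; rewrite inE; by exists i.
    have /(nthP 0)[k] : a (inr i) \in [seq a t | t <- L].
      apply: map_f; rewrite mem_cat orbC map_f // mem_enum.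
      by apply: (fintype.subsetP eK); rewrite inE.
    by rewrite (size_map a) -(size_map v) => kI kE; exists (Ordinal kI); rewrite /= kE.
- rewrite !sum_nth_map -[RHS]E /grad_comb big_cat /= !big_map -addrA.
  rewrite !big_enum /=; congr (_ + (_ + _)).
  rewrite [RHS](row_sum_delta eta) big_mkcond; apply: eq_bigr => i _ /=.
  case: ifPn => // iK; suff -> : eta ord0 i = 0 by rewrite scale0r.
  by apply: contraNeq iK => ei; apply: (fintype.subsetP eK); rewrite inE.
Qed.

Lemma fam_hP z J u :
  reflect (exists2 j, j \in J & u = grad (coordf h j) z) (u \in fam_h h z J).
Proof.
apply: (iffP mapP) => -[j jJ ->]; exists j => //; first by rewrite -mem_enum.
by rewrite mem_enum.
Qed.

Lemma mem_fam_h z J j : j \in J -> grad (coordf h j) z \in fam_h h z J.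
Proof. by move=> jJ; apply/fam_hP; exists j. Qed.

(** A free subfamily of largest cardinality spans. *)
Lemma h_basis_exists : exists J, h_basis h xs J.
Proof.
have f0 : free (fam_h h xs finset.set0).
  by rewrite /fam_h /image_mem enum_set0 nil_free.
case: (arg_maxnP (P := fun J => free (fam_h h xs J)) (fun J => #|J|) f0) => J fJ Jmax.
exists J; rewrite /h_basis /basis_of fJ andbT eqEsubv; apply/andP; split.
  by apply: sub_span => u /fam_hP[j _ ->]; apply: mem_fam_h.
apply/span_subvP => u /fam_hP[j _ ->].
have [jJ|jJ] := boolP (j \in J); first by apply: memv_span; exact: mem_fam_h.
apply: contraT => jN.
have : free (fam_h h xs (j |: J)).
  rewrite (@perm_free _ _ _ (grad (coordf h j) xs :: fam_h h xs J)).
    by rewrite free_cons jN.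
  apply: (@perm_map _ _ _ (enum (j |: J)) (j :: enum J)).
  apply: uniq_perm; rewrite /= ?enum_uniq ?mem_enum ?jJ //.
  by move=> x; rewrite mem_enum !inE mem_enum.
by move=> /Jmax /=; rewrite cardsU1 jJ add1n ltnn.
Qed.

Lemma free_fam_h_near J : free (fam_h h xs J) ->
  \forall z \near xs, free (fam_h h z J).
Proof.
have E z : free (fam_h h z J) <-> free_on [set j in enum J]%SET (fun j => grad (coordf h j) z).
  exact: (free_map_on _ (enum_uniq _)).
move=> /E /(free_on_open (v := fun j z => grad (coordf h j) z)) H.
have {}H := H (fun j => @fam_vec_continuous _ _ _ _ g h xs hg hh (inl (inr j))).
by apply: filterS H => z; exact: (E z).2.
Qed.

(** Near [xs] the basis stays independent, so its span has the dimension of the full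
    span. *)
Lemma span_of_constant_rank J : h_basis h xs J ->
  (\forall z \near xs, rank (fam_h h z finset.setT) = rank (fam_h h xs finset.setT)) ->
  \forall z \near xs, forall j, grad (coordf h j) z \in <<fam_h h z J>>%VS.
Proof.
move=> /andP[/eqP spJ fJ] rk; have fz := free_fam_h_near fJ.
apply: filterS2 rk fz => z rk fz j.
have -> : <<fam_h h z J>>%VS = <<fam_h h z finset.setT>>%VS.
  apply/eqP; rewrite eqEdim; apply/andP; split.
    by apply: sub_span => u /fam_hP[i _ ->]; apply: mem_fam_h.
  rewrite -/(rank (fam_h h z finset.setT)) rk /rank -spJ.
  by rewrite (eqnP fz) (eqnP fJ) !size_map.
by apply: memv_span; apply: mem_fam_h.
Qed.

Lemma qualification_of_h_basis K0 (hbas : forall J, h_basis h xs J ->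
    (\forall z \near xs, forall j, grad (coordf h j) z \in <<fam_h h z J>>%VS) /\
    forall I K, I \subset active g xs -> K \subset K0 -> abnormal I J K ->
    \forall z \near xs, ~~ free (fam g h z I J K)) : qualification K0.
Proof.
have [J hJ] := h_basis_exists; exists J.
by have [h1 h2] := hbas J hJ; split=> //; have /andP[] := hJ.
Qed.

Lemma near_constant_rank : h_constant_rank h xs ->
  \forall z \near xs, rank (fam_h h z finset.setT) = rank (fam_h h xs finset.setT).
Proof.
move=> [e e0 He]; apply/nbhs_ballP; exists e => //= z ze.
by apply: He => //; exact: ballxx.
Qed.

Section Cases.
Variable K0 : {set 'I_n}.
Hypotheses (K0z : K0 \subset zeros xs) (K0n : (#|K0| <= n - s)%N).

Lemma RCPLD_qualification : RCPLD s g h xs -> qualification K0.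
Proof.
move=> [cr H]; apply: qualification_of_h_basis => J hJ; split.
  exact: span_of_constant_rank (near_constant_rank cr).
by apply: dependence_of_CPLD_for => //; exact: H.
Qed.

(** In place of a constant rank, the larger families [j |: J] are used: each
    gradient outside the basis depends on it at [xs], and the qualification for
    [j |: J] carries this dependence to nearby points. *)
Lemma CPLD_qualification : CPLD s g h xs -> qualification K0.
Proof.
move=> H; apply: qualification_of_h_basis => J hJ; split; last first.
  by apply: dependence_of_CPLD_for => //; exact: H.
have /andP[/eqP spJ fJ] := hJ.
apply: (@filter_forall _ _ (fun j z => grad (coordf h j) z \in <<fam_h h z J>>%VS) (nbhs xs)) => j.
have [jJ|jJ] := boolP (j \in J).
  by apply/near_norm_lt; exists 1 => // z _; apply: memv_span; exact: mem_fam_h.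
have cons_perm z : free (fam_h h z (j |: J)) =
    free (grad (coordf h j) z :: fam_h h z J).
  apply: perm_free.
  apply: (@perm_map _ _ _ (enum (j |: J)) (j :: enum J)).
  apply: uniq_perm; rewrite /= ?enum_uniq ?mem_enum ?jJ //.
  by move=> x; rewrite mem_enum !inE mem_enum.
have fam0 z : fam g h z finset.set0 (j |: J) finset.set0 = fam_h h z (j |: J).
  by rewrite /fam /fam_g /fam_e /image_mem !enum_set0 cats0.
have ab : abnormal finset.set0 (j |: J) finset.set0.
  have : grad (coordf h j) xs \in <<fam_h h xs J>>%VS.
    by rewrite spJ; apply: memv_span; exact: mem_fam_h.
  move=> /(span_mapP _ _ (enum_uniq _))[a aE].
  exists 0, (\row_i (if i == j then - 1 else a i)), 0; split.
  - by apply: Or32; exists j; rewrite ?mxE ?eqxx ?oppr_eq0 ?oner_eq0 // !inE eqxx.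
  - by move=> i; rewrite inE.
  - by apply/fintype.subsetP => i; rewrite inE mxE eqxx.
  - rewrite /grad_comb big_set0 add0r addr0 big_setU1 //= mxE eqxx aE.
    rewrite -big_enum /= scaleN1r addrC; apply/eqP; rewrite subr_eq0; apply/eqP.
    apply: eq_big_seq => i; rewrite mem_enum mxE => iJ.
    by case: eqP => // ij; rewrite -ij iJ in jJ.
have N := dependence_of_CPLD_for K0z K0n (H (j |: J)) (finset.sub0set _)
  (finset.sub0set _) ab.
apply: filterS2 N (free_fam_h_near fJ) => z.
by rewrite fam0 cons_perm free_cons => /nandP[/negbNE//|/negP].
Qed.

Lemma ERCPLD_qualification : ERCPLD s g h xs -> qualification K0.
Proof.
move=> [cr H]; apply: qualification_of_h_basis => J hJ; split.
  exact: span_of_constant_rank (near_constant_rank cr).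
move=> I K IA KK0 ab; have [lg [lh [eta [nz lg0 eK E]]]] := ab.
have Kz' := fintype.subset_trans KK0 K0z.
have Kn' := leq_trans (subset_leq_card KK0) K0n.
apply: near_of_sequences; first exact: abnormal_not_free.
have [e0|eN0] := eqVneq eta 0; last first.
  by apply: (H J hJ I eta K) => //; [exact: condE_sub eK|exact: condK_sub|exact: pos_lin_dep_abnormal].
have ab0 : abnormal I J finset.set0.
  exists lg, lh, eta; split=> //.
  by move/eqP: e0; rewrite -supp_eq0 => /eqP->.
have Hs := H J hJ I 0 finset.set0 IA condE0 condK0 (pos_lin_dep_abnormal ab0).
move=> x xx xn; have [N HN] := Hs x xx xn; exists N => k Nk.
by apply: not_free_sub; exact: HN.
Qed.

(** The family over all of [h] has the span of the one over [J] at [xs] and contains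
    the latter nearby; with constant rank, a family that is too large to be
    independent at [xs] remains so.  A nonempty [K] is admissible through the
    vector [eta] with entries one on [K]. *)
Lemma RCRCQ_qualification : RCRCQ s g h xs -> qualification K0.
Proof.
move=> H.
have rkn I K : I \subset active g xs -> K \subset K0 ->
  \forall z \near xs, rank (fam g h z I finset.setT K) = rank (fam g h xs I finset.setT K).
  move=> IA KK0; apply: near_of_sequences => //.
  have Kz' := fintype.subset_trans KK0 K0z.
  have Kn' := leq_trans (subset_leq_card KK0) K0n.
  have [->|KN0] := eqVneq K finset.set0.
    by apply: (H I 0 finset.set0) => //; [exact: condE0|exact: condK0].
  pose eta : 'rV[R]_n := \row_i (i \in K)%:R.
  have eK : supp eta = K.
    by apply/setP => i; rewrite inE mxE pnatr_eq0 eqb0 negbK.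
  have eN0 : eta != 0 by rewrite -supp_eq0 eK.
  by apply: (H I eta K) => //; [apply: (condE_sub Kz' Kn')|apply: condK_sub => //]; rewrite eK.
apply: qualification_of_h_basis => J hJ; split.
  apply: span_of_constant_rank => //.
  have := rkn finset.set0 finset.set0 (finset.sub0set _) (finset.sub0set _).
  rewrite /fam /fam_g /fam_e /image_mem !enum_set0 /=.
  by apply: filterS => z; rewrite !cats0.
move=> I K IA KK0 ab; have nf := abnormal_not_free ab.
apply: filterS (rkn I K IA KK0) => z rk; move: nf; apply: contra.
have /andP[/eqP spJ _] := hJ.
rewrite /free => /eqP fz.
rewrite eqn_leq dim_span /=.
have -> : size (fam g h xs I J K) = size (fam g h z I J K).
  by rewrite /fam !size_cat !size_map.
rewrite -fz.
have sp1 : (<<fam g h z I J K>> <= <<fam g h z I finset.setT K>>)%VS.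
  apply: sub_span => u; rewrite /fam !mem_cat => /or3P[->//|/fam_hP[j _ ->]|->]; rewrite ?orbT //.
  by rewrite mem_fam_h ?orbT.
apply: leq_trans (dimvS sp1) _; rewrite -/(rank _) rk /rank.
apply: dimvS; rewrite /fam !span_cat; apply: addvS => //; apply: addvS => //.
by rewrite spJ.
Qed.

(** Abnormal combinations do not exist, in particular the gradients of [h] are
    independent. *)
Lemma NNAMCQ_qualification : NNAMCQ s g h xs -> qualification K0.
Proof.
move=> H.
have nab I J K : I \subset active g xs -> K \subset K0 -> ~ abnormal I J K.
  move=> IA KK0 [lg [lh [eta [nz lg0 eK E]]]]; apply: H.
  exists (\row_i (if i \in I then lg ord0 i else 0)).
  exists (\row_j (if j \in J then lh ord0 j else 0)), eta.
  have Kz' := fintype.subset_trans KK0 K0z.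
  have Kn' := leq_trans (subset_leq_card KK0) K0n.
  split.
  - case: nz => [[i iI li]|[j jJ lj]|eN0]; last exact: Or33.
    + apply: Or31; apply: contra_neq li => /rowP/(_ i); rewrite !mxE iI; exact.
    + apply: Or32; apply: contra_neq lj => /rowP/(_ j); rewrite !mxE jJ; exact.
  - split=> i iA; rewrite mxE; case: ifP => // iI; first exact: lg0.
    by rewrite (fintype.subsetP IA) in iA.
  - exact: condE_sub eK.
  - rewrite -[RHS]E /grad_comb; congr (_ + _ + _).
      rewrite [RHS]big_mkcond [LHS]big_mkcond; apply: eq_bigr => i _ /=; rewrite mxE.
      case: ifP => iA; case: ifP => iI; rewrite ?scale0r //.
      by rewrite (fintype.subsetP IA) in iA.
    rewrite [RHS]big_mkcond [LHS]big_mkcond; apply: eq_bigr => i _ /=; rewrite mxE inE.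
    by case: ifP => iI; rewrite ?scale0r.
exists finset.setT; split.
- apply/(free_mapP _ (enum_uniq _)) => a aE j _.
  apply/eqP; rewrite -[_ == 0]negbK; apply/negP => aj.
  apply: (nab finset.set0 finset.setT finset.set0).
  + by apply/fintype.subsetP => i; rewrite inE.
  + by apply/fintype.subsetP => i; rewrite inE.
  exists 0, (\row_j a j), 0; split.
  + by apply: Or32; exists j; rewrite ?mxE // inE.
  + by move=> i; rewrite inE.
  + by apply/fintype.subsetP => i; rewrite inE mxE eqxx.
  + rewrite /grad_comb big_set0 add0r addr0 -[RHS]aE big_enum /=.
    by apply: eq_bigr => i _; rewrite mxE.
- by apply/near_norm_lt; exists 1 => // z _ j; apply: memv_span; apply: mem_fam_h.
- by move=> I K IA KK0 /(nab _ _ _ IA KK0).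
Qed.

End Cases.

Lemma LICQ_NNAMCQ : LICQ g h xs -> NNAMCQ s g h xs.
Proof.
move=> /free_fam F [lg [lh [eta [nz [lg0 lgA] [eV _] E]]]].
have a0 t : sum_coef lg lh eta (active g xs) finset.setT t = 0.
  apply: F; last by rewrite -grad_combE.
  move=> [[i|j]|i]; rewrite inE /=; first by move=> /negPf->.
    by rewrite inE.
  by rewrite inE => xi; apply: eV; rewrite inE.
case: nz => /eqP; apply; apply/rowP => i; rewrite mxE.
- have := a0 (inl (inl i)); rewrite /=; case: ifP => // iA _.
  by apply: lgA; rewrite iA.
- by have := a0 (inl (inr i)); rewrite /= inE.
- exact: (a0 (inr i)).
Qed.

End Qualification.

(** * Necessary optimality conditions *)

Section Necessary.
Context {R : realType} {n m p : nat}.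
Variables (s : nat) (f : 'rV[R]_n -> R).
Variables (g : 'rV[R]_n -> 'rV[R]_m) (h : 'rV[R]_n -> 'rV[R]_p).
Hypotheses (hf : C2 f) (hg : C2_vec g) (hh : C2_vec h).
Variables (xs d : 'rV[R]_n).

Lemma coord_spaceP (I : {set 'I_n}) (x : 'rV[R]_n) :
  x \in coord_space I <-> supp x \subset I.
Proof.
rewrite /coord_space; split.
  move=> /(span_mapP _ _ (enum_uniq _))[a ->]; apply/fintype.subsetP => i.
  rewrite inE; apply: contraR => iI; rewrite summxE big_seq big1 // => j.
  rewrite mem_enum => jI; rewrite /evec !mxE eqxx /=; case: eqP => [ij|_]; last by rewrite mulr0.
  by rewrite ij jI in iI.
move=> /fintype.subsetP xI; rewrite (row_sum_delta x); apply: memv_suml => i _.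
have [->|xi] := eqVneq (x ord0 i) 0; first by rewrite scale0r mem0v.
by apply: memvZ; apply: memv_span; apply: map_f; rewrite mem_enum xI ?inE.
Qed.

Variable I : {set 'I_n}.
Hypotheses (xsI : supp xs \subset I) (Is : #|I| = s) (dI : supp d \subset I).
Hypothesis feas : feasible s g h xs.
Hypothesis dg : forall i, i \in active g xs -> dot (grad (coordf g i) xs) d <= 0.
Hypothesis dh : forall i, dot (grad (coordf h i) xs) d = 0.
Hypothesis df : dot (grad f xs) d <= 0.
Hypothesis locmin : exists2 e : R, 0 < e &
    forall x, `|x - xs| < e -> feasible s g h x -> f xs <= f x.

Let K0 : {set 'I_n} := (~: I)%SET.
Let T := ('I_m + 'I_p + 'I_n)%type.

(** The constraints of the problem restricted to [I].  An index [i] of [I] carries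
    no constraint; it is given the constant [- 1] as an inequality that is never
    active, so that its multiplier is zero. *)
Let bT (t : T) : bool :=
  match t with inl (inl _) => true | inl (inr _) => false | inr i => i \notin K0 end.
Let cT (t : T) : 'rV[R]_n -> R :=
  match t with inl (inl i) => coordf g i | inl (inr j) => coordf h j
  | inr i => if i \in K0 then dot (evec i) else cst (- 1) end.
Let GT (t : T) : 'rV[R]_n -> 'rV[R]_n :=
  match t with inl (inl i) => grad (coordf g i) | inl (inr j) => grad (coordf h j)
  | inr i => if i \in K0 then cst (evec i) else cst 0 end.
Let qT (t : T) : R :=
  match t with inl (inl i) => quadform (hessian (coordf g i) xs) d
  | inl (inr j) => quadform (hessian (coordf h j) xs) d | inr i => 0 end.

Let smT t : smooth2_at (cT t) (GT t) xs d (qT t).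
Proof.
case: t => [[i|j]|i]; rewrite /cT /GT /qT.
- exact: (smooth2_C2 xs d (hg i)).
- exact: (smooth2_C2 xs d (hh j)).
- by case: ifP => _; [exact: smooth2_dot|exact: smooth2_cst].
Qed.

Let outI (x : 'rV[R]_n) i : supp x \subset I -> i \in K0 -> x ord0 i = 0.
Proof.
move=> xI; rewrite inE => iI; apply: contraNeq iI => xi.
by apply: (fintype.subsetP xI); rewrite inE.
Qed.

Let K0z : K0 \subset zeros xs.
Proof. by apply/fintype.subsetP => i iK; rewrite inE outI. Qed.

Let K0n : (#|K0| <= n - s)%N.
Proof. by rewrite cardsCs finset.setCK card_ord Is. Qed.

Let ineqsT t : bT t -> cT t xs <= 0.
Proof.
have [fg fh _] := feas.
case: t => [[i|j]|i] //=; first by move=> _; exact: fg.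
by move=> /negPf->; rewrite /cst oppr_le0.
Qed.

Let ineqdT t : bT t -> cT t xs = 0 -> dot (GT t xs) d <= 0.
Proof.
case: t => [[i|j]|i] //=.
  by move=> _ /eqP gi; apply: dg; rewrite inE.
by move=> /negPf->; rewrite /cst dot0l.
Qed.

Let eqsT t : ~~ bT t -> cT t xs = 0.
Proof.
have [_ fh _] := feas.
case: t => [[i|j]|i] //=; first by rewrite /coordf fh mxE.
by rewrite negbK => iK; rewrite iK dot_evec outI.
Qed.

Let eqdT t : ~~ bT t -> dot (GT t xs) d = 0.
Proof.
case: t => [[i|j]|i] //=.
by rewrite negbK => iK; rewrite iK /cst dot_evec outI.
Qed.

Let res_feasible x : (forall t, res (bT t) (cT t x) = 0) -> feasible s g h x.
Proof.
move=> H; split.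
- by move=> i; rewrite -[_ <= 0]res_eq0; apply/eqP; exact: (H (inl (inl i))).
- by apply/rowP => j; rewrite mxE; exact: (H (inl (inr j))).
- rewrite /norm0 -Is; apply: subset_leq_card; apply/fintype.subsetP => i.
  rewrite inE; apply: contraR => iI.
  have iK : i \in K0 by rewrite inE.
  by have := H (inr i); rewrite /= iK /= dot_evec => ->.
Qed.

Let locminT : exists2 e : R, 0 < e & forall x, `|x - xs| < e ->
  (forall t, res (bT t) (cT t x) = 0) -> f xs <= f x.
Proof.
have [e e0 He] := locmin; exists e => // x xe /res_feasible; exact: He.
Qed.

Let feasT t : res (bT t) (cT t xs) = 0.
Proof.
move: (ineqsT (t := t)) (eqsT (t := t)); case: (bT t) => [H _|_ /(_ isT)//].
by apply/eqP; rewrite res_eq0 H.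
Qed.

Let lgT (Lam : T -> R) : 'rV[R]_m := \row_i Lam (inl (inl i)).
Let lhT (Lam : T -> R) : 'rV[R]_p := \row_j Lam (inl (inr j)).
Let etaT (Lam : T -> R) : 'rV[R]_n := \row_i if i \in K0 then Lam (inr i) else 0.

Let sumT (A : {set 'I_m}) Lam : (forall i, i \notin A -> Lam (inl (inl i)) = 0) ->
  \sum_t Lam t *: GT t xs =
  grad_comb g h xs A finset.setT (lgT Lam) (lhT Lam) (etaT Lam).
Proof.
move=> LA; rewrite !big_sumType /= /grad_comb; congr (_ + _ + _).
- rewrite [RHS]big_mkcond; apply: eq_bigr => i _ /=; rewrite mxE.
  by case: ifPn => // /LA->; rewrite scale0r.
- rewrite [RHS]big_mkcond; apply: eq_bigr => j _ /=; by rewrite mxE inE.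
- rewrite [RHS]row_sum_delta; apply: eq_bigr => i _; rewrite mxE.
  by case: ifP => _; rewrite /cst // scaler0 scale0r.
Qed.

Let sumqT Lam : \sum_t Lam t * qT t =
  \sum_i lgT Lam ord0 i * quadform (hessian (coordf g i) xs) d +
  \sum_j lhT Lam ord0 j * quadform (hessian (coordf h j) xs) d.
Proof.
rewrite !big_sumType /= [X in _ + X]big1 ?addr0 => [|i _]; last by rewrite mulr0.
by congr (_ + _); apply: eq_bigr => i _; rewrite mxE.
Qed.

Let etaT_vanishes Lam : vanishes_on (supp xs :|: supp d)%SET (etaT Lam).
Proof.
move=> i iD; rewrite mxE inE; case: ifP => // /negP; case.
by move: iD; rewrite inE => /orP[]; apply: fintype.subsetP.
Qed.

Let etaT_norm0 Lam : (norm0 (etaT Lam) <= n - s)%N.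
Proof.
apply: leq_trans K0n; apply: subset_leq_card; apply/fintype.subsetP => i.
by rewrite inE mxE; case: ifP => // _; rewrite eqxx.
Qed.

Let conclusion := exists (lg : 'rV[R]_m) (lh : 'rV[R]_p) (eta : 'rV[R]_n),
       M_multiplier s f g h xs lg lh eta /\
       0 <= quadform (hess_lagrangian f g h xs lg lh) d.

Let M_multiplier_of Lam : (forall t, bT t -> 0 <= Lam t) ->
  (forall t, bT t -> Lam t != 0 -> cT t xs = 0) ->
  grad f xs + \sum_t Lam t *: GT t xs = 0 ->
  0 <= quadform (hessian f xs) d + \sum_t Lam t * qT t -> conclusion.
Proof.
move=> L0 La st so; exists (lgT Lam), (lhT Lam), (etaT Lam).
have LA i : i \notin active g xs -> Lam (inl (inl i)) = 0.
  move=> iA; apply/eqP; apply: contraNT iA => Li; rewrite inE; apply/eqP.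
  exact: (La (inl (inl i))).
split.
  split.
  - by split=> i iA; rewrite mxE; [exact: L0|exact: LA].
  - by rewrite -(sumT LA).
  - split; last exact: etaT_norm0.
    by move=> i ix; apply: etaT_vanishes; rewrite inE ix.
by rewrite (quadform_lagrangian xs _ _ d hf hg hh) -addrA -sumqT.
Qed.

(** An abnormal Fritz John multiplier is exactly what the qualification excludes. *)
Lemma necessary_SOSCMS : SOSCMS s g h xs d -> conclusion.
Proof.
move=> H.
have [l0 [Lam [l00 nz [Lp La] st so]]] := abnormal_or_normal_multipliers
  smT (smooth2_C2 xs d hf) ineqsT ineqdT eqsT eqdT df locminT.
have [l0z|l0N] := eqVneq l0 0; last first.
  have l0_gt0 : 0 < l0 by rewrite lt_neqAle eq_sym l0N.
  apply: (@M_multiplier_of (fun t => Lam t / l0)).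
  - by move=> t bt; rewrite divr_ge0 // Lp.
  - move=> t bt; rewrite mulf_eq0 negb_or => /andP[/La[]] //.
  - apply: (scalerI l0N); rewrite scaler0 -[RHS]st scalerDr scaler_sumr.
    congr (_ + _); apply: eq_bigr => t _.
    by rewrite scalerA mulrC divfK.
  - rewrite -(pmulr_rge0 _ l0_gt0) mulrDr mulr_sumr.
    rewrite (eq_bigr (fun t => Lam t * qT t)) // => t _.
    by rewrite mulrA mulrCA divff // mulr1.
rewrite l0z scale0r add0r in st; rewrite l0z mul0r add0r in so.
case: H; exists (lgT Lam), (lhT Lam), (etaT Lam).
have LA i : i \notin active_dir g xs d -> Lam (inl (inl i)) = 0.
  move=> iA; apply/eqP; apply: contraNT iA => /La[/= c0 d0].
  by rewrite !inE; apply/andP; split; apply/eqP.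
split.
- case: nz => [|[[[i|j]|i] Lt]]; first by rewrite l0z eqxx.
  + by apply: Or31; apply: contra_neq Lt => /rowP/(_ i); rewrite !mxE.
  + by apply: Or32; apply: contra_neq Lt => /rowP/(_ j); rewrite !mxE.
  + apply: Or33; have [c0 _] := La _ Lt; apply: contra_neq Lt => /rowP/(_ i).
    rewrite !mxE; move: c0 => /=; case: ifP => // _ /eqP.
    by rewrite /cst oppr_eq0 oner_eq0.
- by split=> i iA; rewrite mxE; [exact: Lp|exact: LA].
- by split; [exact: etaT_vanishes|exact: etaT_norm0].
- by rewrite -(sumT LA).
- by rewrite (quadform_lagrangian0 xs _ _ d hg hh) -sumqT.
Qed.

(** The gradients of [h] are first rewritten through those indexed by [J]; the
    reduction then applies with [J] as the part on which coefficients are free. *)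
Lemma qualification_bounded_multipliers :
  qualification g h xs K0 -> bounded_multipliers bT cT GT xs.
Proof.
move=> [J [fJ spJ HJ]].
pose v t z := fam_vec g h z t.
have cv t : {for xs, continuous (v t)} by exact: fam_vec_continuous.
pose S0 := fam_set (active g xs) J K0.
pose Q : {set T} := fam_set finset.set0 J finset.set0.
have PQ t : bT t -> t \notin Q by rewrite inE; case: t => [[i|j]|i] //=; rewrite finset.in_set0.
have QS0 : Q \subset S0.
  by apply/fintype.subsetP => -[[i|j]|i]; rewrite !inE.
have fQ : free_on Q (v^~ xs).
  apply/free_fam; rewrite /fam /fam_g /fam_e /image_mem !enum_set0 cats0.
  exact: fJ.
have HS (S : {set T}) : Q \subset S -> S \subset S0 ->
    (exists a : T -> R, [/\ forall t, t \notin S -> a t = 0,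
      forall t, bT t -> 0 <= a t, \sum_t a t *: v t xs = 0 & exists t, a t != 0]) ->
    \forall z \near xs, ~ free_on S (v^~ z).
  move=> QS SS0 [a [aS ap a0 aN0]].
  pose IS := [set i | inl (inl i) \in S]%SET.
  pose KS := [set i | inr i \in S]%SET.
  have SE : S = fam_set IS J KS.
    apply/setP => -[[i|j]|i]; rewrite !inE //.
    apply/idP/idP => [/(fintype.subsetP SS0)|jJ]; first by rewrite inE.
    by apply: (fintype.subsetP QS); rewrite inE.
  have ISA : IS \subset active g xs.
    by apply/fintype.subsetP => i; rewrite inE => /(fintype.subsetP SS0); rewrite inE.
  have KSK : KS \subset K0.
    by apply/fintype.subsetP => i; rewrite inE => /(fintype.subsetP SS0); rewrite inE.
  have ab : abnormal g h xs IS J KS.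
    exists (\row_i a (inl (inl i))), (\row_j a (inl (inr j))), (\row_i a (inr i)).
    split.
    - have [[[i|j]|i] at0] := aN0.
      + apply: Or31; exists i; rewrite ?mxE // inE.
        by apply: contraNT at0 => /aS->.
      + apply: Or32; exists j; rewrite ?mxE //.
        by apply: contraNT at0 => jJ; rewrite aS // SE inE.
      + by apply: Or33; apply: contra_neq at0 => /rowP/(_ i); rewrite !mxE.
    - by move=> i _; rewrite mxE; exact: ap.
    - apply/fintype.subsetP => i; rewrite !inE mxE.
      by apply: contraR => /aS->.
    - rewrite grad_combE -[RHS]a0; apply: eq_bigr => t _; congr (_ *: _).
      case: t => [[i|j]|i] /=; rewrite !mxE //; case: ifPn => // tS; rewrite aS //.
        by move: tS; rewrite inE.
      by rewrite SE inE.
  apply: filterS (HJ IS KS ISA KSK ab) => z /negP nf.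
  by rewrite SE => /free_fam.
have [M [e [M0 e0 He]]] := bounded_reduction cv PQ QS0 fQ HS.
have /near_norm_lt[e' e'0 He'] := spJ.
exists M, (Num.min e e'); split=> //; first by rewrite lt_min e0.
move=> z; rewrite lt_min => /andP[ze /He' sp] Lam Lp La.
have /choice[al Hal] : forall j, exists a : 'I_p -> R,
    grad (coordf h j) z = \sum_(l in J) a l *: grad (coordf h l) z.
  move=> j; have /(span_mapP _ _ (enum_uniq _))[a aE] := sp j.
  by exists a; rewrite aE big_enum.
pose a (t : T) : R := match t with
  | inl (inl i) => Lam t
  | inl (inr l) => if l \in J then \sum_j Lam (inl (inr j)) * al j l else 0
  | inr i => if i \in K0 then Lam t else 0 end.
have aE : \sum_t a t *: v t z = \sum_t Lam t *: GT t z.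
  rewrite !big_sumType /=; congr (_ + _ + _).
    under [RHS]eq_bigr => j _ do rewrite Hal scaler_sumr big_mkcond /=.
    rewrite exchange_big /=; apply: eq_bigr => l _.
    case: ifP => lJ; last by rewrite scale0r big1.
    by rewrite scaler_suml; apply: eq_bigr => j _; rewrite scalerA.
  by apply: eq_bigr => i _; case: ifP; rewrite /cst // scaler0 scale0r.
have aS t : t \notin S0 -> a t = 0.
  rewrite inE; case: t => [[i|j]|i] /=; try by move=> /negPf->.
  move=> iA; apply/eqP; apply: contraNT iA => Li; rewrite inE; apply/eqP.
  exact: (La (inl (inl i))).
have ap t : bT t -> 0 <= a t.
  by case: t => [[i|j]|i] //= bt; [exact: Lp|case: ifP => // iK; rewrite iK in bt].
have [a' [a'p a'Q a'E a'B]] := He z ze a aS ap.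
exists a'; split=> //.
- move=> t bt Lt; apply: a'Q; first exact: PQ.
  by move: Lt bt; case: t => [[i|j]|i] //= ->; case: ifP.
- rewrite -aE -a'E; apply: eq_bigr => -[[i|j]|i] _ //=; case: ifP => // iK.
  have -> : a' (inr i) = 0.
    by apply: a'Q; [rewrite inE finset.in_set0|rewrite /a iK].
  by rewrite !scale0r.
- by rewrite -aE.
Qed.

Lemma necessary_qualification : qualification g h xs K0 -> conclusion.
Proof.
move=> /qualification_bounded_multipliers bm.
have hc t : C11_at (cT t) (GT t) xs by have [] := smT t.
have hf1 : C11_at f (grad f) xs by have [] := smooth2_C2 xs d hf.
have [kap [e [kap0 e0 He]]] := exact_penalty hc hf1 feasT locminT bm.
have [Lam [L0 La st so]] := multipliers_of_exact_penalty
  smT (smooth2_C2 xs d hf) ineqsT ineqdT eqsT eqdT df kap0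
  (ex_intro2 _ _ e e0 He).
exact: M_multiplier_of st so.
Qed.

Lemma second_order_necessary : SOSCMS s g h xs d \/
       (LICQ g h xs \/ NNAMCQ s g h xs \/ CRCQ s g h xs \/ RCRCQ s g h xs \/
        CPLD s g h xs \/ ERCPLD s g h xs \/ RCPLD s g h xs) -> conclusion.
Proof.
case=> [|cq]; first exact: necessary_SOSCMS.
apply: necessary_qualification.
move: cq => [/(LICQ_NNAMCQ (s := s))|[|[/(_ finset.setT)|[|[|[|]]]]]].
- exact: NNAMCQ_qualification.
- exact: NNAMCQ_qualification.
- exact: RCRCQ_qualification.
- exact: RCRCQ_qualification.
- exact: CPLD_qualification.
- exact: ERCPLD_qualification.
- exact: RCPLD_qualification.
Qed.

End Necessary.

(** * Sufficient optimality conditions *)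

Section Sufficient.
Context {R : realType} {n m p : nat}.
Variables (s : nat) (f : 'rV[R]_n -> R).
Variables (g : 'rV[R]_n -> 'rV[R]_m) (h : 'rV[R]_n -> 'rV[R]_p).
Hypotheses (hf : C2 f) (hg : C2_vec g) (hh : C2_vec h) (hs : (s < n)%N).
Variable xs : 'rV[R]_n.
Hypothesis feas : feasible s g h xs.
Hypothesis sosc : forall d : 'rV[R]_n, d != 0 -> critical_cone s f g h xs d ->
  exists (lg : 'rV[R]_m) (lh : 'rV[R]_p) (eta : 'rV[R]_n),
    S_multiplier s f g h xs d lg lh eta /\
    0 < quadform (hess_lagrangian f g h xs lg lh) d.

Lemma superset_card (T : finType) (A : {set T}) k :
  (#|A| <= k)%N -> (k <= #|T|)%N -> exists B : {set T}, A \subset B /\ #|B| = k.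
Proof.
elim: k => [|k IH]; first by rewrite leqn0 => /eqP A0 _; exists A.
rewrite leq_eqVlt => /orP[/eqP Ak _|]; first by exists A.
rewrite ltnS => /IH H kT; have [B [AB Bk]] := H (ltnW kT).
have /fintype.subsetPn[x _ xB] : ~~ ([set: T] \subset B)%SET.
  by apply/negP => /subset_leq_card; rewrite cardsT Bk leqNgt kT.
exists (x |: B)%SET; rewrite cardsU1 xB Bk; split=> //.
exact: fintype.subset_trans AB (finset.subsetUr _ _).
Qed.

Lemma first_order_limit F G d q (U : set_system nat) (t : nat -> R)
    (a : nat -> 'rV[R]_n) : Filter U -> smooth2_at F G xs d q ->
  (forall k, 0 < t k) -> t k @[k --> U] --> 0 -> a k @[k --> U] --> d ->
  (F (xs + t k *: a k) - F xs) / t k @[k --> U] --> dot (G xs) d.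
Proof.
move=> FU [_ o2] t0 tU aU.
have H := o2 U t a FU (nearW FU t0) tU aU.
have H1 : dot (G xs) (a k) + t k * ((F (xs + t k *: a k) - F xs - t k * dot (G xs) (a k)) / t k ^+ 2)
    @[k --> U] --> dot (G xs) d + 0 * (q / 2).
  by apply: cvgD; [apply: cvg_dot => //; exact: cvg_cst|exact: (cvgM tU H)].
rewrite mul0r addr0 in H1; apply: cvg_trans H1; apply: near_eq_cvg; apply: nearW => k.
by field; exact: lt0r_neq0.
Qed.

(** The finitely many sets [I] with [s] elements cover the supports of all feasible
    points, so one of them can be fixed. *)
Lemma strict_min_on (I : {set 'I_n}) : #|I| = s ->
  \forall x \near xs, feasible s g h x -> supp x \subset I -> x != xs -> f xs < f x.
Proof.
move=> Is; apply: contrapT => Hn.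
have H k : exists z, [/\ `|z - xs| < k.+1%:R^-1, feasible s g h z,
    supp z \subset I, z != xs & f z <= f xs].
  apply: contrapT => /forallNP H; apply: Hn; apply/near_norm_lt.
  exists k.+1%:R^-1; first by rewrite invr_gt0.
  move=> z zk fz zI zN; rewrite ltNge; apply/negP => fle.
  by apply: (H z).
have [z Hz] := choice H.
pose t k := `|z k - xs|.
have t0 k : 0 < t k by rewrite normr_gt0 subr_eq0; have [] := Hz k.
pose a k := (t k)^-1 *: (z k - xs).
have a1 k : `|a k| = 1.
  by rewrite normrZ normfV ger0_norm ?(ltW (t0 k)) // mulVf // lt0r_neq0.
have zE k : z k = xs + t k *: a k.
  by rewrite scalerA divff ?scale1r ?lt0r_neq0 // addrC subrK.
have [U [UU ooU]] := ultraFilterLemma (eventually_filter).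
have invU : k.+1%:R^-1 @[k --> U] --> (0 : R).
  by apply: cvg_trans (@cvg_harmonic R); exact: cvg_app ooU.
have tU : t k @[k --> U] --> 0.
  apply/cvgr0Pnorm_lt => e e0.
  have : \forall k \near U, k.+1%:R^-1 < e by apply: cvgr_lt invU _ _.
  apply: filterS => k; apply: lt_trans.
  by rewrite ger0_norm ?(ltW (t0 k)) //; have [] := Hz k.
have [|d _ aU] := ultra_cvg_compact UU (@ball_compact R n 0 1) (v := a).
  by apply: nearW => k; rewrite /= subr0 a1.
have d1 : `|d| = 1.
  have H1 : `|a k| @[k --> U] --> `|d| by exact: cvg_norm.
  have H2 : `|a k| @[k --> U] --> (1 : R).
    by apply: cvg_trans (@cvg_cst _ (1 : R) _ U _); apply: near_eq_cvg; apply: nearW => k; rewrite a1.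
  exact: (cvg_unique _ H1 H2).
have dN0 : d != 0 by rewrite -normr_gt0 d1.
have zU : z k @[k --> U] --> xs.
  apply/cvgrPdist_lt => e e0.
  have : \forall k \near U, k.+1%:R^-1 < e by apply: cvgr_lt invU _ _.
  apply: filterS => k; apply: lt_trans.
  by rewrite distrC; have [] := Hz k.
have zI k i : i \notin I -> z k ord0 i = 0.
  move=> iI; apply/eqP; apply: contraNT iI => zi.
  by have [_ _ /fintype.subsetP zI _ _] := Hz k; apply: zI; rewrite inE.
have xsI i : i \notin I -> xs ord0 i = 0.
  move=> iI.
  have H1 := cvg_comp _ _ zU (@coord_continuous R 1 n ord0 i xs).
  have H2 : z k ord0 i @[k --> U] --> (0 : R).
    by apply: cvg_trans (@cvg_cst _ (0 : R) _ U _); apply: near_eq_cvg; apply: nearW => k; rewrite zI.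
  exact: (cvg_unique _ H1 H2).
have aI k i : i \notin I -> a k ord0 i = 0.
  by move=> iI; rewrite !mxE zI // xsI // subr0 mulr0.
have dI i : i \notin I -> d ord0 i = 0.
  move=> iI.
  have H1 := cvg_comp _ _ aU (@coord_continuous R 1 n ord0 i d).
  have H2 : a k ord0 i @[k --> U] --> (0 : R).
    by apply: cvg_trans (@cvg_cst _ (0 : R) _ U _); apply: near_eq_cvg; apply: nearW => k; rewrite aI.
  exact: (cvg_unique _ H1 H2).
have sub_supp (x : 'rV[R]_n) : (forall i, i \notin I -> x ord0 i = 0) -> supp x \subset I.
  by move=> H1; apply/fintype.subsetP => i; rewrite inE; apply: contraR => /H1->.
have FU : Filter U by typeclasses eauto.
have slope F (hF : C2 F) := first_order_limit FU (smooth2_C2 xs d hF) t0 tU aU.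
have slope_le0 F : C2 F -> (forall k, F (z k) <= F xs) -> dot (grad F xs) d <= 0.
  move=> hF Fle; apply: (cvgr_to_le (slope F hF)); apply: nearW => k.
  by rewrite -zE mulr_le0_ge0 ?subr_le0 // invr_ge0 ltW.
have [fg fh _] := feas.
have crit : critical_cone s f g h xs d.
  split.
  - move=> i; rewrite inE => /eqP gi; apply: (slope_le0 _ (hg i)) => k.
    by rewrite /coordf gi; have [_ [gk _ _] _ _ _] := Hz k.
  - move=> j; have H1 := slope _ (hh j).
    have H2 : (coordf h j (xs + t k *: a k) - coordf h j xs) / t k @[k --> U] --> (0 : R).
      apply: cvg_trans (@cvg_cst _ (0 : R) _ U _); apply: near_eq_cvg; apply: nearW => k.
      by rewrite -zE /coordf fh; have [_ [_ -> _] _ _ _] := Hz k; rewrite mxE subrr mul0r.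
    exact: (cvg_unique _ H1 H2).
  - exists I; split=> //; first exact: sub_supp.
    by apply/coord_spaceP; exact: sub_supp.
  - by apply: (slope_le0 _ hf) => k; have [] := Hz k.
have [lg [lh [eta [[[lg0 lgA] st e1 e2] so]]]] := sosc dN0 crit.
(* if the two supports have [s] elements together they exhaust [I], on which
   [eta] then vanishes; otherwise [eta] is zero *)
have eta_a k : dot eta (a k) = 0.
  have DI : supp xs :|: supp d \subset I by rewrite finset.subUset !sub_supp.
  move: (subset_leq_card DI); rewrite Is leq_eqVlt => /orP[/eqP Ds|/e2->]; last exact: dot0l.
  have DE : (supp xs :|: supp d)%SET = I by apply/eqP; rewrite eqEcard DI Ds Is leqnn.
  apply: big1 => i _; have [iI|iI] := boolP (i \in I); last by rewrite aI // mulr0.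
  by rewrite (e1 Ds) ?mul0r // DE.
pose F (t : 'I_m + 'I_p + unit) :=
  match t with inl (inl i) => coordf g i | inl (inr j) => coordf h j | _ => f end.
pose c (t : 'I_m + 'I_p + unit) := match t with inl (inl i) => lg ord0 i
  | inl (inr j) => lh ord0 j | _ => 1 end.
have hF o : C2 (F o) by case: o => [[]|].
have [_ o2] := smooth2_sum c (fun o => smooth2_C2 xs d (hF o)).
have H1 := o2 U t a FU (nearW FU t0) tU aU.
have QE : \sum_o c o * quadform (hessian (F o) xs) d =
    quadform (hess_lagrangian f g h xs lg lh) d.
  apply: etrans (esym (quadform_lagrangian xs lg lh d hf hg hh)).
  by rewrite !big_sumType /= sum_unit mul1r addrC addrA.
have GE : \sum_o c o *: grad (F o) xs = - eta.
  apply/eqP; rewrite -addr_eq0 !big_sumType /= sum_unit scale1r; apply/eqP.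
  have gE : \sum_i lg ord0 i *: grad (coordf g i) xs =
      \sum_(i in active_dir g xs d) lg ord0 i *: grad (coordf g i) xs.
    rewrite [RHS]big_mkcond; apply: eq_bigr => i _ /=.
    by case: ifPn => // /lgA->; rewrite scale0r.
  have hE : \sum_j lh ord0 j *: grad (coordf h j) xs =
      \sum_(j in finset.setT) lh ord0 j *: grad (coordf h j) xs.
    by apply: eq_bigl => j; rewrite inE.
  by rewrite gE hE (addrC _ (grad f xs)) -addrA st.
rewrite QE in H1.
suff : quadform (hess_lagrangian f g h xs lg lh) d / 2 <= 0.
  by rewrite leNgt divr_gt0.
apply: (cvgr_to_le H1); apply: nearW => k.
rewrite GE dotNl eta_a oppr0 mulr0 subr0 -zE -sumrB.
rewrite mulr_le0_ge0 ?invr_ge0 ?sqr_ge0 //.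
apply: sumr_le0 => o _; rewrite -mulrBr.
have [_ [gk hk _] _ _ fk] := Hz k.
case: o => [[i|j]|[]] /=.
- have [iA|/lgA->] := boolP (i \in active_dir g xs d); last by rewrite mul0r.
  rewrite mulr_ge0_le0 ?lg0 // subr_le0.
  by move: iA; rewrite !inE /coordf => /andP[/eqP-> _].
- by rewrite /coordf hk fh subrr mulr0.
- by rewrite mul1r subr_le0.
Qed.

Lemma second_order_sufficient : strict_local_minimizer s f g h xs.
Proof.
split=> //.
have : \forall x \near xs, forall I : {set 'I_n}, #|I| = s ->
    feasible s g h x -> supp x \subset I -> x != xs -> f xs < f x.
  apply: (@filter_forall _ {set 'I_n} (fun (I : {set 'I_n}) x => #|I| = s ->
    feasible s g h x -> supp x \subset I -> x != xs -> f xs < f x) (nbhs xs)) => I.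
  have [Is|nIs] := pselect (#|I| = s).
    by apply: filterS (strict_min_on Is) => x H _.
  by apply/near_norm_lt; exists 1.
move=> /nbhs_ballP[e /= e0 He]; exists e => // x xe fx xN.
have xs_le : (#|supp x| <= s)%N by have [] := fx.
have s_le : (s <= #|'I_n|)%N by rewrite card_ord ltnW.
have [I [xI Is]] := superset_card xs_le s_le.
exact: He xI xN.
Qed.

End Sufficient.

Unset Implicit Arguments.
Local Close Scope classical_set_scope.

Theorem corollary4p1 (R : realType) (n m p s : nat)
    (f : 'rV[R]_n -> R) (g : 'rV[R]_n -> 'rV[R]_m) (h : 'rV[R]_n -> 'rV[R]_p)
    (hf : C2 f) (hg : C2_vec g) (hh : C2_vec h) (hs : (s < n)%N) :
  (forall xs d : 'rV[R]_n,
     local_minimizer s f g h xs ->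
     critical_cone s f g h xs d ->
     SOSCMS s g h xs d \/
       (LICQ g h xs \/ NNAMCQ s g h xs \/ CRCQ s g h xs \/ RCRCQ s g h xs \/
        CPLD s g h xs \/ ERCPLD s g h xs \/ RCPLD s g h xs) ->
     M_stationary s f g h xs /\
     exists (lg : 'rV[R]_m) (lh : 'rV[R]_p) (eta : 'rV[R]_n),
       M_multiplier s f g h xs lg lh eta /\
       0 <= quadform (hess_lagrangian f g h xs lg lh) d)
  /\
  (forall xs : 'rV[R]_n,
     feasible s g h xs ->
     (forall d : 'rV[R]_n, d != 0 -> critical_cone s f g h xs d ->
        exists (lg : 'rV[R]_m) (lh : 'rV[R]_p) (eta : 'rV[R]_n),
          S_multiplier s f g h xs d lg lh eta /\
          0 < quadform (hess_lagrangian f g h xs lg lh) d) ->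
     strict_local_minimizer s f g h xs).
Proof.
split=> [xs d [feas [e e0 He]] [dg dh [I [xsI Is /coord_spaceP dI]] df] cq|xs feas sosc].
  have [|lg [lh [eta [M so]]]] := second_order_necessary hf hg hh xsI Is dI feas dg dh df _ cq.
    by exists e => // x xe; apply: He; rewrite -ball_normE /= distrC.
  by split; [exists lg, lh, eta|exists lg, lh, eta].
exact: second_order_sufficient.
Qed.
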